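(* Suppose that for some constants $0<c_1<C_1$ we have $c_1\le\bar{\mathrm E}[x_{ij}^2]\le C_1$ for all $1\le j\le p$. Moreover, suppose that $\zeta_1,\zeta_2\ge 0$ are such that $$\mathrm P(|T-T_0|>\zeta_1)<\zeta_2\qquad\text{and}\qquad \mathrm P\big(\mathrm P_e(|W-W_0|>\zeta_1)>\zeta_2\big)<\zeta_2 .$$ Then there are constants $C_2,C_3>0$ depending only on $c_1$ and $C_1$ such that, with $\pi(\vartheta):=C_2\vartheta^{1/3}(1\vee\log(p/\vartheta))^{2/3}$, for every $\vartheta>0$, $$\rho_\ominus:=\sup_{\alpha\in(0,1)}\mathrm P\big(\{T\le c_W(\alpha)\}\ominus\{T_0\le c_{Z_0}(\alpha)\}\big)\le 2\big(\rho+\pi(\vartheta)+\mathrm P(\Delta>\vartheta)\big)+C_3\zeta_1\sqrt{1\vee\log(p/\zeta_1)}+5\zeta_2 .$$ In addition, $\sup_{\alpha\in(0,1)}|\mathrm P(T\le c_W(\alpha))-\alpha|\le\rho_\ominus+\rho$.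
   Context: Let $n\ge 1$ and $p\ge 3$ be integers. Let $x_1,\dots,x_n$ be independent random vectors in $\mathbb R^p$, $x_i=(x_{i1},\dots,x_{ip})'$, with $\mathrm E[x_i]=0$ and finite covariance matrices. Let $y_1,\dots,y_n$ be independent Gaussian vectors, $y_i\sim N(0,\mathrm E[x_ix_i'])$, and let $e_1,\dots,e_n$ be i.i.d. $N(0,1)$ variables independent of $(x_i)_{i=1}^n$. Put $$T_0=\max_{1\le j\le p}\frac1{\sqrt n}\sum_{i=1}^n x_{ij},\quad Z_0=\max_{1\le j\le p}\frac1{\sqrt n}\sum_{i=1}^n y_{ij},\quad W_0=\max_{1\le j\le p}\frac1{\sqrt n}\sum_{i=1}^n x_{ij}e_i,$$ $\rho:=\sup_{t\in\mathbb R}|\mathrm P(T_0\le t)-\mathrm P(Z_0\le t)|$. $T=T(x_1,\dots,x_n)$ and $W=W(x_1,\dots,x_n,e_1,\dots,e_n)$ are real-valued statistics (measurable functions of the indicated variables), not necessarily of the form of $T_0$, $W_0$. Notation: $\mathbb E_n[\cdot]=n^{-1}\sum_{i=1}^n[\cdot]$, $\bar{\mathrm E}[\cdot]=n^{-1}\sum_{i=1}^n\mathrm E[\cdot]$, $a\vee b=\max\{a,b\}$, $A\ominus B=(A\setminus B)\cup(B\setminus A)$, and $\Delta:=\max_{1\le j,k\le p}|\mathbb E_n[x_{ij}x_{ik}]-\bar{\mathrm E}[x_{ij}x_{ik}]|$. $\mathrm P_e$ denotes probability with respect to $(e_i)_{i=1}^n$ conditional on $(x_i)_{i=1}^n$.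 Quantiles: $c_{Z_0}(\alpha):=\inf\{t\in\mathbb R:\mathrm P(Z_0\le t)\ge\alpha\}$ and $c_W(\alpha):=\inf\{t\in\mathbb R:\mathrm P_e(W\le t)\ge\alpha\}$ (the latter is a function of the data). The expression $\zeta_1\sqrt{1\vee\log(p/\zeta_1)}$ is read as $0$ when $\zeta_1=0$. *)

(* Defs.v *)
From HB Require Import structures.
From mathcomp Require Import all_boot all_order all_algebra.
From mathcomp Require Import all_classical all_reals all_analysis.

Set Implicit Arguments.
Unset Strict Implicit.
Unset Printing Implicit Defensive.

Import Order.TTheory GRing.Theory Num.Theory.
Import numFieldNormedType.Exports.

Local Open Scope classical_set_scope.
Local Open Scope ring_scope.

Section probability_notions.
Context d (Omega : measurableType d) (R : realType) (P : probability Omega R).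

Definition Pr (A : set Omega) : R := fine (P A).

Definition Ex (X : Omega -> R) : R := fine 'E_P[X].

Definition mutually_independent (I : finType) d' (T' : measurableType d')
    (X : I -> Omega -> T') : Prop :=
  forall (J : {set I}) (A : I -> set T'), (forall i, measurable (A i)) ->
    Pr (\bigcap_(i in [set` J]) X i @^-1` A i)
    = \prod_(i in J) Pr (X i @^-1` A i).

Definition independent d1 d2 (T1 : measurableType d1) (T2 : measurableType d2)
    (X : Omega -> T1) (Y : Omega -> T2) : Prop :=
  forall A B, measurable A -> measurable B ->
    Pr (X @^-1` A `&` Y @^-1` B) = Pr (X @^-1` A) * Pr (Y @^-1` B).

Definition has_law d' (T' : measurableType d') (X : Omega -> T')
    (mu : set T' -> \bar R) : Prop :=
  forall A, measurable A -> P (X @^-1` A) = mu A.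

(* N(0, v) on the line. The library's [normal_prob m s] takes the standard
   deviation [s] and is a uniform law when [s = 0], hence the case split. *)
Definition normal0 (v : R) : set R -> \bar R :=
  if v == 0 then \d_(0 : R) else normal_prob 0 (Num.sqrt v).

(* [Y ~ N(0, S)], [S] possibly singular: every linear form [a Y] has law
   [N(0, a S a^T)]. *)
Definition gaussian_vector p (Y : Omega -> p.-tuple R) (S : 'M[R]_p) : Prop :=
  forall a : 'rV[R]_p,
    has_law (fun w => \sum_(j < p) a 0 j * tnth (Y w) j)
            (normal0 ((a *m S *m a^T) 0 0)).

Definition second_moment_mx p (X : Omega -> p.-tuple R) : 'M[R]_p :=
  \matrix_(j, k) Ex (fun w => tnth (X w) j * tnth (X w) k).

End probability_notions.

Section max_statistics.
Context (R : realType).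

(* The maximum of the [f j]; meant for [p > 0], see [vmaxP]. *)
Definition vmax p (f : 'I_p -> R) : R :=
  fine (\big[maxe/-oo%E]_(j < p) (f j)%:E).

Lemma vmaxP p (f : 'I_p -> R) : (0 < p)%N ->
  (exists j, vmax f = f j) /\ (forall j, f j <= vmax f).
Proof.
move=> p_gt0.
have /= max_arg := bigmax_eq_arg -oo%E (Ordinal p_gt0) xpredT
  (fun j => (f j)%:E) isT (fun j _ => leNye _).
have vmaxE : (vmax f)%:E = \big[maxe/-oo%E]_(j < p) (f j)%:E.
  by rewrite /vmax max_arg.
split=> [|k]; first by rewrite /vmax max_arg; eexists.
by rewrite -lee_fin vmaxE; exact: (le_bigmax -oo%E (fun j => (f j)%:E)).
Qed.

Definition max_scaled_sum n p (u : 'I_n -> 'I_p -> R) : R :=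
  vmax (fun j => (Num.sqrt n%:R)^-1 * \sum_(i < n) u i j).

Definition emp_mean n (f : 'I_n -> R) : R := n%:R^-1 * \sum_(i < n) f i.

End max_statistics.

Section bootstrap.
Context d (Omega : measurableType d) (R : realType) (P : probability Omega R).
Context (n p : nat).
Variables (x y : 'I_n -> Omega -> p.-tuple R) (e : 'I_n -> Omega -> R).

Definition data (w : Omega) : n.-tuple (p.-tuple R) := [tuple x i w | i < n].

Definition multipliers (w : Omega) : n.-tuple R := [tuple e i w | i < n].

Definition T0 (u : n.-tuple (p.-tuple R)) : R :=
  max_scaled_sum (fun i j => tnth (tnth u i) j).

Definition W0 (z : n.-tuple (p.-tuple R) * n.-tuple R) : R :=
  max_scaled_sum (fun i j => tnth (tnth z.1 i) j * tnth z.2 i).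

Definition Z0 (w : Omega) : R := max_scaled_sum (fun i j => tnth (y i w) j).

Definition rho : R :=
  sup [set `|Pr P [set w | T0 (data w) <= t] - Pr P [set w | Z0 w <= t]|
      | t in [set: R]].

Definition Delta (w : Omega) : R :=
  vmax (fun j : 'I_p => vmax (fun k : 'I_p =>
    `|emp_mean (fun i => tnth (x i w) j * tnth (x i w) k)
      - emp_mean (fun i =>
          Ex P (fun w' => tnth (x i w') j * tnth (x i w') k))|)).

(* Conditional probability given [x = u] of the event [(x, e) \in A]. Since [e]
   is independent of [x], this is the law of [e] applied to the section of [A]
   at [u]. *)
Definition Pe (A : set (n.-tuple (p.-tuple R) * n.-tuple R))
    (u : n.-tuple (p.-tuple R)) : R :=
  Pr P [set w | A (u, multipliers w)].

Definition cZ0 (alpha : R) : R :=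
  inf [set t | alpha <= Pr P [set w | Z0 w <= t]].

Definition cW (W : n.-tuple (p.-tuple R) * n.-tuple R -> R) (alpha : R)
    (u : n.-tuple (p.-tuple R)) : R :=
  inf [set t | alpha <= Pe [set z | W z <= t] u].

Definition rho_ominus (T : n.-tuple (p.-tuple R) -> R)
    (W : n.-tuple (p.-tuple R) * n.-tuple R -> R) : R :=
  sup [set Pr P ([set w | T (data w) <= cW W alpha (data w)]
                 `+` [set w | T0 (data w) <= cZ0 alpha])
      | alpha in `]0, 1[].

End bootstrap.

Definition pi_bound (R : realType) (C2 : R) (p : nat) (theta : R) : R :=
  C2 * theta `^ (1 / 3) * (Num.max 1 (ln (p%:R / theta))) `^ (2 / 3).

(* Vanishes at [zeta = 0] because of the factor [zeta]. *)
Definition zeta_bound (R : realType) (p : nat) (zeta : R) : R :=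
  zeta * Num.sqrt (Num.max 1 (ln (p%:R / zeta))).

(* Main.v *)
(** Given the data, [W0] is the maximum of a centered Gaussian vector with the
    empirical covariance, while [Z0] is the maximum of one with the averaged
    covariance, and [Delta] is the entrywise distance of the two covariances.

    Comparison: for the log-sum-exp function with parameter [beta], interpolating
    between two Gaussian vectors changes the expectation by at most [beta] times
    that distance. The difference quotient in [s] of the log-sum-exp of [(v, s)]
    is a smooth version of the indicator of [max v <= s].

    Anti-concentration: dilating a Gaussian vector amounts to adding an
    independent copy, so the expected Hessian trace of log-sum-exp is at most the
    expected softmax mean of the coordinates, of order [sqrt (log p)]. The trace
    also dominates [beta] times the probability of a band of width [1 / beta]
    around the maximum.

    Together they bound the distance of the distribution functions of [W0] (given
    the data) and [Z0] by [pi], and show that the one of [Z0] is Lipschitz.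
    Off the exceptional events, [T <= c_W] and [T0 <= c_Z0] can then differ only
    when [P(Z0 <= t)] at [t = T0] is close to [alpha], which is unlikely because
    [T0] and [Z0] have close distribution functions. *)

Require Import Defs.
From HB Require Import structures.
From mathcomp Require Import all_boot all_order all_algebra.
From mathcomp Require Import all_classical all_reals all_analysis.
From mathcomp Require Import measurable_realfun ring lra.
Import Order.TTheory GRing.Theory Num.Theory.
Import numFieldNormedType.Exports.
Local Open Scope classical_set_scope.
Local Open Scope ring_scope.

Set Implicit Arguments.
Unset Strict Implicit.
Unset Printing Implicit Defensive.

(** A Gaussian vector is specified only through the laws of its linear forms, while the argument
    keeps replacing one vector by another of the same covariance on a different, often product,
    probability space. Hence uniqueness of laws from real characteristic functions has to precede
    any comparison. The parameter [K] of log-sum-exp adds one deterministic coordinate to the soft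
    maximum. With [K = expR (beta * s)] it is the level [s] of the smooth indicator. With [K = 1] it
    is the level 0, and the softmax weights of the other coordinates then add up to less than 1,
    which keeps the Hessian trace away from 0 on a band. Final bounds may involve [p] only through
    [ln p]. The third-order remainders depend on [p] more heavily, but they carry a step size that
    is sent to 0. The exponent 1/3 comes from smoothing at a scale [w]: comparison costs
    [L * theta / w ^+ 2], anti-concentration costs [sqrt L * w], and both are of order
    [theta^(1/3) L^(2/3)] when [w = theta^(1/3) L^(1/6)]. For [theta >= 1] or [zeta1 > 1] the
    right-hand side is at least 1 and nothing is left to prove. *)

(** * Expectations and probabilities as real numbers *)

Section expectation_lemmas.
Context d (T : measurableType d) (R : realType) (P : probability T R).
Implicit Types f g : T -> R.

Definition integ f := P.-integrable setT (EFin \o f).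

Lemma integ_meas f : integ f -> measurable_fun setT f.
Proof. by move=> /integrableP[] /measurable_EFinP. Qed.

Lemma integ_cst (c : R) : integ (cst c).
Proof. exact: finite_measure_integrable_cst. Qed.

Lemma integ_dom f g : measurable_fun setT f -> (forall w, `|f w| <= g w) ->
  integ g -> integ f.
Proof.
move=> mf fg ig; apply: (le_integrable measurableT _ _ ig).
  exact/measurable_EFinP.
by move=> w _ /=; rewrite lee_fin (le_trans (fg w))// ler_norm.
Qed.

Lemma integ_bounded f (C : R) : measurable_fun setT f ->
  (forall w, `|f w| <= C) -> integ f.
Proof. by move=> mf fC; exact: (integ_dom mf fC (integ_cst C)). Qed.

Lemma integD f g : integ f -> integ g -> integ (fun w => f w + g w).
Proof. by move=> fi gi; exact: (integrableD measurableT fi gi). Qed.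

Lemma integB f g : integ f -> integ g -> integ (fun w => f w - g w).
Proof. by move=> fi gi; exact: (integrableB measurableT fi gi). Qed.

Lemma integZ (k : R) f : integ f -> integ (fun w => k * f w).
Proof. by move=> fi; exact: (integrableZl measurableT k fi). Qed.

Lemma integ_norm f : integ f -> integ (fun w => `|f w|).
Proof. exact: integrable_norm. Qed.

Lemma integ_sum (I : finType) (h : I -> T -> R) :
  (forall i, integ (h i)) -> integ (fun w => \sum_i h i w).
Proof.
move=> hi; have := integrable_sum measurableT (index_enum I) (P := xpredT)
  (h := fun i => EFin \o h i) (fun i _ => hi i).
by apply: eq_integrable => // w _; rewrite /= sumEFin.
Qed.

Lemma EEcst (c : R) : \int[P]_w c = c.
Proof. by rewrite Rintegral_cst// [X in fine X](@probability_setT _ _ _ P) mulr1. Qed.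

Lemma EED f g : integ f -> integ g ->
  \int[P]_w (f w + g w) = \int[P]_w f w + \int[P]_w g w.
Proof. by move=> fi gi; rewrite RintegralD. Qed.

Lemma EEB f g : integ f -> integ g ->
  \int[P]_w (f w - g w) = \int[P]_w f w - \int[P]_w g w.
Proof. by move=> fi gi; rewrite RintegralB. Qed.

Lemma EEZ (k : R) f : integ f -> \int[P]_w (k * f w) = k * \int[P]_w f w.
Proof. by move=> fi; rewrite RintegralZl. Qed.

Lemma EEle f g : integ f -> integ g -> (forall w, f w <= g w) ->
  \int[P]_w f w <= \int[P]_w g w.
Proof. by move=> fi gi fg; apply: le_Rintegral. Qed.

Lemma EEnorm f : integ f -> `|\int[P]_w f w| <= \int[P]_w `|f w|.
Proof. by move=> fi; apply: le_normr_Rintegral. Qed.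

Lemma EE_seqsum (I : Type) (s : seq I) (h : I -> T -> R) : (forall i, integ (h i)) ->
  integ (fun w => \sum_(i <- s) h i w) /\
  \int[P]_w (\sum_(i <- s) h i w) = \sum_(i <- s) \int[P]_w h i w.
Proof.
move=> hi; elim: s => [|i s [si sE]].
  split; last by rewrite big_nil -[RHS]EEcst; apply: eq_Rintegral => w _; rewrite big_nil.
  by rewrite (_ : (fun _ => _) = cst 0); [exact: integ_cst|apply/funext=> w; rewrite big_nil].
have -> : (fun w => \sum_(j <- i :: s) h j w) = (fun w => h i w + \sum_(j <- s) h j w).
  by apply/funext => w; rewrite big_cons.
by split; [exact: integD|rewrite big_cons EED// sE].
Qed.

Lemma EEsum (I : finType) (h : I -> T -> R) : (forall i, integ (h i)) ->
  \int[P]_w (\sum_i h i w) = \sum_i \int[P]_w h i w.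
Proof. by move=> hi; have [] := EE_seqsum (index_enum I) hi. Qed.

Lemma PrE A : measurable A -> Pr P A = \int[P]_w \1_A w.
Proof. by move=> mA; rewrite /Pr /Rintegral integral_indic// setIT. Qed.

Lemma ExE f : Ex P f = \int[P]_w f w.
Proof. by rewrite /Ex unlock. Qed.

Lemma Pr_ge0 A : 0 <= Pr P A. Proof. by rewrite /Pr fine_ge0. Qed.

Lemma EFin_Pr A : measurable A -> (Pr P A)%:E = P A.
Proof. by move=> mA; rewrite /Pr fineK// fin_num_measure. Qed.

Lemma Pr_le1 A : measurable A -> Pr P A <= 1.
Proof. by move=> mA; rewrite -lee_fin EFin_Pr// probability_le1. Qed.

Lemma Pr_le A B : measurable A -> measurable B -> A `<=` B -> Pr P A <= Pr P B.
Proof. by move=> mA mB AB; rewrite -lee_fin !EFin_Pr// le_measure// inE. Qed.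

Lemma Pr_setU_le A B : measurable A -> measurable B ->
  Pr P (A `|` B) <= Pr P A + Pr P B.
Proof.
move=> mA mB; rewrite -lee_fin EFinD !EFin_Pr//; last exact: measurableU.
exact: measureU2.
Qed.

Lemma integ_indic A : measurable A -> integ \1_A.
Proof.
move=> mA; apply: (@integ_bounded _ 1); first exact: measurable_indic.
by move=> w; rewrite indicE; case: (_ \in _); rewrite ?normr1 ?normr0.
Qed.

Lemma EE_bounded_cvg (f_ : nat -> T -> R) f (C : R) :
  (forall n, measurable_fun setT (f_ n)) ->
  (forall n w, `|f_ n w| <= C) ->
  (forall w, f_ ^~ w @ \oo --> f w) ->
  (fun n => \int[P]_w f_ n w) @ \oo --> \int[P]_w f w.
Proof.
move=> mf_ fC ff.
have mf : measurable_fun setT f.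
  by apply: (@measurable_fun_cvg _ _ _ _ f_ f) => // w _; exact: ff.
have [] := @dominated_convergence _ _ _ P setT measurableT
  (fun n => EFin \o f_ n) (EFin \o f) (cst C%:E).
- by move=> n; exact/measurable_EFinP.
- exact/measurable_EFinP.
- by apply: aeW => w _; apply: cvg_EFin; [exact: nearW|exact: ff].
- exact: finite_measure_integrable_cst.
- by apply: aeW => w n _ /=; rewrite lee_fin.
move=> fi _ fcvg.
apply: fine_cvg => //=; rewrite /Rintegral fineK//.
exact: integrable_fin_num.
Qed.

End expectation_lemmas.

(** * Taylor bounds on the line *)

Section taylor.
Context (R : realType).
Implicit Types f : R -> R.

Lemma mean_value0 f f1 (h : R) : (forall x, is_derive x (1 : R) f (f1 x)) ->
  exists2 c, `|c| <= `|h| & f h - f 0 = f1 c * h.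
Proof.
move=> df.
have cf : continuous f.
  by move=> x; apply/differentiable_continuous/derivable1_diffP; case: (df x).
have [h0|h0] := leP 0 h.
  have [c] := @MVT_segment R f f1 0 h h0 (fun x _ => df x)
    (continuous_subspaceT cf).
  rewrite in_itv/= subr0 => /andP[c0 ch] E; exists c => //.
  by rewrite !ger0_norm.
have [c] := @MVT_segment R f f1 h 0 (ltW h0) (fun x _ => df x)
  (continuous_subspaceT cf).
rewrite in_itv/= => /andP[ch c0] E; exists c.
  by rewrite !ler0_norm ?lerN2// ltW.
by rewrite -opprB E sub0r mulrN opprK.
Qed.

(** Two mean value theorems in a row. The factor 1/2 of the sharp remainder is lost; only the order
    in [h] matters later. *)
Lemma taylor2_bound f f1 f2 (K h : R) :
  (forall x, is_derive x (1 : R) f (f1 x)) -> (forall x, is_derive x (1 : R) f1 (f2 x)) ->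
  (forall x, `|f2 x| <= K) -> `|f h - f 0 - h * f1 0| <= K * h ^+ 2.
Proof.
move=> df df1 f2K.
have [c ch ->] := mean_value0 h df.
have [c' _ E] := mean_value0 c df1.
have -> : f1 c * h - h * f1 0 = h * (f2 c' * c) by rewrite -E; ring.
rewrite !normrM -(real_normK (num_real h)) expr2 mulrCA.
by rewrite ler_pM ?mulr_ge0// ler_wpM2l.
Qed.

(** Once the quadratic part is subtracted from [f], the derivative is the remainder of [f1]
    controlled by [taylor2_bound], so one more mean value theorem suffices. *)
Lemma taylor3_bound f f1 f2 f3 (K h : R) :
  (forall x, is_derive x (1 : R) f (f1 x)) -> (forall x, is_derive x (1 : R) f1 (f2 x)) ->
  (forall x, is_derive x (1 : R) f2 (f3 x)) ->
  (forall x, `|f3 x| <= K) ->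
  `|f h - f 0 - h * f1 0 - h ^+ 2 / 2 * f2 0| <= K * `|h| ^+ 3.
Proof.
move=> df df1 df2 f3K.
pose g x := f x - x * f1 0 - x ^+ 2 / 2 * f2 0.
have dg x : is_derive x (1 : R) g (f1 x - f1 0 - x * f2 0).
  rewrite /g; have := df x => ?.
  by apply: is_derive_eq; rewrite !scaler0 /GRing.scale/=; field.
have [c ch E] := mean_value0 h dg.
have -> : f h - f 0 - h * f1 0 - h ^+ 2 / 2 * f2 0 = g h - g 0.
  by rewrite /g; ring.
rewrite E normrM exprS mulrCA mulrC ler_wpM2l//.
have K0 : 0 <= K by exact: le_trans (f3K 0).
rewrite (le_trans (taylor2_bound c df1 df2 f3K))// ler_wpM2l//.
by rewrite real_normK ?num_real// -(real_normK (num_real c)) -(real_normK (num_real h)) lerXn2r ?nnegrE.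
Qed.

(** A pointwise Taylor bound can be integrated before this criterion is applied, which
    differentiates under an expectation without a domination argument. *)
Lemma is_derive_quadratic f (t a K : R) :
  (forall h, `|f (t + h) - f t - h * a| <= K * h ^+ 2) -> is_derive t (1 : R) f a.
Proof.
move=> fK; have K0 : 0 <= K.
  by have := fK 1; rewrite expr1n mulr1; apply: le_trans.
have cvg : (fun h => h^-1 *: (f (h *: 1 + t) - f t)) @ 0^' --> a.
  apply/cvgrPdist_le => e e0; near=> h.
  have h0 : h != 0 by near: h; exact: nbhs_dnbhs_neq.
  rewrite /GRing.scale/= mulr1 (addrC h).
  have -> : a - h^-1 * (f (t + h) - f t) = - (h^-1 * (f (t + h) - f t - h * a)).
    by field.
  rewrite normrN normrM normfV ler_pdivrMl ?normr_gt0//.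
  rewrite (le_trans (fK h))// -real_normK ?num_real// expr2 mulrA mulrC.
  rewrite ler_wpM2l//.
  have : `|h| <= e / (K + 1).
    near: h; apply: dnbhs0_le; rewrite divr_gt0// ltr_wpDl//.
  rewrite ler_pdivlMr ?ltr_wpDl// => he.
  rewrite (le_trans _ he)// mulrC ler_wpM2l// lerDl//.
split; first by apply/cvg_ex; exists a.
exact: cvg_lim.
Unshelve. all: by end_near. Qed.

Lemma cos_quadratic (y k : R) : `|cos (y + k) - cos y + k * sin y| <= k ^+ 2.
Proof.
have d0 x : is_derive x (1 : R) (fun k => cos (y + k)) (- sin (y + x)).
  by apply: is_derive_eq; rewrite /GRing.scale/=; ring.
have d1 x : is_derive x (1 : R) (fun k => - sin (y + k)) (- cos (y + x)).
  by apply: is_derive_eq; rewrite /GRing.scale/=; ring.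
have := @taylor2_bound _ _ _ 1 k d0 d1.
rewrite addr0 mulrN opprK mul1r; apply => x.
by rewrite normrN ler_norml cos_le1 cos_geN1.
Qed.

End taylor.

(** * The centered normal law *)

Section normal_law.
Context (R : realType) (s : R) (s_gt0 : 0 < s).
Notation mu := (@lebesgue_measure R).
Notation N := (normal_prob 0 s).
Implicit Types f : R -> R.

Let s_neq0 : s != 0. Proof. by rewrite gt_eqF. Qed.

(** The change of variables holds with the Radon-Nikodym derivative, which agrees almost everywhere
    with the density because both have the same integral over every measurable set. *)
Lemma integral_normal_prob (f : R -> \bar R) : N.-integrable setT f ->
  (\int[N]_x f x = \int[mu]_x (f x * (normal_pdf 0 s x)%:E))%E.
Proof.
move=> fi; have dom := normal_prob_dominates (0 : R) s.
rewrite -(Radon_Nikodym_change_of_variables dom)//=.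
have mf := measurable_int _ fi.
apply: ae_eq_integral => //.
- exact: emeasurable_funM.
- apply: emeasurable_funM => //=; apply/measurableT_comp => //=.
  exact: measurable_normal_pdf.
- apply: ae_eqe_mul2l => /=.
  rewrite Radon_NikodymE//=; case: cid => /= h [h1 h2 h3].
  apply: integral_ae_eq => //=.
  + by apply/measurableT_comp =>//; exact: measurable_normal_pdf.
  + by move=> E E01 mE; rewrite -h3.
Qed.

(** The exponential removes half of the Gaussian exponent and leaves the density of variance
    [2 * s ^+ 2]. The resulting exponential moment, at most [sqrt 2], is the source of integrability
    for powers and of the [sqrt (ln p)] bound on softmax means. *)
Lemma normal_pdf_sqexp (x : R) :
  expR (x ^+ 2 / (4 * s ^+ 2)) * normal_pdf 0 s x
  = Num.sqrt 2 * normal_pdf 0 (Num.sqrt 2 * s) x.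
Proof.
have s20 : Num.sqrt 2 * s != 0 by rewrite mulf_neq0// gt_eqF// sqrtr_gt0.
rewrite !normal_pdfE// /normal_peak /normal_fun [LHS]mulrCA -expRD [RHS]mulrA.
have s2E : Num.sqrt 2 ^+ 2 = 2 :> R by rewrite sqr_sqrtr.
rewrite exprMn s2E !subr0.
have -> : x ^+ 2 / (4 * s ^+ 2) + - x ^+ 2 / (s ^+ 2 *+ 2)
  = - x ^+ 2 / ((2 * s ^+ 2) *+ 2) by field.
congr (_ * _).
have -> : Num.sqrt (2 * s ^+ 2 * pi *+ 2) = Num.sqrt 2 * Num.sqrt (s ^+ 2 * pi *+ 2).
  by rewrite -sqrtrM//; congr Num.sqrt; ring.
by rewrite invfM mulrA divff ?mul1r// gt_eqF// sqrtr_gt0.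
Qed.

Let sqexp (x : R) := expR (x ^+ 2 / (4 * s ^+ 2)).

Let measurable_sqexp : measurable_fun setT sqexp.
Proof.
apply: measurableT_comp => //.
by apply: measurable_funM => //; apply: measurable_funX.
Qed.

(** Passing to the density presupposes integrability, the very thing to be established. Truncation
    at [n] supplies it; monotone convergence removes the truncation afterwards. *)
Lemma le_integral_normal_sqexp_min (n : nat) :
  (\int[N]_x (Num.min (sqexp x) n%:R)%:E <= (Num.sqrt 2)%:E)%E.
Proof.
have mf : measurable_fun setT (fun x : R => Num.min (sqexp x) n%:R).
  exact: measurable_minr.
have f0 x : 0 <= Num.min (sqexp x) n%:R :> R.
  by rewrite le_min expR_ge0 ler0n.
rewrite integral_normal_prob; last first.
  apply: (@integ_bounded _ _ _ N _ n%:R mf) => x.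
  by rewrite ger0_norm// ge_min lexx orbT.
rewrite -[leRHS]mule1 -(integral_normal_pdf 0 (Num.sqrt 2 * s)).
rewrite -ge0_integralZl//=; last first.
- by move=> x _; rewrite lee_fin normal_pdf_ge0.
- by apply/measurable_EFinP; exact: measurable_normal_pdf.
apply: ge0_le_integral => //=.
- by move=> x _; rewrite lee_fin mulr_ge0// normal_pdf_ge0.
- by apply/measurable_EFinP; apply: measurable_funM => //; exact: measurable_normal_pdf.
- by apply/measurable_EFinP; apply: measurable_funM => //; exact: measurable_normal_pdf.
move=> x _; rewrite -!EFinM lee_fin -normal_pdf_sqexp ler_wpM2r ?normal_pdf_ge0//.
by rewrite ge_min lexx.
Qed.

Lemma le_integral_normal_sqexp : (\int[N]_x (sqexp x)%:E <= (Num.sqrt 2)%:E)%E.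
Proof.
have cf : (fun n => \int[N]_x (Num.min (sqexp x) n%:R)%:E)%E @ \oo --> (\int[N]_x (sqexp x)%:E)%E.
  pose g n (x : R) := (Num.min (sqexp x) n%:R)%:E.
  rewrite (_ : integral _ _ _ = \int[N]_x limn (g ^~ x))%E; last first.
    apply: eq_integral => x _; apply/esym/cvg_lim => //; rewrite /g.
    apply: cvg_EFin; first exact: nearW.
    apply: cvg_near_cst; near=> n; apply/min_idPl.
    by near: n; exact: nbhs_infty_ger.
  apply: cvg_monotone_convergence => //=.
  - by move=> n; apply/measurable_EFinP; apply: measurable_minr.
  - by move=> n x _; rewrite lee_fin le_min expR_ge0 ler0n.
  - move=> x _ m n mn; rewrite lee_fin le_min ge_min lexx/= ge_min.
    by rewrite (_ : m%:R <= n%:R)// ?orbT// ler_nat.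
apply: (cvge_to_le cf); apply: nearW => n.
exact: le_integral_normal_sqexp_min.
Unshelve. all: by end_near. Qed.

Lemma integ_normal_sqexp : integ N sqexp.
Proof.
apply/integrableP; split; first exact/measurable_EFinP.
under eq_integral do rewrite /= ger0_norm ?expR_ge0//.
by apply: (le_lt_trans le_integral_normal_sqexp); exact: ltry.
Qed.

Lemma EE_normal_sqexp : \int[N]_x sqexp x <= Num.sqrt 2.
Proof.
rewrite -lee_fin /Rintegral fineK ?le_integral_normal_sqexp//.
exact: (integrable_fin_num measurableT integ_normal_sqexp).
Qed.
End normal_law.

Section normal_ibp.
Context (R : realType) (s : R) (s_gt0 : 0 < s).
Notation mu := (@lebesgue_measure R).
Notation N := (normal_prob 0 s).
Notation pdf := (normal_pdf 0 s).
Implicit Types f : R -> R.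

Lemma integrable_mul_normal_pdf f : integ N f ->
  mu.-integrable setT (fun x => (f x * pdf x)%:E).
Proof.
move=> fi; have mf := integ_meas fi.
have mfp : measurable_fun setT (fun x => f x * pdf x).
  by apply: measurable_funM => //; exact: measurable_normal_pdf.
apply/integrableP; split; first exact/measurable_EFinP.
have := integral_normal_prob (integ_norm fi).
under [in X in _ = X -> _]eq_integral => x _.
  rewrite /= -EFinM -{1}(ger0_norm (normal_pdf_ge0 0 s x)) -normrM; over.
move=> <-.
by have /integrableP[_] := fi.
Qed.

Lemma Rintegral_normal_prob f : integ N f ->
  \int[N]_x f x = \int[mu]_x (f x * pdf x).
Proof. by move=> fi; rewrite /Rintegral integral_normal_prob. Qed.

Lemma is_derive_normal_pdf (x : R) :
  is_derive x (1 : R) pdf (- (x / s ^+ 2) * pdf x).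
Proof.
have s0 : s != 0 by rewrite gt_eqF.
rewrite normal_pdfE// /normal_fun.
have -> : (fun x : R => normal_peak s * expR (- (x - 0) ^+ 2 / (s ^+ 2 *+ 2)))
   = (fun x : R => normal_peak s * expR (- (s ^+ 2 *+ 2)^-1 * x ^+ 2)).
  by apply/funext => y; rewrite subr0 !mulNr (mulrC (y ^+ 2)).
apply: is_derive_eq.
rewrite /GRing.scale/= subr0.
have -> : - (s ^+ 2 *+ 2)^-1 * x ^+ 2 = - x ^+ 2 / (s ^+ 2 *+ 2) by ring.
by field.
Qed.

(** The integrand is the derivative of [f * pdf], the logarithmic derivative of the density being
    [- x / s ^+ 2]. *)
Lemma normal_pdf_itvN (n : nat) (f f1 : R -> R) :
  (forall x, is_derive x (1 : R) f (f1 x)) -> continuous f1 ->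
  \int[mu]_(x in `[- n.+1%:R, n.+1%:R]) (f1 x * pdf x - (s ^+ 2)^-1 * (x * f x * pdf x))
  = f n.+1%:R * pdf n.+1%:R - f (- n.+1%:R) * pdf (- n.+1%:R).
Proof.
move=> df cf1.
have cf : continuous f.
  by move=> x; apply/differentiable_continuous/derivable1_diffP; case: (df x).
have cpdf : continuous pdf by apply: continuous_normal_pdf; rewrite gt_eqF.
pose h x := f x * pdf x.
pose h1 x := f1 x * pdf x - (s ^+ 2)^-1 * (x * f x * pdf x).
have dh x : is_derive x (1 : R) h (h1 x).
  have := df x; have := is_derive_normal_pdf x => ? ?.
  rewrite /h; apply: is_derive_eq; rewrite /h1 /GRing.scale/=; ring.
have ch : continuous h.
  by move=> x; apply/differentiable_continuous/derivable1_diffP; case: (dh x).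
have ch1 : continuous h1.
  move=> x; apply: cvgB; first by apply: cvgM; [exact: cf1|exact: cpdf].
  apply: cvgM; first exact: cvg_cst.
  apply: cvgM; last exact: cpdf.
  by apply: cvgM; [exact: cvg_id|exact: cf].
rewrite /Rintegral (@continuous_FTC2 _ h1 h)//.
- by rewrite ltrNl (lt_trans _ (ltr0Sn _ n))// oppr_lt0.
- exact: continuous_subspaceT.
- split.
  + by move=> x _; case: (dh x).
  + exact/cvg_at_right_filter/ch.
  + exact/cvg_at_left_filter/ch.
- by move=> x _; rewrite derive1E; apply: derive_val; exact: dh.
Qed.

Lemma integ_normal_sqr : integ N (fun x => x ^+ 2).
Proof.
apply: (integ_dom _ _ (integZ (4 * s ^+ 2) (integ_normal_sqexp s_gt0))).
  exact: measurable_funX.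
move=> x; rewrite ger0_norm ?sqr_ge0//.
have s2 : 0 < 4 * s ^+ 2 by rewrite mulr_gt0// exprn_gt0.
rewrite -ler_pdivrMl// mulrC (le_trans _ (expR_ge1Dx _))//.
by rewrite lerDr.
Qed.

(** Controls the boundary terms of the integration by parts when [f] grows linearly. A rate [1 / n]
    is enough, so [u <= expR u] stands in for the true Gaussian decay. *)
Lemma normal_pdf_le_inv (n : nat) :
  (1 + n.+1%:R) * pdf n.+1%:R <= 4 * s ^+ 2 * normal_peak s * n.+1%:R^-1.
Proof.
rewrite normal_pdfE ?gt_eqF// /normal_fun subr0.
set y : R := n.+1%:R.
have y1 : 1 <= y by rewrite ler1n.
have y0 : 0 < y by rewrite (lt_le_trans _ y1).
have pk : 0 <= normal_peak s by exact: normal_peak_ge0.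
rewrite mulrCA -mulrA (mulrC (4 * _)) -mulrA ler_wpM2l//.
have -> : - y ^+ 2 / (s ^+ 2 *+ 2) = - (y ^+ 2 / (2 * s ^+ 2)).
  by rewrite mulNr mulr_natl.
rewrite expRN ler_pdivrMr ?expR_gt0// (mulrC y^-1).
have s2 : 0 < 2 * s ^+ 2 by rewrite mulr_gt0// exprn_gt0.
have := expR_ge1Dx (y ^+ 2 / (2 * s ^+ 2)).
set E := expR _ => hE.
have hE' : y ^+ 2 / (2 * s ^+ 2) <= E by rewrite (le_trans _ hE)// lerDr.
rewrite (@le_trans _ _ (4 * s ^+ 2 * y^-1 * (y ^+ 2 / (2 * s ^+ 2))))//; last first.
  by rewrite ler_wpM2l// mulr_ge0 ?invr_ge0 ?(ltW y0)// mulr_ge0// sqr_ge0.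
have -> : 4 * s ^+ 2 * y^-1 * (y ^+ 2 / (2 * s ^+ 2)) = 2 * y.
  by field; rewrite gt_eqF//= gt_eqF.
lra.
Qed.

(** Stein's identity. The integrals of the derivative of [f * pdf] over growing intervals tend to
    the full integral by domination, and to 0 because the boundary terms vanish. *)
Lemma normal_ibp (f f1 : R -> R) (C : R) :
  (forall x, is_derive x (1 : R) f (f1 x)) -> continuous f1 ->
  (forall x, `|f x| <= 1 + `|x|) -> (forall x, `|f1 x| <= C) ->
  \int[N]_x (x * f x) = s ^+ 2 * \int[N]_x f1 x.
Proof.
move=> df cf1 fle f1C.
have cf : continuous f.
  by move=> x; apply/differentiable_continuous/derivable1_diffP; case: (df x).
have mf : measurable_fun setT f by exact: continuous_measurable_fun.
have mf1 : measurable_fun setT f1 by exact: continuous_measurable_fun.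
have if1 : integ N f1 by apply: (@integ_bounded _ _ _ N _ C).
have ixf : integ N (fun x => x * f x).
  apply: (integ_dom _ _ (integD (integ_cst N 1) (integZ 2 integ_normal_sqr))).
    exact: measurable_funM.
  move=> x; rewrite normrM -(real_normK (num_real x)).
  rewrite (le_trans (ler_wpM2l (normr_ge0 x) (fle x)))//=.
  move: (sqr_ge0 (`|x| - 1)); nra.
have i1 := integrable_mul_normal_pdf if1.
have i2 := integrable_mul_normal_pdf ixf.
have i3 : mu.-integrable setT
    (fun x => ((s ^+ 2)^-1 * (x * f x * pdf x))%:E).
  under eq_fun do rewrite EFinM.
  exact: integrableZl.
pose h1 x := f1 x * pdf x - (s ^+ 2)^-1 * (x * f x * pdf x).
have ih1 : mu.-integrable setT (EFin \o h1).
  have := integrableB measurableT i1 i3.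
  by apply: eq_integrable => // x _; rewrite /= EFinB.
have mh1 := measurable_int _ ih1.
have cvg1 : (fun n => \int[mu]_(x in `[- n.+1%:R, n.+1%:R]) h1 x) @ \oo -->
    \int[mu]_x h1 x.
  have [] := @dominated_convergence _ _ _ mu setT measurableT
    (fun n => EFin \o (h1 \_ `[- n.+1%:R, n.+1%:R])) (EFin \o h1)
    (fun x => `|h1 x|%:E).
  - move=> n; apply/measurable_EFinP; apply/measurable_restrict => //.
    by apply/measurable_funTS; apply/measurable_EFinP.
  - exact: mh1.
  - apply: aeW => x _; apply: cvg_EFin; first exact: nearW.
    apply: cvg_near_cst; near=> n; rewrite /= patchE mem_set//= in_itv/= -ler_norml.
    near: n; exists (Num.truncn `|x|) => // n /= xn.
    rewrite (le_trans (ltW (truncnS_gt _)))// ler_nat//.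
  - exact: integrable_norm.
  - apply: aeW => x n _ /=; rewrite lee_fin patchE; case: ifP => //.
    by rewrite normr0.
  move=> _ _ h.
  under eq_fun do rewrite Rintegral_mkcond.
  apply: fine_cvg => //=; rewrite /Rintegral fineK//.
  exact: integrable_fin_num.
have cvg0 : (fun n => \int[mu]_(x in `[- n.+1%:R, n.+1%:R]) h1 x) @ \oo --> (0 : R).
  pose K := 2 * (4 * s ^+ 2 * normal_peak s).
  have cK : (fun n => K * @harmonic R n) @ \oo --> (0 : R).
    by rewrite -(mulr0 K); apply: cvgMr; exact: cvg_harmonic.
  apply/norm_cvg0P.
  apply: (@squeeze_cvgr _ _ _ _ (cst 0) (fun n => K * @harmonic R n)); last 2 first.
  - exact: cvg_cst.
  - exact: cK.
  apply: nearW => n /=; rewrite normr_ge0/= normal_pdf_itvN//.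
  rewrite (le_trans (ler_normB _ _))// !normrM.
  have bnd y : `|y| = n.+1%:R -> `|f y| * `|pdf y| <= (1 + n.+1%:R) * pdf n.+1%:R.
    move=> yn; rewrite (ger0_norm (normal_pdf_ge0 _ _ _)) ler_pM//.
    - exact: normal_pdf_ge0.
    - by rewrite -yn fle.
    - rewrite !normal_pdfE ?gt_eqF// /normal_fun !subr0.
      by rewrite -(real_normK (num_real y)) yn.
  rewrite (le_trans (lerD (bnd _ _) (bnd _ _)))//.
  - by rewrite ger0_norm.
  - by rewrite normrN ger0_norm.
  rewrite /K -mulrA mulr_natl lerD// normal_pdf_le_inv//.
have h10 : \int[mu]_x h1 x = 0 by apply: (cvg_unique _ cvg1 cvg0).
move: h10; rewrite /h1 RintegralB// RintegralZl// -!Rintegral_normal_prob//.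
move=> /subr0_eq ->.
by rewrite mulrA divff ?mul1r// expf_neq0// gt_eqF.
Unshelve. all: by end_near. Qed.

Lemma EE_normal_sqr : \int[N]_x x ^+ 2 = s ^+ 2.
Proof.
have -> : \int[N]_x x ^+ 2 = \int[N]_x (x * id x).
  by apply: eq_Rintegral => x _; rewrite expr2.
rewrite (@normal_ibp id (cst 1) 1 (fun x => is_derive_id x 1))//=.
- by rewrite EEcst mulr1.
- by move=> x; exact: cvg_cst.
- by move=> x; rewrite lerDr.
- by move=> x; rewrite normr1.
Qed.

(** Stein's identity for the sine wave shows that [C] solves [C' = - u * s ^+ 2 * C], so
    [C u * expR (u ^+ 2 * s ^+ 2 / 2)] is constant in [u]. The free phase [b] lets real cosines
    carry the whole complex characteristic function. *)
Lemma EE_normal_cos (t b : R) :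
  \int[N]_x cos (t * x + b) = cos b * expR (- (t ^+ 2 * s ^+ 2 / 2)).
Proof.
have mlin (a c : R) : measurable_fun setT (fun x : R => a * x + c).
  by apply: measurable_funD => //; apply: measurable_funM.
have mcos : measurable_fun setT (@cos R).
  by apply: continuous_measurable_fun; exact: continuous_cos.
have msin : measurable_fun setT (@sin R).
  by apply: continuous_measurable_fun; exact: continuous_sin.
have icos (a : R) : integ N (fun x => cos (a * x + b)).
  apply: (@integ_bounded _ _ _ N _ 1); first exact: (measurableT_comp mcos (mlin _ _)).
  by move=> x; rewrite ler_norml cos_le1 cos_geN1.
have isin (a : R) : integ N (fun x => x * sin (a * x + b)).
  apply: (integ_dom _ _ (integD (integ_cst N 1) integ_normal_sqr)).
    by apply: measurable_funM => //; exact: (measurableT_comp msin (mlin _ _)).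
  move=> x; rewrite normrM -(real_normK (num_real x)) /=.
  have s1 : `|sin (a * x + b)| <= 1 by rewrite ler_norml sin_le1 sin_geN1.
  rewrite (le_trans (ler_wpM2l (normr_ge0 x) s1))// mulr1.
  move: (sqr_ge0 (`|x| - 1)) (normr_ge0 x); nra.
pose C (u : R) := \int[N]_x cos (u * x + b).
have dC u : is_derive u (1 : R) C (- (u * s ^+ 2 * C u)).
  (* The pointwise error of the cosine expansion is [(h * x) ^+ 2], of expectation
     [h ^+ 2 * s ^+ 2]. *)
  apply: (@is_derive_quadratic _ _ _ _ (s ^+ 2)) => h.
  have <- : \int[N]_x (x * sin (u * x + b)) = u * s ^+ 2 * C u.
    have dsin (x : R) : is_derive x (1 : R) (fun x => sin (u * x + b))
        (u * cos (u * x + b)).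
      by apply: is_derive_eq; rewrite /GRing.scale/=; ring.
    rewrite (@normal_ibp _ (fun x => u * cos (u * x + b)) `|u| dsin)//.
    - by rewrite EEZ// /C; ring.
    - move=> x; apply: cvgM; first exact: cvg_cst.
      apply: continuous_comp; last exact: continuous_cos.
      by apply: cvgD; [apply: cvgM; [exact: cvg_cst|exact: cvg_id]|exact: cvg_cst].
    - by move=> x; rewrite (@le_trans _ _ 1)// ?lerDl// ler_norml sin_le1 sin_geN1.
    - move=> x; rewrite normrM ler_piMr//.
      by rewrite ler_norml cos_le1 cos_geN1.
  rewrite mulrN opprK /C -EEB// -EEZ// -EED//; last 2 first.
    exact: integB.
    exact: integZ.
  rewrite (le_trans (EEnorm _))//; first by apply: integD; [exact: integB|exact: integZ].
  rewrite -EE_normal_sqr (mulrC _ (h ^+ 2)) -EEZ; last exact: integ_normal_sqr.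
  apply: EEle.
  - by apply: integ_norm; apply: integD; [exact: integB|exact: integZ].
  - by apply: integZ; exact: integ_normal_sqr.
  move=> x; rewrite -exprMn.
  have := cos_quadratic (u * x + b) (h * x).
  by rewrite (_ : u * x + b + h * x = (u + h) * x + b) ?mulrA//; ring.
pose G u := C u * expR (u ^+ 2 * (s ^+ 2 / 2)).
have dG u : is_derive u (1 : R) G 0.
  have := dC u => ?.
  by rewrite /G; apply: is_derive_eq; rewrite /GRing.scale/= ; field.
have := is_derive_0_is_cst t 0 dG.
rewrite /G expr0n/= mul0r expR0 mulr1.
have -> : C 0 = cos b.
  rewrite /C -[RHS](EEcst N); apply: eq_Rintegral => x _.
  by rewrite mul0r add0r.
move=> <-; rewrite -[RHS]mulrA -expRD.
have -> : t ^+ 2 * (s ^+ 2 / 2) + - (t ^+ 2 * s ^+ 2 / 2) = 0 by ring.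
by rewrite expR0 mulr1.
Qed.

End normal_ibp.

(** * Transfer of expectations between variables of the same law *)

Section transfer_law.
Context (R : realType) d1 (T1 : measurableType d1) (P1 : probability T1 R)
  d2 (T2 : measurableType d2) (P2 : probability T2 R)
  d (S : measurableType d) (X1 : T1 -> S) (X2 : T2 -> S).
Hypothesis mX1 : measurable_fun setT X1.
Hypothesis mX2 : measurable_fun setT X2.
Hypothesis X12 : forall A, measurable A -> P1 (X1 @^-1` A) = P2 (X2 @^-1` A).

Lemma ge0_integral_eq_law (f : S -> \bar R) : measurable_fun setT f ->
  (forall x, (0 <= f x)%E) -> (\int[P1]_w f (X1 w) = \int[P2]_w f (X2 w))%E.
Proof.
move=> mf f0.
transitivity (\int[pushforward P1 X1]_y f y)%E.
  by rewrite ge0_integral_pushforward.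
transitivity (\int[pushforward P2 X2]_y f y)%E; last first.
  by rewrite ge0_integral_pushforward.
by apply: eq_measure_integral => A mA _; exact: X12.
Qed.

Lemma integ_eq_law (f : S -> R) : measurable_fun setT f ->
  integ P1 (f \o X1) -> integ P2 (f \o X2).
Proof.
move=> mf /integrableP[_ h]; apply/integrableP; split.
  by apply/measurable_EFinP; exact: measurableT_comp.
rewrite -(@ge0_integral_eq_law (fun x => `|(f x)%:E|%E))//.
by apply: measurableT_comp => //; exact/measurable_EFinP.
Qed.

Lemma EE_eq_law (f : S -> R) : measurable_fun setT f ->
  integ P1 (f \o X1) -> \int[P1]_w f (X1 w) = \int[P2]_w f (X2 w).
Proof.
move=> mf if1; have if2 := integ_eq_law mf if1.
congr fine.
transitivity (\int[pushforward P1 X1]_y (f y)%:E)%E.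
  by rewrite integral_pushforward//; exact/measurable_EFinP.
transitivity (\int[pushforward P2 X2]_y (f y)%:E)%E; last first.
  by rewrite integral_pushforward//; exact/measurable_EFinP.
by apply: eq_measure_integral => A mA _; exact: X12.
Qed.

End transfer_law.

(** * Laws are determined by their characteristic functions *)

Section step_approximation.
Context (R : realType).

(* Tends to the indicator of [u < 0] for [u] in [-1, 1] other than 0. *)
Definition step_poly (n : nat) (u : R) := (1 - ((1 + u) / 2) ^+ n.+1) ^+ (2 ^ n.+1).

Lemma bernoulli_ineq (u : R) n : 0 <= u <= 1 -> 1 - n%:R * u <= (1 - u) ^+ n.
Proof.
move=> /andP[u0 u1]; elim: n => [|n ih]; first by rewrite mul0r subr0 expr0.
rewrite exprS (@le_trans _ _ ((1 - u) * (1 - n%:R * u)))//.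
  have : 0 <= n%:R * u ^+ 2 by rewrite mulr_ge0// sqr_ge0.
  rewrite -natr1; nra.
by rewrite ler_wpM2l// subr_ge0.
Qed.

Lemma step_poly01 n (u : R) : -1 <= u <= 1 -> 0 <= step_poly n u <= 1.
Proof.
move=> /andP[u1 u2]; set s := (1 + u) / 2.
have s01 : 0 <= s <= 1 by rewrite /s; apply/andP; split; lra.
have sn : 0 <= s ^+ n.+1 <= 1.
  by case/andP: s01 => ? ?; rewrite exprn_ge0//= exprn_ile1.
case/andP: sn => ? ?.
by rewrite /step_poly -/s exprn_ge0 ?subr_ge0//= exprn_ile1 ?subr_ge0// lerBlDr lerDl.
Qed.

(** The number of factors times the inner power is [(1 + u) ^+ n.+1]. For [u < 0] it tends to 0 and
    Bernoulli's inequality pushes [step_poly] to 1; for [u > 0] it tends to infinity and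
    [1 - v <= expR (- v)] pushes [step_poly] to 0. At [u = 0] the limit would be [1 / e]. *)
Lemma step_poly_cvg (u : R) : -1 <= u <= 1 -> u != 0 ->
  (fun n => step_poly n u) @ \oo --> ((u < 0)%R%:R : R).
Proof.
move=> u11 u0; have /andP[um1 u1] := u11.
have s01 : 0 <= (1 + u) / 2 <= 1 by apply/andP; split; lra.
have sn n : 0 <= ((1 + u) / 2) ^+ n.+1 <= 1.
  by case/andP: s01 => ? ?; rewrite exprn_ge0//= exprn_ile1.
have pw n : (2 ^ n.+1)%:R * ((1 + u) / 2) ^+ n.+1 = (1 + u) ^+ n.+1.
  by rewrite natrX -exprMn mulrC -mulrA mulVf// mulr1.
have [uN|uP] := ltP u 0.
  have cg : (fun n => 1 - (1 + u) ^+ n.+1) @ \oo --> (1 : R).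
    rewrite -[X in _ --> X]subr0; apply: cvgB; first exact: cvg_cst.
    rewrite (_ : (fun n => (1 + u) ^+ n.+1) = [sequence (1 + u) ^+ (n + 1)]_n); last first.
      by apply/funext => n /=; rewrite addn1.
    rewrite cvg_shiftn; apply: cvg_expr; rewrite ger0_norm; lra.
  apply: (@squeeze_cvgr _ _ _ _ (fun n => 1 - (1 + u) ^+ n.+1) (cst 1)) => //; last first.
    exact: cvg_cst.
  apply: nearW => n; have /andP[_ ->] := step_poly01 n u11.
  by rewrite andbT -pw bernoulli_ineq.
have {uP}u_gt0 : 0 < u by rewrite lt_neqAle eq_sym u0.
have cg : (fun n => u^-1 * @harmonic R n) @ \oo --> (0 : R).
  by rewrite -(mulr0 u^-1); apply: cvgMr; exact: cvg_harmonic.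
apply: (@squeeze_cvgr _ _ _ _ (cst 0) (fun n => u^-1 * @harmonic R n)) => //; last first.
  exact: cvg_cst.
apply: nearW => n; have /andP[-> _] /= := step_poly01 n u11.
rewrite /step_poly (@le_trans _ _ (expR (- (1 + u) ^+ n.+1)))//.
  rewrite -pw -mulrN expRM_natl lerXn2r ?nnegrE ?expR_ge0 ?subr_ge0//.
    by case/andP: (sn n).
  exact: expR_ge1Dx.
rewrite expRN -invfM lef_pV2 ?posrE ?expR_gt0 ?mulr_gt0//.
rewrite (@le_trans _ _ ((1 + u) ^+ n.+1))//; last first.
  by rewrite (le_trans _ (expR_ge1Dx _))// lerDr.
have bern m : 1 + m%:R * u <= (1 + u) ^+ m.
  elim: m => [|m ih]; first by rewrite mul0r addr0 expr0.
  rewrite exprS (@le_trans _ _ ((1 + u) * (1 + m%:R * u)))//.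
    have : 0 <= m%:R * u ^+ 2 by rewrite mulr_ge0// sqr_ge0.
    rewrite -natr1; nra.
  by rewrite ler_wpM2l// addr_ge0// ltW.
by rewrite (le_trans _ (bern _))// mulrC lerDr.
Qed.

End step_approximation.

Definition lin (R : realType) p (a : 'I_p -> R) (x : p.-tuple R) : R :=
  \sum_(j < p) a j * tnth x j.

Lemma measurable_lin (R : realType) p (a : 'I_p -> R) :
  measurable_fun setT (lin a).
Proof.
apply: measurable_sum => j; apply: measurable_funM => //.
exact: measurable_tnth.
Qed.

Lemma measurable_cos (R : realType) : measurable_fun setT (@cos R).
Proof. by apply: continuous_measurable_fun; exact: continuous_cos. Qed.

Section multipliers.
Context (R : realType) d1 (T1 : measurableType d1) (P1 : probability T1 R)
  d2 (T2 : measurableType d2) (P2 : probability T2 R) (p : nat)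
  (X1 : T1 -> p.-tuple R) (X2 : T2 -> p.-tuple R).
Hypothesis mX1 : measurable_fun setT X1.
Hypothesis mX2 : measurable_fun setT X2.
Hypothesis cf12 : forall (a : 'I_p -> R) b,
  \int[P1]_w cos (lin a (X1 w) + b) = \int[P2]_w cos (lin a (X2 w) + b).

(* Functions whose Fourier transforms under the two laws agree. The functions
   preserving them form an algebra closed under bounded pointwise limits, which
   contains the sine and cosine waves, hence the indicators of half-spaces. *)
Let twin (f : p.-tuple R -> R) := [/\ measurable_fun setT f,
  exists C, forall x, `|f x| <= C &
  forall (a : 'I_p -> R) b, \int[P1]_w (f (X1 w) * cos (lin a (X1 w) + b))
    = \int[P2]_w (f (X2 w) * cos (lin a (X2 w) + b))].

Let multiplier (g : p.-tuple R -> R) := forall f, twin f -> twin (fun x => f x * g x).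

Let mlincos (a : 'I_p -> R) b : measurable_fun setT (fun x : p.-tuple R => cos (lin a x + b)).
Proof.
apply: (measurableT_comp (@measurable_cos R)).
by apply: measurable_funD => //; exact: measurable_lin.
Qed.

Let twin_integ1 f (a : 'I_p -> R) b : twin f ->
  integ P1 (fun w => f (X1 w) * cos (lin a (X1 w) + b)).
Proof.
move=> [mf [C fC] _]; apply: (@integ_bounded _ _ _ _ _ C).
  have /(measurableT_comp) := measurable_funM mf (mlincos a b).
  by apply.
move=> w; rewrite normrM (le_trans _ (fC (X1 w)))// ler_piMr//.
by rewrite ler_norml cos_le1 cos_geN1.
Qed.

Let twin_integ2 f (a : 'I_p -> R) b : twin f ->
  integ P2 (fun w => f (X2 w) * cos (lin a (X2 w) + b)).
Proof.
move=> [mf [C fC] _]; apply: (@integ_bounded _ _ _ _ _ C).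
  have /(measurableT_comp) := measurable_funM mf (mlincos a b).
  by apply.
move=> w; rewrite normrM (le_trans _ (fC (X2 w)))// ler_piMr//.
by rewrite ler_norml cos_le1 cos_geN1.
Qed.

Let twin1 : twin (cst 1).
Proof.
split; first exact: measurable_cst.
  by exists 1 => x; rewrite /= normr1.
move=> a b; have := cf12 a b.
by under eq_Rintegral do rewrite -[cos _]mul1r;
   under [X in _ = X -> _]eq_Rintegral do rewrite -[cos _]mul1r.
Qed.

Let twinD f g : twin f -> twin g -> twin (fun x => f x + g x).
Proof.
move=> Vf Vg; have [mf [C fC] Ef] := Vf; have [mg [D gD] Eg] := Vg; split.
- exact: measurable_funD.
- by exists (C + D) => x; rewrite (le_trans (ler_normD _ _))// lerD.
move=> a b.
under eq_Rintegral do rewrite mulrDl.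
under [RHS]eq_Rintegral do rewrite mulrDl.
by rewrite !EED ?Ef ?Eg//; [exact: twin_integ2|exact: twin_integ2|exact: twin_integ1|exact: twin_integ1].
Qed.

Let twinZ (k : R) f : twin f -> twin (fun x => k * f x).
Proof.
move=> Vf; have [mf [C fC] Ef] := Vf; split.
- exact: measurable_funM.
- by exists (`|k| * C) => x; rewrite normrM ler_wpM2l.
move=> a b.
under eq_Rintegral do rewrite -mulrA.
under [RHS]eq_Rintegral do rewrite -mulrA.
by rewrite !EEZ ?Ef//; [exact: twin_integ2|exact: twin_integ1].
Qed.

Let twin_cvg (f_ : nat -> p.-tuple R -> R) f (C : R) : (forall n, twin (f_ n)) ->
  (forall n x, `|f_ n x| <= C) -> (forall x, (fun n => f_ n x) @ \oo --> f x) ->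
  twin f.
Proof.
move=> Vf fC ff; split.
- apply: (@measurable_fun_cvg _ _ _ _ f_ f) => // n.
  by case: (Vf n).
- exists C => x; apply: (cvgr_to_le (cvg_norm (ff x))).
  by apply: nearW => n; exact: fC.
move=> a b.
have h1 : (fun n => \int[P1]_w (f_ n (X1 w) * cos (lin a (X1 w) + b))) @ \oo
    --> \int[P1]_w (f (X1 w) * cos (lin a (X1 w) + b)).
  apply: (@EE_bounded_cvg _ _ _ _ _ _ C).
  - by move=> n; apply: integ_meas; exact: twin_integ1.
  - move=> n w; rewrite normrM (le_trans _ (fC n (X1 w)))// ler_piMr//.
    by rewrite ler_norml cos_le1 cos_geN1.
  - by move=> w; apply: cvgM; [exact: ff|exact: cvg_cst].
have h2 : (fun n => \int[P2]_w (f_ n (X2 w) * cos (lin a (X2 w) + b))) @ \oo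
    --> \int[P2]_w (f (X2 w) * cos (lin a (X2 w) + b)).
  apply: (@EE_bounded_cvg _ _ _ _ _ _ C).
  - by move=> n; apply: integ_meas; exact: twin_integ2.
  - move=> n w; rewrite normrM (le_trans _ (fC n (X2 w)))// ler_piMr//.
    by rewrite ler_norml cos_le1 cos_geN1.
  - by move=> w; apply: cvgM; [exact: ff|exact: cvg_cst].
have E : (fun n => \int[P1]_w (f_ n (X1 w) * cos (lin a (X1 w) + b)))
    = (fun n => \int[P2]_w (f_ n (X2 w) * cos (lin a (X2 w) + b))).
  by apply/funext => n; case: (Vf n).
by move: h1; rewrite E => h1; apply: (cvg_unique _ h1 h2).
Qed.

Let multiplier_cst (k : R) : multiplier (cst k).
Proof.
move=> f Vf; rewrite (_ : (fun x => _) = (fun x => k * f x)); first exact: twinZ.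
by apply/funext => x; rewrite mulrC.
Qed.

Let multiplierD f g : multiplier f -> multiplier g -> multiplier (fun x => f x + g x).
Proof.
move=> Mf Mg h Vh.
rewrite (_ : (fun x => _) = (fun x => h x * f x + h x * g x)).
  by apply: twinD; [exact: Mf|exact: Mg].
by apply/funext => x; rewrite mulrDr.
Qed.

Let multiplierM f g : multiplier f -> multiplier g -> multiplier (fun x => f x * g x).
Proof.
move=> Mf Mg h Vh.
rewrite (_ : (fun x => _) = (fun x => (h x * f x) * g x)).
  by apply: Mg; exact: Mf.
by apply/funext => x; rewrite mulrA.
Qed.

Let multiplierB f g : multiplier f -> multiplier g -> multiplier (fun x => f x - g x).
Proof.
move=> Mf Mg.
rewrite (_ : (fun x => _) = (fun x => f x + cst (-1) x * g x)).
  by apply: multiplierD => //; apply: multiplierM.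
by apply/funext => x; rewrite mulN1r.
Qed.

Let multiplierX f n : multiplier f -> multiplier (fun x => f x ^+ n).
Proof.
move=> Mf; elim: n => [|n ih]; first exact: multiplier_cst.
rewrite (_ : (fun x => _) = (fun x => f x * f x ^+ n)).
  exact: multiplierM.
by apply/funext => x; rewrite exprS.
Qed.

Let multiplier_cvg (g_ : nat -> p.-tuple R -> R) g (C : R) :
  (forall n, multiplier (g_ n)) -> (forall n x, `|g_ n x| <= C) ->
  (forall x, (fun n => g_ n x) @ \oo --> g x) -> multiplier g.
Proof.
move=> Mg gC gg f Vf; have [_ [D fD] _] := Vf.
apply: (@twin_cvg (fun n x => f x * g_ n x) _ (D * C)).
- by move=> n; exact: Mg.
- by move=> n x; rewrite normrM ler_pM.
- by move=> x; apply: cvgM; [exact: cvg_cst|exact: gg].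
Qed.

(** A product of two cosine waves is the mean of the waves whose frequencies and phases are the sum
    and the difference, so testing against all waves is stable under this multiplication. *)
Let multiplier_cos (a : 'I_p -> R) b : multiplier (fun x => cos (lin a x + b)).
Proof.
move=> f Vf; have [mf [C fC] Ef] := Vf; split.
- exact: measurable_funM.
- exists C => x; rewrite normrM (le_trans _ (fC x))// ler_piMr//.
  by rewrite ler_norml cos_le1 cos_geN1.
move=> a' b'.
have E x : f x * cos (lin a x + b) * cos (lin a' x + b')
  = 2^-1 * (f x * cos (lin (fun j => a j - a' j) x + (b - b')) +
            f x * cos (lin (fun j => a j + a' j) x + (b + b'))).
  have -> : lin (fun j => a j - a' j) x = lin a x - lin a' x.
    by rewrite /lin -sumrB; apply: eq_bigr => j _; rewrite mulrBl.
  have -> : lin (fun j => a j + a' j) x = lin a x + lin a' x.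
    by rewrite /lin -big_split; apply: eq_bigr => j _; rewrite mulrDl.
  rewrite (_ : lin a x - lin a' x + (b - b') = (lin a x + b) - (lin a' x + b')); last by ring.
  rewrite (_ : lin a x + lin a' x + (b + b') = (lin a x + b) + (lin a' x + b')); last by ring.
  move: (lin a x + b) (lin a' x + b') => u v.
  by rewrite cosB cosD; field.
under eq_Rintegral do rewrite E.
under [RHS]eq_Rintegral do rewrite E.
rewrite !EEZ ?EED ?Ef//; try exact: twin_integ1; try exact: twin_integ2.
- by apply: integD; exact: twin_integ2.
- by apply: integD; exact: twin_integ1.
Qed.

Let multiplier_sin (a : 'I_p -> R) b : multiplier (fun x => sin (lin a x + b)).
Proof.
rewrite (_ : (fun x => _) = (fun x => cos (lin a x + (b - pi / 2)))).
  exact: multiplier_cos.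
by apply/funext => x; rewrite addrA cosBpihalf.
Qed.

(** Powers of [cos ^+ 2] tend to the indicator of the zeros of the sine. This set is treated
    separately because [step_poly] has the wrong limit at 0. *)
Let multiplier_sin_eq0 (a : 'I_p -> R) b : multiplier (fun x => (sin (lin a x + b) == 0)%:R).
Proof.
apply: (@multiplier_cvg (fun n x => (1 - sin (lin a x + b) ^+ 2) ^+ n.+1) _ 1).
- move=> n; apply: multiplierX; apply: (@multiplierB (cst 1)); first exact: multiplier_cst.
  exact/multiplierX/multiplier_sin.
- move=> n x; rewrite -cos2sin2 -exprM normrX exprn_ile1//.
  by rewrite ler_norml cos_le1 cos_geN1.
move=> x; have [->|s0] := eqVneq (sin (lin a x + b)) 0.
  rewrite expr0n/= subr0; under eq_fun do rewrite expr1n; exact: cvg_cst.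
rewrite (_ : (fun n => _) = [sequence (1 - sin (lin a x + b) ^+ 2) ^+ (n + 1)]_n); last first.
  by apply/funext => n /=; rewrite addn1.
rewrite cvg_shiftn; apply: cvg_expr; rewrite -cos2sin2 ger0_norm ?sqr_ge0//.
by rewrite cos2sin2 ltrBlDr ltrDl lt_neqAle sqr_ge0 andbT eq_sym sqrf_eq0.
Qed.

Let multiplier_sin_lt0 (a : 'I_p -> R) b : multiplier (fun x => (sin (lin a x + b) < 0)%R%:R).
Proof.
have sin11 x : -1 <= sin (lin a x + b) <= 1 by rewrite sin_le1 sin_geN1.
(* The second factor kills the zeros of the sine, where [step_poly] does not tend to the
   indicator. *)
apply: (@multiplier_cvg (fun n x => step_poly n (sin (lin a x + b)) *
   (1 - (sin (lin a x + b) == 0)%:R)) _ 1).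
- move=> n; apply: multiplierM; last by apply: (@multiplierB (cst 1)).
  apply: multiplierX; apply: (@multiplierB (cst 1)); first exact: multiplier_cst.
  apply: multiplierX; apply: multiplierM; last exact: multiplier_cst.
  by apply: (@multiplierD (cst 1)); first exact: multiplier_cst.
- move=> n x; have /andP[s0 s1] := step_poly01 n (sin11 x).
  rewrite normrM ger0_norm//; case: (_ == 0) => /=; last by rewrite subr0 normr1 mulr1.
  by rewrite subrr normr0 mulr0.
move=> x; have [->|s0] := eqVneq (sin (lin a x + b)) 0.
  by rewrite subrr ltxx; under eq_fun do rewrite mulr0; exact: cvg_cst.
rewrite subr0; under eq_fun do rewrite mulr1.
exact: step_poly_cvg.
Qed.

(* [sin (y / n)] has the sign of [y] for [n] large. *)
Let multiplier_lt (j : 'I_p) (t : R) : multiplier (fun x => (tnth x j < t)%R%:R).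
Proof.
apply: (@multiplier_cvg (fun n x => (sin (n.+1%:R^-1 * (tnth x j - t)) < 0)%R%:R) _ 1).
- move=> n; have := @multiplier_sin_lt0 (fun i => (i == j)%:R * n.+1%:R^-1) (- (n.+1%:R^-1 * t)).
  congr multiplier; apply/funext => x.
  rewrite (_ : lin _ x = n.+1%:R^-1 * tnth x j) -?mulrBr//.
  rewrite /lin (bigD1 j)//= big1 ?addr0 ?eqxx ?mul1r// => i /negbTE ->.
  by rewrite !mul0r.
- by move=> n x; case: (_ < _)%R; rewrite ?normr1 ?normr0.
move=> x; set y := tnth x j - t.
have ylt : (tnth x j < t) = (y < 0) by rewrite /y subr_lt0.
rewrite ylt; apply: cvg_near_cst; near=> n.
have n0 : 0 < n.+1%:R :> R by rewrite ltr0n.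
have yn : `|y| / n.+1%:R < pi.
  rewrite ltr_pdivrMr// -ltr_pdivrMl ?pi_gt0//.
  near: n; exists (Num.truncn (pi^-1 * `|y|)) => // n /= nt.
  by rewrite (lt_le_trans (truncnS_gt _))// ler_nat.
congr (nat_of_bool _)%:R; have [y0|y0|->] := ltgtP y 0.
- rewrite -[y]opprK mulrN sinN oppr_lt0 sin_gt0_pi//.
  rewrite mulr_gt0 ?invr_gt0 ?oppr_gt0//= mulrC.
  by rewrite -(ltr0_norm y0).
- apply/negbTE; rewrite -leNgt ltW// sin_gt0_pi//.
  by rewrite mulr_gt0 ?invr_gt0//= mulrC -{1}(gtr0_norm y0).
- by rewrite mulr0 sin0 ltxx.
Unshelve. all: by end_near. Qed.

(** Closure under products replaces a pi-lambda argument: the indicator of a countable union is the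
    limit of [1 - \prod (1 - \1_(F i))] over finitely many [i]. *)
Let sigma_algebra_multiplier :
  sigma_algebra setT [set A : set (p.-tuple R) | multiplier \1_A].
Proof.
split => /=.
- by rewrite indic0; exact: multiplier_cst.
- move=> A MA; rewrite setTD.
  rewrite (_ : \1_(~` A) = (fun x => cst 1 x - \1_A x)).
    by apply: multiplierB => //; exact: multiplier_cst.
  by apply/funext => x; rewrite !indicE in_setC; case: (x \in A) => /=; rewrite ?subrr ?subr0.
- move=> F MF.
  apply: (@multiplier_cvg (fun n x => 1 - \prod_(i < n) (1 - \1_(F i) x)) _ 1).
  + move=> n; apply: (@multiplierB (cst 1)); first exact: multiplier_cst.
    elim: n => [|n ih].
      have -> : (fun x : p.-tuple R => \prod_(i < 0) (1 - \1_(F i) x)) = cst (1 : R).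
        by apply/funext => x; rewrite big_ord0.
      exact: multiplier_cst.
    rewrite (_ : (fun x => _) = (fun x => \prod_(i < n) (1 - \1_(F i) x) * (1 - \1_(F n) x))).
      apply: multiplierM => //; apply: (@multiplierB (cst 1)) => //.
    by apply/funext => x; rewrite big_ord_recr.
  + move=> n x.
    have /andP[h1 h2] : 0 <= \prod_(i < n) (1 - \1_(F i) x : R) <= 1.
      elim/big_ind : _ => //= [|u v /andP[? ?] /andP[? ?]|i _].
      * by rewrite ler01 lexx.
      * by rewrite mulr_ge0//= mulr_ile1.
      * by rewrite indicE; case: (_ \in _); rewrite ?subrr ?subr0 lexx ler01.
    by rewrite ger0_norm ?subr_ge0// lerBlDr lerDl.
  move=> x; apply: cvg_near_cst.
  have [[k _ Fk]|nF] := pselect ((\bigcup_k F k) x).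
    exists k.+1 => // n /= kn; rewrite indicE mem_set; last by exists k.
    rewrite (bigD1 (Ordinal kn))//= indicE mem_set// subrr mul0r subr0//.
  apply: nearW => n; rewrite indicE memNset// big1 ?subrr// => i _.
  rewrite indicE memNset ?subr0// => Fi; apply: nF; by exists (i : nat).
Qed.

(** Sets whose indicator is a multiplier form a sigma-algebra containing the coordinate half-spaces,
    hence all measurable sets. Multiplying the constant 1 by [\1_A] and testing at frequency 0
    compares the two probabilities. *)
Lemma eq_law_of_cf (A : set (p.-tuple R)) : measurable A ->
  P1 (X1 @^-1` A) = P2 (X2 @^-1` A).
Proof.
move=> mA; suff MA : multiplier \1_A.
  have [_ _] := MA _ twin1 => /(_ (fun=> 0) 0) /=.
  have lin0 x : lin (fun=> 0) x = 0 :> R by rewrite /lin big1// => j _; rewrite mul0r.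
  under eq_Rintegral do rewrite lin0 addr0 cos0 mul1r mulr1.
  under [X in _ = X -> _]eq_Rintegral do rewrite lin0 addr0 cos0 mul1r mulr1.
  have mA1 : measurable (X1 @^-1` A) by rewrite -[X in measurable X]setTI; exact: mX1.
  have mA2 : measurable (X2 @^-1` A) by rewrite -[X in measurable X]setTI; exact: mX2.
  by rewrite -(EFin_Pr P1 mA1) -(EFin_Pr P2 mA2) !PrE// => E; congr EFin; exact: E.
move: A mA; apply: smallest_sub; first exact: sigma_algebra_multiplier.
elim/big_ind : _ => //= [A B hA hB|j _]; first by rewrite subUset.
move=> _ [B mB <-]; rewrite setTI.
(* Open left rays generate the Borel sets of the line, and their preimages are the half-spaces of
   [multiplier_lt]. *)
suff : <<s @RGenInftyO.G R >> B -> multiplier \1_((fun x : p.-tuple R => tnth x j) @^-1` B).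
  apply; suff : (@RGenInftyO.G R).-sigma.-measurable B by [].
  by rewrite -(@RGenInftyO.measurableE R).
move: B {mB}.
have : sigma_algebra setT [set B | multiplier \1_((fun x : p.-tuple R => tnth x j) @^-1` B)].
  have [s0 sC sU] := sigma_algebra_multiplier; split => /=.
  - by rewrite preimage_set0; exact: s0.
  - by move=> B MB; rewrite setTD preimage_setC -setTD; exact: sC.
  - by move=> F MF; rewrite preimage_bigcup; exact: sU.
move=> sa; apply: (smallest_sub sa) => _ [t ->] /=.
have := multiplier_lt j t; congr multiplier; apply/funext => x.
rewrite indicE; congr (nat_of_bool _)%:R; apply/idP/idP.
  by move=> xt; rewrite inE/= in_itv.
by rewrite inE/= in_itv.
Qed.

End multipliers.

(** * Independence and product measures *)

Section product_space.
Context (R : realType) d1 (T1 : measurableType d1) (P1 : probability T1 R)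
  d2 (T2 : measurableType d2) (P2 : probability T2 R).

Lemma integ_prod (f : T1 -> R) (g : T2 -> R) : integ P1 f -> integ P2 g ->
  integ (P1 \x P2)%E (fun z => f z.1 * g z.2).
Proof.
move=> fi gi; have mf := integ_meas fi; have mg := integ_meas gi.
have mfg : measurable_fun setT (fun z : T1 * T2 => f z.1 * g z.2).
  by apply: measurable_funM; apply: measurableT_comp.
apply/(integrable12ltyP P1 P2); first exact/measurable_EFinP.
have ig : (\int[P2]_y `|(g y)%:E|)%E = (\int[P2]_y `|g y|)%:E.
  by rewrite /Rintegral fineK//; exact: (integrable_fin_num measurableT (integ_norm gi)).
under eq_integral => x _.
  rewrite /=.
  under eq_integral do rewrite normrM EFinM.
  rewrite ge0_integralZl//; last by apply/measurable_EFinP; exact: measurableT_comp.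
  rewrite [X in (_ * X)%E]ig -EFinM mulrC; over.
have := integrable_lty measurableT (integZ (\int[P2]_y `|g y|) (integ_norm fi)).
by [].
Qed.

Lemma EE_prod (f : T1 -> R) (g : T2 -> R) : integ P1 f -> integ P2 g ->
  \int[(P1 \x P2)%E]_z (f z.1 * g z.2) = (\int[P1]_x f x) * (\int[P2]_y g y).
Proof.
move=> fi gi; have ifg := integ_prod fi gi.
rewrite {1}/Rintegral -(integral12_prod_meas1 ifg).
rewrite /fubini_F /=.
under eq_integral => x _.
  under eq_integral do rewrite EFinM.
  rewrite integralZl//.
  rewrite -[X in (_ * X)%E]fineK; last exact: (integrable_fin_num measurableT gi).
  rewrite -EFinM mulrC; over.
rewrite -/(Rintegral P1 setT (fun x => (\int[P2]_y g y) * f x)).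
by rewrite EEZ// mulrC.
Qed.

Lemma integ_fst (f : T1 -> R) : integ P1 f -> integ (P1 \x P2)%E (f \o fst).
Proof.
move=> fi; have := integ_prod fi (integ_cst P2 1).
by apply: eq_integrable => // z _ /=; rewrite mulr1.
Qed.

Lemma integ_snd (g : T2 -> R) : integ P2 g -> integ (P1 \x P2)%E (g \o snd).
Proof.
move=> gi; have := integ_prod (integ_cst P1 1) gi.
by apply: eq_integrable => // z _ /=; rewrite mul1r.
Qed.

Lemma EE_fst (f : T1 -> R) : integ P1 f ->
  \int[(P1 \x P2)%E]_z f z.1 = \int[P1]_x f x.
Proof.
move=> fi; have := EE_prod fi (integ_cst P2 1); rewrite EEcst mulr1 => <-.
by apply: eq_Rintegral => z _; rewrite mulr1.
Qed.

Lemma EE_snd (g : T2 -> R) : integ P2 g ->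
  \int[(P1 \x P2)%E]_z g z.2 = \int[P2]_y g y.
Proof.
move=> gi; have := EE_prod (integ_cst P1 1) gi; rewrite EEcst mul1r => <-.
by apply: eq_Rintegral => z _; rewrite mul1r.
Qed.

End product_space.

(** * Expectations of products and waves of independent variables *)

Section independence.
Context (R : realType) d (T : measurableType d) (P : probability T R).

Import HBNNSimple.

(** The usual extension from indicators to simple functions and, by bounded convergence, to bounded
    ones. Keeping [g] and [c] abstract lets the induction of [EE_indep_prod] release one factor at a
    time. *)
Lemma EE_indep_of_indic d' (S : measurableType d') (X : T -> S) (g : T -> R) (c : R) :
  measurable_fun setT X -> measurable_fun setT g -> (exists C, forall w, `|g w| <= C) ->
  (forall A, measurable A ->
    \int[P]_w (\1_A (X w) * g w) = (\int[P]_w \1_A (X w)) * c) ->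
  forall phi : S -> R, measurable_fun setT phi -> (exists C, forall x, `|phi x| <= C) ->
    \int[P]_w (phi (X w) * g w) = (\int[P]_w phi (X w)) * c.
Proof.
move=> mX mg [C gC] hA phi mphi [D phiD].
have ibnd (f : S -> R) : measurable_fun setT f -> (exists D, forall x, `|f x| <= D) ->
    integ P (f \o X) /\ integ P (fun w => f (X w) * g w).
  move=> mf [E fE]; split.
    by apply: (@integ_bounded _ _ _ _ _ E) => [|w]; [exact: measurableT_comp|exact: fE].
  apply: (@integ_bounded _ _ _ _ _ (E * C)) => [|w]; last by rewrite normrM ler_pM.
  by apply: measurable_funM => //; exact: measurableT_comp.
have hs (h : {nnsfun S >-> R}) :
    \int[P]_w (h (X w) * g w) = (\int[P]_w h (X w)) * c.
  have [s hE] : exists s : seq R, forall x, h x = \sum_(r <- s) r * \1_(h @^-1` [set r]) x.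
    by eexists => x; rewrite [LHS]fimfunE fsbig_finite.
  have mr r : measurable (h @^-1` [set r]) by [].
  have ir r : integ P (fun w => \1_(h @^-1` [set r]) (X w)) /\
      integ P (fun w => \1_(h @^-1` [set r]) (X w) * g w).
    apply: (ibnd \1_(h @^-1` [set r])); first exact: measurable_indic.
    by exists 1 => x; rewrite indicE; case: (_ \in _); rewrite ?normr1 ?normr0.
  under eq_Rintegral do rewrite hE mulr_suml.
  under [X in _ = X * _]eq_Rintegral do rewrite hE.
  have := @EE_seqsum _ _ _ P _ s (fun r w => r * \1_(h @^-1` [set r]) (X w) * g w).
  move=> [].
    by move=> r; under eq_fun do rewrite -mulrA; apply: integZ; case: (ir r).
  move=> _ ->.
  have := @EE_seqsum _ _ _ P _ s (fun r w => r * \1_(h @^-1` [set r]) (X w)).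
  move=> [].
    by move=> r; apply: integZ; case: (ir r).
  move=> _ ->; rewrite mulr_suml; apply: eq_bigr => r _.
  under eq_Rintegral do rewrite -mulrA.
  by rewrite !EEZ ?hA ?mulrA//; case: (ir r).
have hp (f : S -> R) : measurable_fun setT f -> (forall x, 0 <= f x) ->
    (exists D, forall x, f x <= D) ->
    \int[P]_w (f (X w) * g w) = (\int[P]_w f (X w)) * c.
  move=> mf f0 [E fE].
  have mf' : measurable_fun setT (EFin \o f) by exact/measurable_EFinP.
  pose f_ := nnsfun_approx measurableT mf'.
  have f_cvg x : (fun n => f_ n x) @ \oo --> f x.
    have f0' y : setT y -> (0 <= (EFin \o f) y)%E by move=> _; rewrite lee_fin.
    by have := @cvg_nnsfun_approx _ _ _ setT measurableT _ mf' f0' x Logic.I => /fine_cvg.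
  have f_le n x : f_ n x <= f x.
    rewrite -(cvg_lim _ (f_cvg x))//; apply: (@nondecreasing_cvgn_le _ (fun n => f_ n x)).
      by move=> m k mk; exact/lefP/nd_nnsfun_approx.
    by apply/cvg_ex; exists (f x).
  have f_norm n x : `|f_ n x| <= E by rewrite ger0_norm// (le_trans (f_le _ _)).
  have c1 : (fun n => \int[P]_w (f_ n (X w) * g w)) @ \oo --> \int[P]_w (f (X w) * g w).
    apply: (@EE_bounded_cvg _ _ _ _ _ _ (E * C)).
    - by move=> n; apply: measurable_funM => //; exact: measurableT_comp.
    - by move=> n w; rewrite normrM ler_pM.
    - by move=> w; apply: cvgM; [exact: f_cvg|exact: cvg_cst].
  have c2 : (fun n => (\int[P]_w f_ n (X w)) * c) @ \oo --> (\int[P]_w f (X w)) * c.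
    apply: cvgM; last exact: cvg_cst.
    apply: (@EE_bounded_cvg _ _ _ _ _ _ E).
    - by move=> n; exact: measurableT_comp.
    - by move=> n w; exact: f_norm.
    - by move=> w; exact: f_cvg.
  move: c1; under eq_fun do rewrite hs.
  by move=> c1; apply: (cvg_unique _ c1 c2).
(* A signed function becomes nonnegative after adding its bound [D]; the contribution of the
   constant is cancelled at the end. *)
have D0 : forall x, 0 <= phi x + D.
  by move=> x; rewrite -lerBlDr sub0r; have := phiD x; rewrite ler_norml => /andP[].
have mphiD : measurable_fun setT (fun x => phi x + D) by exact: measurable_funD.
have bphiD : exists E, forall x, phi x + D <= E.
  by exists (D + D) => x; rewrite lerD2r (le_trans (ler_norm _)).
have h1 := hp _ mphiD D0 bphiD.
have h2 := hp (cst D) (measurable_cst _) (fun x => le_trans (normr_ge0 _) (phiD x))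
  (ex_intro _ D (fun=> lexx D)).
have [iphi iphig] := ibnd phi mphi (ex_intro _ D phiD).
have ig : integ P g by apply: (@integ_bounded _ _ _ P _ C).
move: h1; under eq_Rintegral do rewrite mulrDl.
rewrite (EED iphig (integZ D ig)) (EED iphi (integ_cst P D)).
by rewrite h2 mulrDl => /addIr.
Qed.
(** Induction on the number of factors not known to be indicators. When there are none, the claim is
    independence over the full index set; otherwise [EE_indep_of_indic] reduces one of them to an
    indicator. *)
Lemma EE_indep_prod (I : finType) d' (S : measurableType d') (X : I -> T -> S)
    (f : I -> S -> R) :
  (forall i, measurable_fun setT (X i)) -> mutually_independent P X ->
  (forall i, measurable_fun setT (f i)) ->
  (forall i, exists C, forall x, `|f i x| <= C) ->
  \int[P]_w (\prod_i f i (X i w)) = \prod_i \int[P]_w f i (X i w).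
Proof.
move=> mX indX mf bf.
suff main (K : {set I}) (g : I -> S -> R) : (forall i, measurable_fun setT (g i)) ->
    (forall i, exists C, forall x, `|g i x| <= C) ->
    (forall i, i \notin K -> exists2 A, measurable A & g i = \1_A) ->
    \int[P]_w (\prod_i g i (X i w)) = \prod_i \int[P]_w g i (X i w).
  by apply: (main [set: I]%SET) => // i; rewrite finset.in_setT.
move cK : #|K| => m; elim: m K cK g => [|m ih] K cK g mg bg iK.
  move/eqP : cK; rewrite cards_eq0 => /eqP K0.
  have {}iK i : {A | measurable A & g i = \1_A}.
    apply: cid2; apply: iK; rewrite K0; rewrite finset.inE//.
  pose A i := s2val (iK i).
  have mA i : measurable (A i) by exact: (s2valP (iK i)).
  have gA i : g i = \1_(A i) by exact: (s2valP' (iK i)).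
  have mXA i : measurable (X i @^-1` A i).
    by rewrite -[Y in measurable Y]setTI; exact: mX.
  have := indX [set: I]%SET A mA.
  under [RHS]eq_bigr do rewrite PrE//.
  move=> E.
  transitivity (\prod_(i in [set: I]%SET) \int[P]_w \1_(X i @^-1` A i) w).
    rewrite -E PrE; last first.
      by apply: fin_bigcap_measurable => //; exact: finite_finset.
    apply: eq_Rintegral => w _.
    rewrite indicE; case: (boolP (w \in _)) => [|] wI.
      rewrite big1// => i _; rewrite gA indicE mem_set//.
      by move: wI; rewrite inE => /(_ i); apply => /=; rewrite finset.in_setT.
    have [i iA] : exists i, ~ A i (X i w).
      apply/existsNP => h; move/negP : wI; apply; rewrite inE => i _; exact: h.
    by rewrite (bigD1 i)//= gA indicE memNset// mul0r.
  rewrite big_mkcond; apply: eq_bigr => i _; rewrite finset.in_setT.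
  by apply: eq_Rintegral => w _; rewrite gA.
have [k kK] : exists k, k \in K by apply/set0Pn; rewrite -card_gt0 cK.
pose G w := \prod_(i | i != k) g i (X i w).
pose c := \prod_(i | i != k) \int[P]_w g i (X i w).
under eq_Rintegral do rewrite (bigD1 k)//=.
rewrite [RHS](bigD1 k)//= -/c.
have mG : measurable_fun setT G.
  rewrite /G; under eq_fun do rewrite -big_filter.
  by apply: measurable_prod => i _; exact: measurableT_comp.
have bG : exists C, forall w, `|G w| <= C.
  have /choice[D gD] := bg.
  exists (\prod_(i | i != k) D i) => w; rewrite normr_prod.
  by apply: ler_prod => i _; rewrite normr_ge0/=.
apply: (EE_indep_of_indic (mX k) mG bG) => // B mB.
pose g' i := if i == k then \1_B else g i.
have g'k i : i != k -> g' i = g i by rewrite /g' => /negbTE ->.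
have := ih (K :\ k)%SET _ g'.
rewrite (bigD1 k)//= /g' eqxx.
under eq_Rintegral => w _.
  rewrite (bigD1 k)//= eqxx.
  under eq_bigr => i ik do rewrite (negbTE ik).
  over.
under eq_bigr => i ik do rewrite (negbTE ik).
apply.
- by move: cK; rewrite (cardsD1 k) kK => -[].
- by move=> i; case: ifP => // _; exact: measurable_indic.
- move=> i; case: ifP => // _; exists 1 => x.
  by rewrite indicE; case: (_ \in _); rewrite ?normr1 ?normr0.
- move=> i; have [->|ik] := eqVneq i k; first by exists B.
  by rewrite finset.in_setD1 ik => /iK.
Qed.

(** Multiplicativity of characteristic functions without complex numbers. Quantifying over the phase
    says that each [u i (X i)] has cosine mean [phi i] and sine mean 0. The induction moves one
    index at a time out of the cosine of the sum into a product, ending at [EE_indep_prod]. *)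
Lemma EE_cos_indep_sum (I : finType) d' (S : measurableType d') (X : I -> T -> S)
    (u : I -> S -> R) (phi : I -> R) :
  (forall i, measurable_fun setT (X i)) -> mutually_independent P X ->
  (forall i, measurable_fun setT (u i)) ->
  (forall i b, \int[P]_w cos (u i (X i w) + b) = cos b * phi i) ->
  forall b, \int[P]_w cos (\sum_i u i (X i w) + b) = cos b * \prod_i phi i.
Proof.
move=> mX indX mu cfu b.
have mc (v : S -> R) : measurable_fun setT v -> measurable_fun setT (fun x => cos (v x)).
  exact: measurableT_comp (@measurable_cos R).
have c1 (y : R) : `|cos y| <= 1 by rewrite ler_norml cos_le1 cos_geN1.
suff main (K : {set I}) (g : I -> S -> R) c : (forall i, measurable_fun setT (g i)) ->
    (forall i, exists C, forall x, `|g i x| <= C) ->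
    \int[P]_w (cos (\sum_(i in K) u i (X i w) + c) * \prod_(i in ~: K) g i (X i w))
    = cos c * \prod_(i in K) phi i * \prod_(i in ~: K) \int[P]_w g i (X i w).
  have := main [set: I]%SET (fun _ => cst 1) b (fun i => measurable_cst _).
  have b1 (i : I) : exists C : R, forall x : S, `|cst 1 x| <= C.
    by exists 1 => x; rewrite /= normr1.
  move=> /(_ b1).
  rewrite [X in _ = _ * X]big_pred0; last by move=> i; rewrite finset.setCT finset.inE.
  rewrite mulr1 (eq_bigl xpredT); last by move=> i; rewrite finset.in_setT.
  move=> <-.
  apply: eq_Rintegral => w _.
  rewrite [X in _ * X]big_pred0 ?mulr1; last by move=> i; rewrite finset.setCT finset.inE.
  by congr (cos (_ + _)); apply: eq_bigl => i; rewrite finset.in_setT.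
move cK : #|K| => m; elim: m K cK g c => [|m ih] K cK g c mg bg.
  move/eqP : cK; rewrite cards_eq0 => /eqP ->.
  rewrite [X in _ = _ * X * _]big_set0 mulr1 finset.setC0.
  have bgT (F : I -> R) : \prod_(i in [set: I]%SET) F i = \prod_i F i.
    by apply: eq_bigl => i; rewrite finset.in_setT.
  under eq_Rintegral do rewrite big_set0 add0r bgT.
  rewrite bgT -(EE_indep_prod mX indX mg bg) EEZ//.
  have /choice[D gD] := bg.
  apply: (@integ_bounded _ _ _ _ _ (\prod_i D i)).
    by apply: measurable_prod => i _; exact: measurableT_comp.
  by move=> w; rewrite normr_prod; apply: ler_prod => i _; rewrite normr_ge0/=.
have [k kK] : exists k, k \in K by apply/set0Pn; rewrite -card_gt0 cK.
have cK' : #|K :\ k|%SET = m by move: cK; rewrite (cardsD1 k) kK => -[].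
(* The two terms of the addition formula for index [k]. The sine is written as a shifted cosine so
   that the hypothesis with phase [- pi / 2] gives it mean 0, and only the [gc] term survives. *)
pose gc i := if i == k then (fun x => cos (u k x)) else g i.
pose gs i := if i == k then (fun x => cos (u k x - pi / 2)) else g i.
have mgc i : measurable_fun setT (gc i).
  by rewrite /gc; case: ifP => // _; exact: mc.
have mgs i : measurable_fun setT (gs i).
  by rewrite /gs; case: ifP => // _; apply: mc; exact: measurable_funB.
have bgc i : exists C, forall x, `|gc i x| <= C.
  by rewrite /gc; case: ifP => // _; exists 1.
have bgs i : exists C, forall x, `|gs i x| <= C.
  by rewrite /gs; case: ifP => // _; exists 1.
have splitK (F : I -> R) : \prod_(i in ~: (K :\ k)%SET) F i = F k * \prod_(i in ~: K) F i.
  rewrite (bigD1 k)/=; last by rewrite !finset.inE eqxx.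
  congr (_ * _); apply: eq_bigl => i; rewrite !finset.inE.
  by have [->|ik] /= := eqVneq i k; rewrite ?kK ?andbF ?andbT.
have splitS (F : I -> R) : \sum_(i in K) F i = F k + \sum_(i in (K :\ k)%SET) F i.
  by rewrite (big_setD1 k).
have gcE w : \prod_(i in ~: K) gc i (X i w) = \prod_(i in ~: K) g i (X i w).
  apply: eq_bigr => i; rewrite finset.inE /gc => iK; case: eqP => // ik.
  by rewrite ik kK in iK.
have gsE w : \prod_(i in ~: K) gs i (X i w) = \prod_(i in ~: K) g i (X i w).
  apply: eq_bigr => i; rewrite finset.inE /gs => iK; case: eqP => // ik.
  by rewrite ik kK in iK.
have Ec : \int[P]_w gc k (X k w) = phi k.
  rewrite -[RHS]mul1r -cos0 -cfu; apply: eq_Rintegral => w _.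
  by rewrite /gc eqxx addr0.
have Es : \int[P]_w gs k (X k w) = 0.
  rewrite -[RHS](mul0r (phi k)) -(cos_pihalf R) -[in RHS]cosN -cfu.
  by apply: eq_Rintegral => w _; rewrite /gs eqxx.
have ihc := ih _ cK' gc c mgc bgc.
have ihs := ih _ cK' gs (c - pi / 2) mgs bgs.
have ibnd (g' : I -> S -> R) c' : (forall i, measurable_fun setT (g' i)) ->
    (forall i, exists C, forall x, `|g' i x| <= C) ->
    integ P (fun w => cos (\sum_(i in (K :\ k)%SET) u i (X i w) + c') *
       \prod_(i in ~: (K :\ k)%SET) g' i (X i w)).
  move=> mg' /choice[D gD].
  apply: (@integ_bounded _ _ _ _ _ (\prod_(i in ~: (K :\ k)%SET) D i)).
    apply: measurable_funM.
      apply: measurableT_comp; first exact: measurable_cos.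
      apply: measurable_funD => //.
      under eq_fun do rewrite -big_filter.
      by apply: measurable_sum => i _; exact: measurableT_comp.
    under eq_fun do rewrite -big_filter.
    by apply: measurable_prod => i _; exact: measurableT_comp.
  move=> w; rewrite normrM normr_prod.
  rewrite (@le_trans _ _ (\prod_(i in ~: (K :\ k)%SET) `|g' i (X i w)|))//.
    by rewrite ler_piMl// prodr_ge0.
  by apply: ler_prod => i _; rewrite normr_ge0/=.
have E w : cos (\sum_(i in K) u i (X i w) + c) * \prod_(i in ~: K) g i (X i w) =
   cos (\sum_(i in (K :\ k)%SET) u i (X i w) + c) *
       \prod_(i in ~: (K :\ k)%SET) gc i (X i w) -
   cos (\sum_(i in (K :\ k)%SET) u i (X i w) + (c - pi / 2)) *
       \prod_(i in ~: (K :\ k)%SET) gs i (X i w).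
  rewrite splitS !splitK gcE gsE /gc /gs !eqxx.
  set A := \sum_(i in _) _; rewrite addrA !cosBpihalf -addrA addrC cosD; ring.
under eq_Rintegral do rewrite E.
rewrite EEB ?ihc ?ihs; [|exact: ibnd|exact: ibnd].
rewrite !splitK Es Ec mul0r mulr0 subr0 [in RHS](big_setD1 k)//=.
have -> : \prod_(i in ~: K) \int[P]_w gc i (X i w) = \prod_(i in ~: K) \int[P]_w g i (X i w).
  apply: eq_bigr => i; rewrite finset.inE /gc => iK; case: eqP => // ik.
  by rewrite ik kK in iK.
ring.
Qed.

End independence.

(** * Normal variables through their characteristic function *)

Section centered_normal.
Context (R : realType) d (T : measurableType d) (P : probability T R).
Implicit Types (Z : T -> R) (v : R).

(** Encoding by the characteristic function covers [v = 0] uniformly and is stable under independent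
    sums. All phases [b] are included to record that the sine part vanishes. *)
Definition centered_normal Z v := measurable_fun setT Z /\
  forall t b, \int[P]_w cos (t * Z w + b) = cos b * expR (- (t ^+ 2 * v / 2)).

Lemma has_law_centered_normal Z v : measurable_fun setT Z -> 0 <= v ->
  has_law P Z (normal0 v) -> centered_normal Z v.
Proof.
move=> mZ v0 lawZ; split=> // t b.
have mf : measurable_fun setT (fun x : R => cos (t * x + b)).
  apply: measurableT_comp; first exact: measurable_cos.
  by apply: measurable_funD => //; exact: measurable_funM.
have c1 (y : R) : `|cos y| <= 1 by rewrite ler_norml cos_le1 cos_geN1.
have i1 : integ P (fun w => cos (t * Z w + b)).
  by apply: (@integ_bounded _ _ _ _ _ 1) => //; exact: (measurableT_comp mf).
move: lawZ; rewrite /normal0; have [-> lawZ|v_neq0 lawZ] := eqVneq v 0.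
  rewrite mulr0 mul0r oppr0 expR0 mulr1.
  rewrite (@EE_eq_law _ _ _ P _ _ P _ _ Z (cst 0) _ _ _ (fun x => cos (t * x + b)))//=.
    by under eq_Rintegral do rewrite mulr0 add0r; rewrite EEcst.
  move=> A mA; rewrite lawZ//= diracE.
  have [A0|A0] := boolP (0 \in A).
    rewrite (_ : cst 0 @^-1` A = setT) ?probability_setT//.
    by apply/seteqP; split => // w _ /=; rewrite inE in A0.
  rewrite (_ : cst 0 @^-1` A = set0) ?measure0//.
  by apply/seteqP; split => // w /= A0'; move/negP : A0; apply; rewrite inE.
have s0 : 0 < Num.sqrt v by rewrite sqrtr_gt0 lt_neqAle eq_sym v_neq0.
rewrite (@EE_eq_law _ _ _ P _ _ (normal_prob 0 (Num.sqrt v)) _ _ Z id _ _ _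
  (fun x => cos (t * x + b)))//=.
by rewrite EE_normal_cos// sqr_sqrtr.
Qed.

(** A cosine has mean at most 1, whereas a negative [v] would make [expR (- (v / 2))] exceed 1. *)
Lemma centered_normal_ge0 Z v : centered_normal Z v -> 0 <= v.
Proof.
move=> [mZ cfZ]; have := cfZ 1 0; rewrite cos0 mul1r expr1n mul1r.
move=> E; have : expR (- (v / 2)) <= 1.
  rewrite -E -[leRHS](EEcst P); apply: EEle => //.
  - apply: (@integ_bounded _ _ _ _ _ 1).
      apply: measurableT_comp; first exact: measurable_cos.
      by apply: measurable_funD => //; exact: measurable_funM.
    by move=> w; rewrite ler_norml cos_le1 cos_geN1.
  - exact: integ_cst.
by rewrite expR_le1 oppr_le0 pmulr_lge0// invr_gt0.
Qed.

End centered_normal.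

Section centered_normal_law.
Context (R : realType).

Lemma lin1 (c : 'I_1 -> R) (x : R) : lin c [tuple x | i < 1] = c ord0 * x.
Proof. by rewrite /lin big_ord1 tnth_mktuple. Qed.

(** Real variables are viewed as 1-tuples in order to reuse the multivariate uniqueness result. *)
Lemma centered_normal_unique d1 (T1 : measurableType d1) (P1 : probability T1 R)
    d2 (T2 : measurableType d2) (P2 : probability T2 R) Z1 Z2 v :
  centered_normal P1 Z1 v -> centered_normal P2 Z2 v ->
  forall A, measurable A -> P1 (Z1 @^-1` A) = P2 (Z2 @^-1` A).
Proof.
move=> [m1 cf1] [m2 cf2] A mA.
pose X1 w := [tuple Z1 w | i < 1]; pose X2 w := [tuple Z2 w | i < 1].
have mX1 : measurable_fun setT X1.
  apply/measurable_fun_tnthP => i; rewrite (_ : _ \o _ = Z1)//.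
  by apply/funext => w; rewrite /= tnth_mktuple.
have mX2 : measurable_fun setT X2.
  apply/measurable_fun_tnthP => i; rewrite (_ : _ \o _ = Z2)//.
  by apply/funext => w; rewrite /= tnth_mktuple.
have mB : measurable ((fun x : 1.-tuple R => tnth x ord0) @^-1` A).
  by rewrite -[X in measurable X]setTI; exact: measurable_tnth.
have := @eq_law_of_cf _ _ _ P1 _ _ P2 1 X1 X2 mX1 mX2 _ _ mB.
have -> : X1 @^-1` ((fun x : 1.-tuple R => tnth x ord0) @^-1` A) = Z1 @^-1` A.
  by apply/seteqP; split => w /=; rewrite tnth_mktuple.
have -> : X2 @^-1` ((fun x : 1.-tuple R => tnth x ord0) @^-1` A) = Z2 @^-1` A.
  by apply/seteqP; split => w /=; rewrite tnth_mktuple.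
apply=> a b.
under eq_Rintegral do rewrite lin1.
under [RHS]eq_Rintegral do rewrite lin1.
by rewrite cf1 cf2.
Qed.

Lemma centered_normal_normal_prob (v : R) : 0 < v ->
  centered_normal (normal_prob 0 (Num.sqrt v)) id v.
Proof.
move=> v0; split => // t b.
by rewrite EE_normal_cos ?sqrtr_gt0// sqr_sqrtr// ltW.
Qed.

Lemma centered_normal0 d (T : measurableType d) (P : probability T R) :
  centered_normal P (cst 0) (0 : R).
Proof.
split => // t b; under eq_Rintegral do rewrite mulr0 add0r.
by rewrite EEcst mulr0 mul0r oppr0 expR0 mulr1.
Qed.

Context d (T : measurableType d) (P : probability T R) (Z : T -> R) (v : R).
Hypothesis NZ : centered_normal P Z v.

Lemma centered_normal_EE f : 0 < v -> measurable_fun setT f ->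
  integ (normal_prob 0 (Num.sqrt v)) f ->
  integ P (f \o Z) /\ \int[P]_w f (Z w) = \int[normal_prob 0 (Num.sqrt v)]_x f x.
Proof.
move=> v0 mf fi.
have h := centered_normal_unique (centered_normal_normal_prob v0) NZ.
have [mZ _] := NZ.
have i2 := @integ_eq_law _ _ _ (normal_prob 0 (Num.sqrt v)) _ _ P _ _ id Z (@measurable_id _ _ _) mZ h f mf fi.
split => //.
exact/esym/(@EE_eq_law _ _ _ (normal_prob 0 (Num.sqrt v)) _ _ P _ _ id Z (@measurable_id _ _ _) mZ h f mf fi).
Qed.

Lemma centered_normal0_EE f : v = 0 -> measurable_fun setT f ->
  integ P (f \o Z) /\ \int[P]_w f (Z w) = f 0.
Proof.
move=> v0 mf.
have h := centered_normal_unique (centered_normal0 P) (eq_ind _ (centered_normal P Z) NZ _ v0).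
have [mZ _] := NZ.
have fi : integ P (f \o cst 0) := integ_cst P (f 0).
have i2 := @integ_eq_law _ _ _ P _ _ P _ _ (cst (0 : R)) Z (measurable_cst _) mZ h f mf fi.
split => //; rewrite -[RHS](EEcst P).
exact/esym/(@EE_eq_law _ _ _ P _ _ P _ _ (cst (0 : R)) Z (measurable_cst _) mZ h f mf fi).
Qed.

Lemma centered_normal_sqr :
  integ P (fun w => Z w ^+ 2) /\ \int[P]_w (Z w ^+ 2) = v.
Proof.
have := centered_normal_ge0 NZ; rewrite le_eqVlt => /predU1P[v0|v0].
  by have := @centered_normal0_EE (fun x => x ^+ 2) (esym v0); rewrite expr0n/= -v0; apply.
have s0 : 0 < Num.sqrt v by rewrite sqrtr_gt0.
have [|i2 ->] := @centered_normal_EE (fun x => x ^+ 2) v0 _ (integ_normal_sqr s0) => //.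
by rewrite EE_normal_sqr// sqr_sqrtr// ltW.
Qed.

Lemma centered_normal_sqexp : 0 < v ->
  integ P (fun w => expR (Z w ^+ 2 / (4 * v))) /\
  \int[P]_w expR (Z w ^+ 2 / (4 * v)) <= Num.sqrt 2.
Proof.
move=> v0; have s0 : 0 < Num.sqrt v by rewrite sqrtr_gt0.
have E := integ_normal_sqexp s0; rewrite sqr_sqrtr ?ltW// in E.
have [|i2 ->] := @centered_normal_EE _ v0 _ E.
  apply: measurableT_comp => //.
  by apply: measurable_funM => //; apply: measurable_funX.
split => //; have := EE_normal_sqexp s0.
by rewrite sqr_sqrtr //; exact: ltW.
Qed.

Lemma centered_normal_cube : integ P (fun w => `|Z w| ^+ 3).
Proof.
have mcube : measurable_fun setT (fun x : R => `|x| ^+ 3) by exact: measurable_funX.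
have := centered_normal_ge0 NZ; rewrite le_eqVlt => /predU1P[v0|v0].
  by have [] := @centered_normal0_EE (fun x => `|x| ^+ 3) (esym v0) mcube.
have [mZ _] := NZ.
have [ie _] := centered_normal_sqexp v0.
apply: (integ_dom _ _ (integD (integ_cst P 1) (integZ (64 * v ^+ 2) ie))).
  exact: (measurableT_comp mcube).
move=> w; rewrite ger0_norm ?exprn_ge0//=.
(* With this [y], the fourth power is [64 * v ^+ 2 * (y * y)], and [y <= expR y] bounds it by a
   multiple of the integrable [expR (y + y)]. *)
set y := Z w ^+ 2 / (8 * v).
have ye : y <= expR y by rewrite (le_trans _ (expR_ge1Dx y))// lerDr.
have y0 : 0 <= y by rewrite divr_ge0 ?sqr_ge0// mulr_ge0// ltW.
have -> : Z w ^+ 2 / (4 * v) = y + y by rewrite /y; field; rewrite gt_eqF.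
rewrite expRD (@le_trans _ _ (1 + `|Z w| ^+ 4))//.
  have := normr_ge0 (Z w); move: `|Z w| => z z0.
  have [z1|/ltW z1] := leP z 1; first by rewrite (le_trans (exprn_ile1 _ _ _))// lerDl exprn_ge0.
  by rewrite (le_trans (ler_weXn2l z1 (isT : (3 <= 4)%N)))// lerDr.
rewrite lerD2l.
have -> : `|Z w| ^+ 4 = 64 * v ^+ 2 * (y * y).
  rewrite (_ : `|Z w| ^+ 4 = (`|Z w| ^+ 2) ^+ 2); last by rewrite -exprM.
  by rewrite real_normK ?num_real// /y; field; rewrite gt_eqF.
apply: ler_wpM2l; first by rewrite mulr_ge0// sqr_ge0.
exact: ler_pM.
Qed.

End centered_normal_law.

(** * Gaussian vectors *)

Section quadratic_form.
Context (R : realType) (p : nat).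
Implicit Types (S : 'I_p -> 'I_p -> R) (a : 'I_p -> R).

Definition qf S a : R := \sum_j \sum_k a j * a k * S j k.

Lemma qfZ S a t : qf S (fun j => t * a j) = t ^+ 2 * qf S a.
Proof.
rewrite /qf mulr_sumr; apply: eq_bigr => j _; rewrite mulr_sumr.
by apply: eq_bigr => k _; ring.
Qed.

Lemma linZ a t (x : p.-tuple R) : lin (fun j => t * a j) x = t * lin a x.
Proof. by rewrite /lin mulr_sumr; apply: eq_bigr => j _; rewrite mulrA. Qed.

Definition unitv (j : 'I_p) : 'I_p -> R := fun i => (i == j)%:R.

Lemma sum_unitv j (F : 'I_p -> R) : \sum_i unitv j i * F i = F j.
Proof.
rewrite (bigD1 j)//= /unitv eqxx mul1r big1 ?addr0// => i /negbTE ->.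
by rewrite mul0r.
Qed.

Lemma lin_unitv j (x : p.-tuple R) : lin (unitv j) x = tnth x j.
Proof. exact: sum_unitv. Qed.

Lemma qfE S a : qf S a = \sum_j a j * \sum_k a k * S j k.
Proof.
apply: eq_bigr => j _; rewrite mulr_sumr.
by apply: eq_bigr => k _; rewrite mulrA.
Qed.

Lemma sum_unitvD j k (F : 'I_p -> R) :
  \sum_i (unitv j i + unitv k i) * F i = F j + F k.
Proof. by under eq_bigr do rewrite mulrDl; rewrite big_split/= !sum_unitv. Qed.

Lemma qf_unitvD S j k : qf S (fun i => unitv j i + unitv k i)
  = S j j + S j k + S k j + S k k.
Proof.
by rewrite qfE sum_unitvD !sum_unitvD !addrA.
Qed.

Lemma qf_unitv S j : qf S (unitv j) = S j j.
Proof.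
by rewrite qfE !sum_unitv.
Qed.

End quadratic_form.

Section gauss_def.
Context (R : realType) d (T : measurableType d) (P : probability T R) (p : nat).

(** The symmetry clause makes [S] the covariance matrix: the quadratic form alone determines only
    its symmetric part. *)
Definition gauss (X : T -> p.-tuple R) (S : 'I_p -> 'I_p -> R) :=
  [/\ measurable_fun setT X, forall j k, S j k = S k j &
      forall a, centered_normal P (fun w => lin a (X w)) (qf S a)].

Lemma gaussI X S : measurable_fun setT X -> (forall j k, S j k = S k j) ->
  (forall a b, \int[P]_w cos (lin a (X w) + b) = cos b * expR (- (qf S a / 2))) ->
  gauss X S.
Proof.
move=> mX sS cfX; split => // a; split.
  by apply: measurableT_comp => //; exact: measurable_lin.
by move=> t b; under eq_Rintegral do rewrite -linZ; rewrite cfX qfZ.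
Qed.

Lemma gauss_cf X S : gauss X S -> forall a b,
  \int[P]_w cos (lin a (X w) + b) = cos b * expR (- (qf S a / 2)).
Proof.
move=> [_ _ h] a b; have [_ /(_ 1 b)] := h a.
by under eq_Rintegral do rewrite mul1r; rewrite expr1n mul1r.
Qed.

Lemma gauss_coord X S j : gauss X S -> centered_normal P (fun w => tnth (X w) j) (S j j).
Proof.
move=> [_ _ h]; have := h (unitv R j); rewrite qf_unitv.
by under [X in centered_normal _ X _]eq_fun do rewrite lin_unitv.
Qed.

(** [Z] and [- Z] have the same characteristic function, hence the same law and the same mean. *)
Lemma centered_normal_mean (Z : T -> R) v : centered_normal P Z v ->
  integ P Z /\ \int[P]_w Z w = 0.
Proof.
move=> NZ; have [mZ cfZ] := NZ.
have iZ : integ P Z.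
  apply: (integ_dom mZ _ (integD (integ_cst P 1) (centered_normal_cube NZ))) => w /=.
  have := normr_ge0 (Z w); move: `|Z w| => z z0.
  have [z1|/ltW z1] := leP z 1; first by rewrite (le_trans z1)// lerDl exprn_ge0.
  by rewrite (le_trans (ler_weXn2l z1 (isT : (1 <= 3)%N)))// lerDr.
split => //.
have NmZ : centered_normal P (fun w => - Z w) v.
  split; first exact: measurable_funN.
  move=> t b; under eq_Rintegral do rewrite mulrN -mulNr.
  by rewrite cfZ sqrrN.
have h := centered_normal_unique NZ NmZ.
have := @EE_eq_law _ _ _ P _ _ P _ _ Z (fun w => - Z w) mZ (measurable_funN mZ) h
  id (@measurable_id _ _ _) iZ.
rewrite /=; under [X in _ = X -> _]eq_Rintegral do rewrite -mulN1r.
rewrite EEZ//; lra.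
Qed.

(** Polarization: the variances of two coordinates and of their sum determine the covariance. *)
Lemma gauss_cov X S j k : gauss X S ->
  integ P (fun w => tnth (X w) j * tnth (X w) k) /\
  \int[P]_w (tnth (X w) j * tnth (X w) k) = S j k.
Proof.
move=> GX; have [mX sS h] := GX.
have [ij Ej] := centered_normal_sqr (gauss_coord j GX).
have [ik Ek] := centered_normal_sqr (gauss_coord k GX).
have := centered_normal_sqr (h (fun i => unitv R j i + unitv R k i)).
have linE w : lin (fun i => unitv R j i + unitv R k i) (X w) = tnth (X w) j + tnth (X w) k.
  by rewrite -!lin_unitv /lin -big_split; apply: eq_bigr => i _; rewrite mulrDl.
under [X in integ _ X]eq_fun do rewrite linE.
under [X in X = _]eq_Rintegral do rewrite linE.
rewrite qf_unitvD => -[is_ Es].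
have E : (fun w => tnth (X w) j * tnth (X w) k) = (fun w => 2^-1 * (
   (tnth (X w) j + tnth (X w) k) ^+ 2 - (tnth (X w) j ^+ 2 + tnth (X w) k ^+ 2))).
  by apply/funext => w; field.
rewrite E; split.
  by apply: integZ; apply: integB => //; exact: integD.
rewrite (EEZ _ (integB is_ (integD ij ik))) (EEB is_ (integD ij ik)) (EED ij ik).
by rewrite Es Ej Ek (sS k j); field.
Qed.

Lemma gauss_abs3 X S j : gauss X S -> integ P (fun w => `|tnth (X w) j| ^+ 3).
Proof. by move=> GX; exact: (centered_normal_cube (gauss_coord j GX)). Qed.

Lemma gauss_mean X S j : gauss X S ->
  integ P (fun w => tnth (X w) j) /\ \int[P]_w tnth (X w) j = 0.
Proof. by move=> GX; exact: (centered_normal_mean (gauss_coord j GX)). Qed.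

Lemma gauss_scale X S (l : 'I_p -> R) : gauss X S ->
  gauss (fun w => [tuple l j * tnth (X w) j | j < p]) (fun j k => l j * l k * S j k).
Proof.
move=> GX; have [mX sS _] := GX; apply: gaussI.
- apply/measurable_fun_tnthP => j.
  rewrite (_ : _ \o _ = fun w => l j * tnth (X w) j); last first.
    by apply/funext => w; rewrite /= tnth_mktuple.
  by apply: measurable_funM => //; exact: (measurableT_comp (measurable_tnth j) mX).
- by move=> j k; rewrite (sS j k) (mulrC (l j)).
move=> a b; have := gauss_cf GX (fun j => a j * l j) b.
rewrite (_ : qf S (fun j => a j * l j) = qf (fun j k => l j * l k * S j k) a); last first.
  by apply: eq_bigr => j _; apply: eq_bigr => k _; ring.
move=> <-; apply: eq_Rintegral => w _; congr (cos (_ + _)).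
by apply: eq_bigr => j _; rewrite tnth_mktuple mulrA.
Qed.

End gauss_def.

(** This is how independent copies built on product spaces stand in for the original vectors. *)
Lemma gauss_EE (R : realType) (p : nat) d1 (T1 : measurableType d1)
    (P1 : probability T1 R) (X1 : T1 -> p.-tuple R) d2 (T2 : measurableType d2)
    (P2 : probability T2 R) (X2 : T2 -> p.-tuple R) S (f : p.-tuple R -> R) :
  gauss P1 X1 S -> gauss P2 X2 S -> measurable_fun setT f ->
  integ P1 (f \o X1) -> \int[P1]_w f (X1 w) = \int[P2]_w f (X2 w).
Proof.
move=> G1 G2 mf; have [m1 _ _] := G1; have [m2 _ _] := G2.
apply: (EE_eq_law m1 m2) => //; apply: eq_law_of_cf => // a b.
by rewrite (gauss_cf G1) (gauss_cf G2).
Qed.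

Section gauss_comb.
Context (R : realType) (p : nat) d1 (T1 : measurableType d1)
  (P1 : probability T1 R) (X1 : T1 -> p.-tuple R) d2 (T2 : measurableType d2)
  (P2 : probability T2 R) (X2 : T2 -> p.-tuple R) (S1 S2 : 'I_p -> 'I_p -> R).

Definition comb_tuple (a b : R) (z : T1 * T2) : p.-tuple R :=
  [tuple a * tnth (X1 z.1) j + b * tnth (X2 z.2) j | j < p].

(** The addition formula splits the wave over the two factors of the product space. Its sine part
    drops out, having a factor of mean proportional to [cos (pi / 2)]. *)
Lemma gauss_comb (a b : R) : gauss P1 X1 S1 -> gauss P2 X2 S2 ->
  gauss (P1 \x P2)%E (comb_tuple a b)
    (fun j k => a ^+ 2 * S1 j k + b ^+ 2 * S2 j k).
Proof.
move=> G1 G2; have [m1 s1 _] := G1; have [m2 s2 _] := G2; apply: gaussI.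
- apply/measurable_fun_tnthP => j.
  rewrite (_ : _ \o _ = fun z => a * tnth (X1 z.1) j + b * tnth (X2 z.2) j); last first.
    by apply/funext => w; rewrite /= tnth_mktuple.
  apply: measurable_funD; apply: measurable_funM => //;
    apply: (measurableT_comp (measurable_tnth j)); exact: measurableT_comp.
- by move=> j k; rewrite s1 s2.
move=> c t.
have linE z : lin c (comb_tuple a b z) = a * lin c (X1 z.1) + b * lin c (X2 z.2).
  rewrite /lin !mulr_sumr -big_split; apply: eq_bigr => j _.
  by rewrite tnth_mktuple /=; ring.
have ic1 s : integ P1 (fun w => cos (a * lin c (X1 w) + s)).
  apply: (@integ_bounded _ _ _ _ _ 1).
    apply: measurableT_comp; first exact: measurable_cos.
    apply: measurable_funD => //; apply: measurable_funM => //.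
    exact: (measurableT_comp (measurable_lin c) m1).
  by move=> w; rewrite ler_norml cos_le1 cos_geN1.
have ic2 s : integ P2 (fun w => cos (b * lin c (X2 w) + s)).
  apply: (@integ_bounded _ _ _ _ _ 1).
    apply: measurableT_comp; first exact: measurable_cos.
    apply: measurable_funD => //; apply: measurable_funM => //.
    exact: (measurableT_comp (measurable_lin c) m2).
  by move=> w; rewrite ler_norml cos_le1 cos_geN1.
have E z : cos (lin c (comb_tuple a b z) + t) =
    cos (a * lin c (X1 z.1) + 0) * cos (b * lin c (X2 z.2) + t)
    - cos (a * lin c (X1 z.1) + (- (pi / 2))) * cos (b * lin c (X2 z.2) + (t - pi / 2)).
  by rewrite linE addr0 addrA !cosBpihalf -addrA cosD.
under eq_Rintegral do rewrite E.
rewrite (EEB (integ_prod (ic1 0) (ic2 t))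
  (integ_prod (ic1 (- (pi / 2))) (ic2 (t - pi / 2)))).
rewrite (EE_prod (ic1 0) (ic2 t)) (EE_prod (ic1 (- (pi / 2))) (ic2 (t - pi / 2))).
have [_ _ h1] := G1; have [_ _ h2] := G2.
have [_ cf1] := h1 c; have [_ cf2] := h2 c.
rewrite !cf1 !cf2 cos0 cosN cos_pihalf !mul0r subr0 mul1r mulrCA -expRD.
congr (_ * expR _).
have -> : qf (fun j k => a ^+ 2 * S1 j k + b ^+ 2 * S2 j k) c
    = a ^+ 2 * qf S1 c + b ^+ 2 * qf S2 c.
  rewrite /qf !mulr_sumr -big_split; apply: eq_bigr => j _ /=.
  rewrite !mulr_sumr -big_split; apply: eq_bigr => k _ /=; ring.
by field.
Qed.

End gauss_comb.

Section gauss_sum.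
Context (R : realType) d (T : measurableType d) (P : probability T R) (n p : nat).

Lemma gauss_indep_sum (X : 'I_n -> T -> p.-tuple R) (S : 'I_n -> 'I_p -> 'I_p -> R)
    (c : R) : mutually_independent P X -> (forall i, gauss P (X i) (S i)) ->
  gauss P (fun w => [tuple c * \sum_i tnth (X i w) j | j < p])
    (fun j k => c ^+ 2 * \sum_i S i j k).
Proof.
move=> indX GX; apply: gaussI.
- apply/measurable_fun_tnthP => j.
  rewrite (_ : _ \o _ = fun w => c * \sum_i tnth (X i w) j); last first.
    by apply/funext => w; rewrite /= tnth_mktuple.
  apply: measurable_funM => //; apply: measurable_sum => i.
  by apply: (measurableT_comp (measurable_tnth j)); case: (GX i).
- by move=> j k; congr (_ * _); apply: eq_bigr => i _; case: (GX i).
move=> a b.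
have mX i : measurable_fun setT (X i) by case: (GX i).
have := @EE_cos_indep_sum _ _ _ P _ _ _ X (fun i x => c * lin a x)
  (fun i => expR (- (c ^+ 2 * qf (S i) a / 2))) mX indX _ _ b.
have -> : \prod_i expR (- (c ^+ 2 * qf (S i) a / 2))
    = expR (- (qf (fun j k => c ^+ 2 * \sum_i S i j k) a / 2)).
  rewrite -expR_sum; congr expR; rewrite sumrN -mulr_suml -mulr_sumr; congr (- (_ / 2)).
  rewrite /qf exchange_big/= mulr_sumr; apply: eq_bigr => j _.
  rewrite exchange_big/= mulr_sumr; apply: eq_bigr => k _.
  by rewrite -mulr_sumr; ring.
move=> <-; first last.
- by move=> i t; have [_ _ /(_ a)[_ ->]] := GX i.
- by move=> i; apply: measurable_funM => //; exact: measurable_lin.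
apply: eq_Rintegral => w _; congr (cos (_ + _)).
rewrite -mulr_sumr exchange_big/= mulr_sumr; apply: eq_bigr => j _.
by rewrite tnth_mktuple -mulr_sumr; ring.
Qed.

(** With [u] the observed data and [c] the inverse of [sqrt n], this is the conditional law of the
    bootstrap sums, whose covariance is the empirical one. *)
Lemma gauss_multipliers (e : 'I_n -> T -> R) (u : 'I_n -> 'I_p -> R) (c : R) :
  mutually_independent P e -> (forall i, centered_normal P (e i) 1) ->
  gauss P (fun w => [tuple c * \sum_i u i j * e i w | j < p])
    (fun j k => c ^+ 2 * \sum_i u i j * u i k).
Proof.
move=> inde Ne; have me i : measurable_fun setT (e i) by case: (Ne i).
apply: gaussI.
- apply/measurable_fun_tnthP => j.
  rewrite (_ : _ \o _ = fun w => c * \sum_i u i j * e i w); last first.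
    by apply/funext => w; rewrite /= tnth_mktuple.
  apply: measurable_funM => //; apply: measurable_sum => i.
  exact: measurable_funM.
- by move=> j k; congr (_ * _); apply: eq_bigr => i _; rewrite mulrC.
move=> a b.
pose s i := c * \sum_j a j * u i j.
have := @EE_cos_indep_sum _ _ _ P _ _ _ e (fun i x => s i * x)
  (fun i => expR (- (s i ^+ 2 * 1 / 2))) me inde _ _ b.
have -> : \prod_i expR (- (s i ^+ 2 * 1 / 2))
    = expR (- (qf (fun j k => c ^+ 2 * \sum_i u i j * u i k) a / 2)).
  rewrite -expR_sum; congr expR; rewrite sumrN -mulr_suml; congr (- (_ / 2)).
  transitivity (\sum_i \sum_j \sum_k a j * a k * (c ^+ 2 * (u i j * u i k))).
    apply: eq_bigr => i _; rewrite mulr1 /s exprMn [X in _ * X]expr2.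
    rewrite mulr_suml mulr_sumr; apply: eq_bigr => j _.
    by rewrite !mulr_sumr; apply: eq_bigr => k _; ring.
  rewrite exchange_big/=; apply: eq_bigr => j _.
  rewrite exchange_big/=; apply: eq_bigr => k _.
  by rewrite -!mulr_sumr.
move=> <-; first last.
- by move=> i t; have [_ ->] := Ne i.
- by move=> i; exact: measurable_funM.
apply: eq_Rintegral => w _; congr (cos (_ + _)).
under eq_bigr => i _ do rewrite /s -mulrA mulr_suml.
rewrite -mulr_sumr exchange_big/= mulr_sumr; apply: eq_bigr => j _.
rewrite tnth_mktuple mulrCA mulr_sumr; congr (_ * _); apply: eq_bigr => i _.
by rewrite mulrA.
Qed.

End gauss_sum.

(** * Log-sum-exp and Gaussian comparison *)

Section log_sum_exp.
Context (R : realType) (p : nat) (beta K : R).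
Hypotheses (p_gt0 : (0 < p)%N) (beta_gt0 : 0 < beta) (K_ge0 : 0 <= K).
Implicit Types v h : 'I_p -> R.

(** A positive [K = expR (beta * s)] acts as an extra coordinate frozen at the value [s]. *)
Definition lse_sum v : R := K + \sum_j expR (beta * v j).
Definition lse v : R := beta^-1 * ln (lse_sum v).
Definition softmax v j : R := expR (beta * v j) / lse_sum v.
Definition softmean v h : R := \sum_j softmax v j * h j.

Lemma lse_sum_gt0 v : 0 < lse_sum v.
Proof.
rewrite /lse_sum (bigD1 (Ordinal p_gt0))//= addrCA ltr_wpDr ?expR_gt0//.
by rewrite addr_ge0// sumr_ge0// => j _; exact: expR_ge0.
Qed.

Lemma softmax_ge0 v j : 0 <= softmax v j.
Proof. by rewrite divr_ge0 ?expR_ge0// ltW// lse_sum_gt0. Qed.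

Lemma sum_softmax_le1 v : \sum_j softmax v j <= 1.
Proof.
by rewrite -mulr_suml ler_pdivrMr ?lse_sum_gt0// mul1r lerDr.
Qed.

Lemma softmax_le1 v j : softmax v j <= 1.
Proof.
rewrite (le_trans _ (sum_softmax_le1 v))// (bigD1 j)//= lerDl sumr_ge0//.
by move=> i _; exact: softmax_ge0.
Qed.

Lemma softmean_norm v h (H : R) : (forall j, `|h j| <= H) -> `|softmean v h| <= H.
Proof.
move=> hH; have H0 : 0 <= H by rewrite (le_trans _ (hH (Ordinal p_gt0))).
rewrite (le_trans (ler_norm_sum _ _ _))//.
rewrite (@le_trans _ _ (\sum_j softmax v j * H))//.
  by apply: ler_sum => j _; rewrite normrM ger0_norm ?softmax_ge0// ler_wpM2l// softmax_ge0.
by rewrite -mulr_suml ler_piMl// sum_softmax_le1.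
Qed.

Section along_line.
Variables (v h : 'I_p -> R).

Let vt (t : R) j := v j + t * h j.
(** Moments of the direction [h] under the softmax weights. The derivative of [m k] is
    [beta * (m k.+1 - m k * m 1)], so every derivative of [lse] along the line is a polynomial in
    these moments. *)
Let m (k : nat) (t : R) := softmean (vt t) (fun j => h j ^+ k).
Let s (k : nat) (t : R) := \sum_j h j ^+ k * expR (beta * vt t j).

Let mE k t : m k t = s k t / lse_sum (vt t).
Proof.
rewrite /m /s /softmean mulr_suml; apply: eq_bigr => j _.
by rewrite /softmax mulrAC (mulrC (expR _)).
Qed.

Let ds k t : is_derive t (1 : R) (s k) (beta * s k.+1 t).
Proof.
have dj j : is_derive t (1 : R) (fun u => h j ^+ k * expR (beta * vt u j))
    (beta * (h j ^+ k.+1 * expR (beta * vt t j))).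
  by rewrite /vt; apply: is_derive_eq; rewrite /GRing.scale/= exprS; ring.
have := @is_derive_sum _ _ _ _ (fun j u => h j ^+ k * expR (beta * vt u j)) t 1 _ dj.
have -> : (\sum_(j < p) (fun u => h j ^+ k * expR (beta * vt u j))) = s k.
  by apply/funext => u; rewrite fct_sumE.
by rewrite -mulr_sumr.
Qed.

Let dZ t : is_derive t (1 : R) (fun u => lse_sum (vt u)) (beta * s 1 t).
Proof.
have -> : (fun u => lse_sum (vt u)) = (fun u => K + s 0 u).
  by apply/funext => u; congr (_ + _); apply: eq_bigr => j _; rewrite expr0 mul1r.
rewrite -[X in is_derive _ _ _ X]add0r.
exact: (is_deriveD (is_derive_cst K t 1) (ds 0 t)).
Qed.

Let dg t : is_derive t (1 : R) (fun u => lse (vt u)) (m 1 t).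
Proof.
have Z0 := lse_sum_gt0 (vt t).
have D := @is_derive1_comp _ (@ln R) (fun u => lse_sum (vt u)) t _ _
  (is_derive1_ln Z0) (dZ t).
apply: (is_derive_eq (is_deriveZ beta^-1 D)).
by rewrite mE /GRing.scale/=; field; rewrite !gt_eqF.
Qed.

Let dm k t : is_derive t (1 : R) (m k) (beta * (m k.+1 t - m k t * m 1 t)).
Proof.
have Z0 := lse_sum_gt0 (vt t); have Zn0 : lse_sum (vt t) != 0 by rewrite gt_eqF.
have -> : m k = (fun u => s k u * (lse_sum (vt u))^-1).
  by apply/funext => u; rewrite mE.
have DV := @is_deriveV _ (fun u => lse_sum (vt u)) t _ 1 Zn0 (dZ t).
apply: (is_derive_eq (is_deriveM (ds k t) DV)).
by rewrite !mE /GRing.scale/=; field.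
Qed.

Let dm1 t : is_derive t (1 : R) (fun u => beta * (m 2 u - m 1 u * m 1 u))
  (beta ^+ 2 * (m 3 t - 3 * m 1 t * m 2 t + 2 * m 1 t ^+ 3)).
Proof.
apply: (is_derive_eq (is_deriveZ beta (is_deriveB (dm 2 t) (is_deriveM (dm 1 t) (dm 1 t))))).
by rewrite /GRing.scale/=; ring.
Qed.

Let vt0 : vt 0 = v. Proof. by apply/funext => j; rewrite /vt mul0r addr0. Qed.
Let m1E t : m 1 t = softmean (vt t) h. Proof. by []. Qed.

Let mnorm k t (H : R) : (forall j, `|h j| <= H) -> `|m k t| <= H ^+ k.
Proof.
move=> hH; apply: softmean_norm => j; rewrite normrX.
by rewrite lerXn2r ?nnegrE// (le_trans _ (hH j)).
Qed.

Lemma lse_taylor2_line (H t : R) : (forall j, `|h j| <= H) ->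
  `|lse (fun j => v j + t * h j) - lse v - t * softmean v h|
  <= 2 * beta * H ^+ 2 * t ^+ 2.
Proof.
move=> hH; have H0 : 0 <= H by rewrite (le_trans _ (hH (Ordinal p_gt0))).
have := @taylor2_bound _ _ _ _ (2 * beta * H ^+ 2) t dg (dm 1).
rewrite m1E vt0; apply => u.
rewrite normrM (gtr0_norm beta_gt0) (mulrC 2) -mulrA ler_wpM2l ?(ltW beta_gt0)//.
rewrite (le_trans (ler_normB _ _))// normrM.
have h1 := mnorm 1 u hH; have h2 := mnorm 2 u hH; rewrite expr1 in h1.
have : `|m 1 u| * `|m 1 u| <= H * H by rewrite ler_pM.
rewrite -expr2; lra.
Qed.

Lemma lse_taylor3_line (H : R) : (forall j, `|h j| <= H) ->
  `|lse (fun j => v j + h j) - lse v - softmean v h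
    - beta / 2 * (softmean v (fun j => h j ^+ 2) - softmean v h ^+ 2)|
  <= 6 * beta ^+ 2 * H ^+ 3.
Proof.
move=> hH; have H0 : 0 <= H by rewrite (le_trans _ (hH (Ordinal p_gt0))).
(* The coefficients 1, 3 and 2 in the third derivative add up to 6. *)
have := @taylor3_bound _ _ _ _ _ (6 * beta ^+ 2 * H ^+ 3) 1 dg (dm 1) dm1.
rewrite !m1E vt0 normr1 !expr1n mul1r mulr1.
have -> : vt 1 = (fun j => v j + h j) by apply/funext => j; rewrite /vt mul1r.
have -> : 1 / 2 * (beta * (m 2 0 - softmean v h * softmean v h)) =
  beta / 2 * (softmean v (fun j => h j ^+ 2) - softmean v h ^+ 2).
  by rewrite /m vt0; field.
apply => u.
have -> : 6 * beta ^+ 2 * H ^+ 3 = beta ^+ 2 * (6 * H ^+ 3) by ring.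
rewrite normrM (ger0_norm (sqr_ge0 beta)) ler_wpM2l ?sqr_ge0//.
have h1 := mnorm 1 u hH; have h2 := mnorm 2 u hH; rewrite expr1 in h1.
have h3 := mnorm 3 u hH.
have h12 : `|m 1 u| * `|m 2 u| <= H * H ^+ 2 by rewrite ler_pM.
have h111 : `|m 1 u| ^+ 3 <= H ^+ 3 by rewrite lerXn2r ?nnegrE.
rewrite -exprS in h12.
rewrite (le_trans (ler_normD _ _))//.
have n3 : `|3 * m 1 u * m 2 u| <= 3 * H ^+ 3.
  by rewrite -mulrA !normrM ger0_norm// ler_wpM2l.
have n2 : `|2 * m 1 u ^+ 3| <= 2 * H ^+ 3.
  by rewrite normrM normrX ger0_norm// ler_wpM2l.
have := ler_normB (m 3 u) (3 * m 1 u * m 2 u); lra.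
Qed.

(** The gradient is nonnegative with total mass at most 1. *)
Lemma lse_lip (H : R) : (forall j, `|h j| <= H) ->
  `|lse (fun j => v j + h j) - lse v| <= H.
Proof.
move=> hH.
have [c _ E] := mean_value0 1 dg.
move: E; rewrite vt0 mulr1 => E.
rewrite (_ : (fun j => v j + h j) = vt 1); last by apply/funext => j; rewrite /vt mul1r.
by rewrite E; have := mnorm 1 c hH; rewrite expr1.
Qed.

End along_line.

End log_sum_exp.

Section lse_gauss.
Context (R : realType) (p : nat) (beta K : R) (mu : 'I_p -> R).
Hypotheses (p_gt0 : (0 < p)%N) (beta_gt0 : 0 < beta) (K_ge0 : 0 <= K).

(** The shift brings a threshold to 0. It may depend on [j] because coordinates are later divided by
    different standard deviations. *)
Definition shifted (x : p.-tuple R) : 'I_p -> R := fun j => mu j + tnth x j.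

Lemma measurable_lse : measurable_fun setT (fun x => lse beta K (shifted x)).
Proof.
apply: measurable_funM => //.
apply: measurableT_comp; first exact: measurable_ln.
apply: measurable_funD => //; apply: measurable_sum => j.
apply: measurableT_comp => //; apply: measurable_funM => //.
by apply: measurable_funD => //; exact: measurable_tnth.
Qed.

Lemma measurable_softmax j : measurable_fun setT (fun x => softmax beta K (shifted x) j).
Proof.
rewrite (_ : (fun x => _) = fun x =>
  expR (beta * (mu j + tnth x j) - ln (lse_sum beta K (shifted x)))); last first.
  apply/funext => x; rewrite expRD expRN lnK//.
  by rewrite posrE lse_sum_gt0.
apply: measurableT_comp => //; apply: measurable_funB.
  apply: measurable_funM => //.
  by apply: measurable_funD => //; exact: measurable_tnth.
apply: measurableT_comp; first exact: measurable_ln.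
apply: measurable_funD => //; apply: measurable_sum => i.
apply: measurableT_comp => //; apply: measurable_funM => //.
by apply: measurable_funD => //; exact: measurable_tnth.
Qed.

Context d1 (T1 : measurableType d1) (P1 : probability T1 R) (V : T1 -> p.-tuple R)
  (A : 'I_p -> 'I_p -> R) (GV : gauss P1 V A).

Let F x := lse beta K (shifted x).
Let w x j := softmax beta K (shifted x) j.

Lemma integ_lse : integ P1 (fun u => lse beta K (shifted (V u))).
Proof.
have [mV _ _] := GV.
apply: (integ_dom _ _ (integD (integ_cst P1 `|lse beta K mu|)
   (integ_sum (fun j => integ_norm (gauss_mean j GV).1)))).
  exact: (measurableT_comp measurable_lse mV).
move=> u; have := @lse_lip _ _ _ _ p_gt0 beta_gt0 K_ge0 mu
  (fun j => tnth (V u) j) (\sum_j `|tnth (V u) j|) _.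
rewrite -/(shifted _) => h /=.
have {}h : `|lse beta K (shifted (V u)) - lse beta K mu| <= \sum_j `|tnth (V u) j|.
  by apply: h => j; rewrite (bigD1 j)//= lerDl sumr_ge0.
rewrite -[lse _ _ (shifted _)](subrK (lse beta K mu)) addrC.
by rewrite (le_trans (ler_normD _ _))// lerD2l.
Qed.

Lemma integ_softmax j : integ P1 (fun u => w (V u) j).
Proof.
have [mV _ _] := GV; apply: (@integ_bounded _ _ _ _ _ 1).
  exact: (measurableT_comp (measurable_softmax j) mV).
by move=> u; rewrite ger0_norm ?softmax_ge0// softmax_le1.
Qed.

Lemma integ_softmax2 j k : integ P1 (fun u => w (V u) j * w (V u) k).
Proof.
have [mV _ _] := GV; apply: (@integ_bounded _ _ _ _ _ 1).
  by apply: measurable_funM; [exact: (measurableT_comp (measurable_softmax j) mV)|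
    exact: (measurableT_comp (measurable_softmax k) mV)].
move=> u; rewrite normrM mulr_ile1// ger0_norm ?softmax_ge0// softmax_le1//.
Qed.

(* beta^-1 times the expected trace of B against the Hessian of the
   log-sum-exp function *)
Definition lse_trace (B : 'I_p -> 'I_p -> R) : R :=
  \sum_j (\int[P1]_u w (V u) j) * B j j
  - \sum_j \sum_k (\int[P1]_u (w (V u) j * w (V u) k)) * B j k.

(** Each of the two sums averages matrix entries with nonnegative weights of total mass at most 1,
    so each contributes at most [D], whatever [p] is. *)
Lemma lse_traceB B B' D : (forall j k, `|B j k - B' j k| <= D) ->
  `|lse_trace B - lse_trace B'| <= 2 * D.
Proof.
move=> BD; have D0 : 0 <= D by exact: le_trans (BD (Ordinal p_gt0) (Ordinal p_gt0)).
have -> : lse_trace B - lse_trace B' = lse_trace (fun j k => B j k - B' j k).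
  rewrite /lse_trace.
  have -> : \sum_j (\int[P1]_u w (V u) j) * (B j j - B' j j) =
    \sum_j (\int[P1]_u w (V u) j) * B j j - \sum_j (\int[P1]_u w (V u) j) * B' j j.
    by rewrite -sumrB; apply: eq_bigr => j _; rewrite mulrBr.
  have -> : \sum_j \sum_k (\int[P1]_u (w (V u) j * w (V u) k)) * (B j k - B' j k) =
    \sum_j \sum_k (\int[P1]_u (w (V u) j * w (V u) k)) * B j k -
    \sum_j \sum_k (\int[P1]_u (w (V u) j * w (V u) k)) * B' j k.
    rewrite -sumrB; apply: eq_bigr => j _; rewrite -sumrB.
    by apply: eq_bigr => k _; rewrite mulrBr.
  ring.
rewrite (le_trans (ler_normB _ _))// mulr_natl mulr2n lerD//.
  rewrite (le_trans (ler_norm_sum _ _ _))//.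
  rewrite (@le_trans _ _ (\sum_j (\int[P1]_u w (V u) j) * D))//.
    apply: ler_sum => j _; rewrite normrM ger0_norm ?ler_wpM2l//;
    by apply: Rintegral_ge0 => u _; exact: softmax_ge0.
  rewrite -mulr_suml ler_piMl// -EEsum; last exact: integ_softmax.
  rewrite -[leRHS](EEcst P1); apply: EEle.
  - exact: integ_sum integ_softmax.
  - exact: integ_cst.
  - by move=> u; exact: sum_softmax_le1.
rewrite (le_trans (ler_norm_sum _ _ _))//.
rewrite (@le_trans _ _ (\sum_j \sum_k (\int[P1]_u (w (V u) j * w (V u) k)) * D))//.
  apply: ler_sum => j _; rewrite (le_trans (ler_norm_sum _ _ _))//.
  apply: ler_sum => k _; rewrite normrM ger0_norm ?ler_wpM2l//;
  by apply: Rintegral_ge0 => u _; rewrite mulr_ge0// softmax_ge0.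
have E j : \sum_k (\int[P1]_u (w (V u) j * w (V u) k)) * D
    = (\int[P1]_u (\sum_k w (V u) j * w (V u) k)) * D.
  by rewrite -mulr_suml EEsum// => k; exact: integ_softmax2.
under eq_bigr do rewrite E.
rewrite -mulr_suml ler_piMl//.
rewrite -EEsum; last by move=> j; apply: integ_sum => k; exact: integ_softmax2.
rewrite -[leRHS](EEcst P1); apply: EEle.
- by apply: integ_sum => j; apply: integ_sum => k; exact: integ_softmax2.
- exact: integ_cst.
- move=> u; under eq_bigr do rewrite -mulr_sumr.
  rewrite -mulr_suml mulr_ile1 ?sum_softmax_le1// sumr_ge0// => j _; exact: softmax_ge0.
Qed.

End lse_gauss.

(** * Effect of a small independent Gaussian perturbation *)

Section lse_step.
Context (R : realType) (p : nat) (beta K : R) (mu : 'I_p -> R).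
Hypotheses (p_gt0 : (0 < p)%N) (beta_gt0 : 0 < beta) (K_ge0 : 0 <= K).
Context d1 (T1 : measurableType d1) (P1 : probability T1 R) (V : T1 -> p.-tuple R)
  (A : 'I_p -> 'I_p -> R) (GV : gauss P1 V A).
Context d2 (T2 : measurableType d2) (P2 : probability T2 R) (X : T2 -> p.-tuple R)
  (B : 'I_p -> 'I_p -> R) (GX : gauss P2 X B) (r : R).
Hypothesis r_ge0 : 0 <= r.

Let F x := lse beta K (shifted mu x).
Let w x j := softmax beta K (shifted mu x) j.

(** Replacing the largest cube by the sum of cubes costs a dependence on [p], harmless because of
    the factor [r ^+ 3], and makes the remainder integrable. *)
Lemma lse_taylor3_pointwise (v h : 'I_p -> R) :
  `|lse beta K (fun j => v j + r * h j) - lse beta K v - r * softmean beta K v h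
    - r ^+ 2 * (beta / 2) * (softmean beta K v (fun j => h j ^+ 2) - softmean beta K v h ^+ 2)|
  <= 6 * beta ^+ 2 * r ^+ 3 * \sum_j `|h j| ^+ 3.
Proof.
have [[j0 vj0] hj0] := vmaxP (fun j => `|h j|) p_gt0.
have hH j : `|r * h j| <= r * `|h j0|.
  by rewrite normrM ger0_norm// ler_wpM2l// -vj0.
have := lse_taylor3_line p_gt0 beta_gt0 K_ge0 v hH.
have -> : softmean beta K v (fun j => r * h j) = r * softmean beta K v h.
  by rewrite /softmean mulr_sumr; apply: eq_bigr => j _; ring.
have -> : softmean beta K v (fun j => (r * h j) ^+ 2) = r ^+ 2 * softmean beta K v (fun j => h j ^+ 2).
  by rewrite /softmean mulr_sumr; apply: eq_bigr => j _; ring.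
have -> : r ^+ 2 * (beta / 2) * (softmean beta K v (fun j => h j ^+ 2) - softmean beta K v h ^+ 2)
  = beta / 2 * (r ^+ 2 * softmean beta K v (fun j => h j ^+ 2) - (r * softmean beta K v h) ^+ 2).
  ring.
move=> /le_trans; apply; rewrite exprMn mulrA.
apply: ler_wpM2l; first by rewrite mulr_ge0 ?exprn_ge0// mulr_ge0// sqr_ge0.
by rewrite (bigD1 j0)//= lerDl sumr_ge0// => j _; rewrite exprn_ge0.
Qed.

(** The perturbation is independent of [V] and centered, so the linear term has mean 0 and the
    quadratic one pairs the Hessian at [V] with the covariance [B]. *)
Lemma lse_step :
  `|\int[(P1 \x P2)%E]_z F (comb_tuple V X 1 r z) - \int[P1]_u F (V u)
    - r ^+ 2 * (beta / 2) * lse_trace beta K mu P1 V B|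
  <= 6 * beta ^+ 2 * r ^+ 3 * \sum_j \int[P2]_u `|tnth (X u) j| ^+ 3.
Proof.
pose PP := (P1 \x P2)%E.
have iF1 : integ PP (fun z => F (comb_tuple V X 1 r z)).
  exact: (integ_lse mu p_gt0 beta_gt0 K_ge0 (gauss_comb 1 r GV GX)).
have iF2 := integ_lse mu p_gt0 beta_gt0 K_ge0 GV.
have iF2' : integ PP (fun z => F (V z.1)) := integ_fst P2 iF2.
have iw j : integ P1 (fun u => w (V u) j) := integ_softmax beta mu p_gt0 K_ge0 GV j.
have iww j k : integ P1 (fun u => w (V u) j * w (V u) k) := integ_softmax2 beta mu p_gt0 K_ge0 GV j k.
have iX j : integ P2 (fun u => tnth (X u) j) by case: (gauss_mean j GX).
have iXX j k : integ P2 (fun u => tnth (X u) j * tnth (X u) k) by case: (gauss_cov j k GX).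
(* The linear term and the two halves of the quadratic term, written as sums of products over the
   two factors of the product space. *)
pose Q1 z := \sum_j w (V z.1) j * tnth (X z.2) j.
pose Q2 z := \sum_j w (V z.1) j * (tnth (X z.2) j * tnth (X z.2) j).
pose Q3 z := \sum_j \sum_k (w (V z.1) j * w (V z.1) k) * (tnth (X z.2) j * tnth (X z.2) k).
have iQ1j j := integ_prod (iw j) (iX j).
have iQ2j j := integ_prod (iw j) (iXX j j).
have iQ3jk j k := integ_prod (iww j k) (iXX j k).
have iQ1 : integ PP Q1 := integ_sum iQ1j.
have iQ2 : integ PP Q2 := integ_sum iQ2j.
have iQ3 : integ PP Q3 := integ_sum (fun j => integ_sum (iQ3jk j)).
have EQ1 : \int[PP]_z Q1 z = 0.
  rewrite (EEsum iQ1j) big1// => j _.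
  by rewrite (EE_prod (iw j) (iX j)) (gauss_mean j GX).2 mulr0.
have EQ23 : \int[PP]_z Q2 z - \int[PP]_z Q3 z = lse_trace beta K mu P1 V B.
  rewrite (EEsum iQ2j) (EEsum (fun j => integ_sum (iQ3jk j))); congr (_ - _).
    by apply: eq_bigr => j _; rewrite (EE_prod (iw j) (iXX j j)) (gauss_cov j j GX).2.
  apply: eq_bigr => j _; rewrite (EEsum (iQ3jk j)); apply: eq_bigr => k _.
  by rewrite (EE_prod (iww j k) (iXX j k)) (gauss_cov j k GX).2.
have i3 : integ P2 (fun u => \sum_j `|tnth (X u) j| ^+ 3).
  by apply: integ_sum => j; exact: (gauss_abs3 j GX).
have i3' : integ PP (fun z => \sum_j `|tnth (X z.2) j| ^+ 3) := integ_snd P1 i3.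
pose c := r ^+ 2 * (beta / 2).
have iD : integ PP (fun z => F (comb_tuple V X 1 r z) - F (V z.1) - r * Q1 z - c * (Q2 z - Q3 z)).
  apply: integB; last by apply: integZ; exact: integB.
  by apply: integB; [exact: integB|exact: integZ].
have -> : \int[PP]_z F (comb_tuple V X 1 r z) - \int[P1]_u F (V u)
    - r ^+ 2 * (beta / 2) * lse_trace beta K mu P1 V B =
    \int[PP]_z (F (comb_tuple V X 1 r z) - F (V z.1) - r * Q1 z - c * (Q2 z - Q3 z)).
  rewrite (EEB (integB (integB iF1 iF2') (integZ r iQ1)) (integZ c (integB iQ2 iQ3))).
  rewrite (EEB (integB iF1 iF2') (integZ r iQ1)) (EEB iF1 iF2') (EEZ r iQ1) EQ1 mulr0 subr0.
  by rewrite (EEZ c (integB iQ2 iQ3)) (EEB iQ2 iQ3) EQ23 (EE_fst P2 iF2).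
rewrite (le_trans (EEnorm iD))//.
rewrite -(EEsum (fun j => gauss_abs3 j GX)) -(EE_snd P1 i3) -(EEZ _ i3').
apply: EEle; [exact: integ_norm|exact: integZ|move=> z].
have := lse_taylor3_pointwise (shifted mu (V z.1)) (fun j => tnth (X z.2) j).
have -> : lse beta K (fun j => shifted mu (V z.1) j + r * tnth (X z.2) j) = F (comb_tuple V X 1 r z).
  congr lse; apply/funext => j.
  by rewrite /shifted tnth_mktuple mul1r addrA.
have -> : softmean beta K (shifted mu (V z.1)) (fun j => tnth (X z.2) j) = Q1 z by [].
have -> : softmean beta K (shifted mu (V z.1)) (fun j => tnth (X z.2) j ^+ 2) = Q2 z.
  by apply: eq_bigr => j _; rewrite expr2.
have -> : Q1 z ^+ 2 = Q3 z; last by [].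
rewrite expr2 /Q1 mulr_suml; apply: eq_bigr => j _; rewrite mulr_sumr.
by apply: eq_bigr => k _; ring.
Qed.

End lse_step.

Section lse_comparison.
Context (R : realType) (p : nat) (beta K : R) (mu : 'I_p -> R).
Hypotheses (p_gt0 : (0 < p)%N) (beta_gt0 : 0 < beta) (K_ge0 : 0 <= K).
Context d1 (T1 : measurableType d1) (P1 : probability T1 R) (X : T1 -> p.-tuple R)
  (SX : 'I_p -> 'I_p -> R) (GX : gauss P1 X SX).
Context d2 (T2 : measurableType d2) (P2 : probability T2 R) (Y : T2 -> p.-tuple R)
  (SY : 'I_p -> 'I_p -> R) (GY : gauss P2 Y SY).
Variable D : R.
Hypothesis SXY : forall j k, `|SX j k - SY j k| <= D.

Let F x := lse beta K (shifted mu x).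
Let mF : measurable_fun setT F. Proof. exact: measurable_lse. Qed.
Let CX := \sum_j \int[P1]_u `|tnth (X u) j| ^+ 3.
Let CY := \sum_j \int[P2]_u `|tnth (Y u) j| ^+ 3.

(* Slepian interpolation. The increments are compared through Taylor expansions
   at a common Gaussian vector, so that no derivative in [s] is needed. *)
Let U (s : R) := \int[(P1 \x P2)%E]_z F (comb_tuple X Y (Num.sqrt (1 - s)) (Num.sqrt s) z).

Let U_step (s dl : R) : 0 <= s -> 0 <= dl -> s + dl <= 1 ->
  `|U (s + dl) - U s| <= dl * (beta * D) + 6 * beta ^+ 2 * (CX + CY) * Num.sqrt dl ^+ 3.
Proof.
move=> s0 dl0 sdl1.
(* The common part of both ends of the step: adding [sqrt dl] times a copy of [X] gives the law at
   [s], adding [sqrt dl] times a copy of [Y] gives the law at [s + dl]. *)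
pose V := comb_tuple X Y (Num.sqrt (1 - (s + dl))) (Num.sqrt s).
have GV := gauss_comb (Num.sqrt (1 - (s + dl))) (Num.sqrt s) GX GY.
rewrite -/V in GV.
have r2 : Num.sqrt dl ^+ 2 = dl by rewrite sqr_sqrtr.
have GVX := gauss_comb 1 (Num.sqrt dl) GV GX.
have GVY := gauss_comb 1 (Num.sqrt dl) GV GY.
have Gs := gauss_comb (Num.sqrt (1 - s)) (Num.sqrt s) GX GY.
have Gsd := gauss_comb (Num.sqrt (1 - (s + dl))) (Num.sqrt (s + dl)) GX GY.
have q1 : Num.sqrt (1 - s) ^+ 2 = 1 - s by rewrite sqr_sqrtr//; lra.
have q2 : Num.sqrt (1 - (s + dl)) ^+ 2 = 1 - (s + dl) by rewrite sqr_sqrtr//; lra.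
have q3 : Num.sqrt s ^+ 2 = s by rewrite sqr_sqrtr.
have q4 : Num.sqrt (s + dl) ^+ 2 = s + dl by rewrite sqr_sqrtr//; lra.
have UX : U s = \int[((P1 \x P2) \x P1)%E]_z F (comb_tuple V X 1 (Num.sqrt dl) z).
  rewrite /U; apply: (gauss_EE Gs _ mF); last exact: (integ_lse mu p_gt0 beta_gt0 K_ge0 Gs).
  move: GVX; congr gauss; apply/funext => j; apply/funext => k.
  by rewrite !expr1n r2 q1 q2 q3; ring.
have UY : U (s + dl) = \int[((P1 \x P2) \x P2)%E]_z F (comb_tuple V Y 1 (Num.sqrt dl) z).
  rewrite /U; apply: (gauss_EE Gsd _ mF); last exact: (integ_lse mu p_gt0 beta_gt0 K_ge0 Gsd).
  move: GVY; congr gauss; apply/funext => j; apply/funext => k.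
  by rewrite !expr1n r2 q2 q3 q4; ring.
have hX := lse_step mu p_gt0 beta_gt0 K_ge0 GV GX (sqrtr_ge0 dl).
have hY := lse_step mu p_gt0 beta_gt0 K_ge0 GV GY (sqrtr_ge0 dl).
rewrite -/CX -UX r2 in hX; rewrite -/CY -UY r2 in hY.
have := lse_traceB beta mu p_gt0 K_ge0 GV SXY.
move: hX hY; set tX := lse_trace _ _ _ _ _ SX; set tY := lse_trace _ _ _ _ _ SY.
set E0 := Rintegral _ _ _; move: (U (s + dl)) (U s) E0 tX tY CX CY => a b e {}tX {}tY cX cY hX hY tXY.
have -> : a - b = (a - e - dl * (beta / 2) * tY)
  - (b - e - dl * (beta / 2) * tX) - dl * (beta / 2) * (tX - tY) by ring.
rewrite (le_trans (ler_normB _ _))//.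
have h3 : `|dl * (beta / 2) * (tX - tY)| <= dl * (beta * D).
  rewrite normrM ger0_norm ?mulr_ge0 ?divr_ge0 ?(ltW beta_gt0)//.
  have -> : dl * (beta * D) = dl * (beta / 2) * (2 * D) by field.
  by rewrite ler_wpM2l// mulr_ge0// divr_ge0// ltW.
rewrite addrC lerD//.
rewrite (le_trans (ler_normB _ _))// (le_trans (lerD hY hX))//.
by rewrite le_eqVlt; apply/orP; left; apply/eqP; ring.
Qed.

Lemma lse_comparison :
  `|\int[P1]_u F (X u) - \int[P2]_u F (Y u)| <= beta * D.
Proof.
have U0 : U 0 = \int[P1]_u F (X u).
  have G0 := gauss_comb (Num.sqrt (1 - 0)) (Num.sqrt 0) GX GY.
  rewrite /U; apply: (gauss_EE G0 _ mF); last exact: (integ_lse mu p_gt0 beta_gt0 K_ge0 G0).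
  move: GX; congr gauss; apply/funext => j; apply/funext => k.
  by rewrite subr0 sqrtr1 sqrtr0 expr1n expr0n/=; ring.
have U1 : U 1 = \int[P2]_u F (Y u).
  have G1 := gauss_comb (Num.sqrt (1 - 1)) (Num.sqrt 1) GX GY.
  rewrite /U; apply: (gauss_EE G1 _ mF); last exact: (integ_lse mu p_gt0 beta_gt0 K_ge0 G1).
  move: GY; congr gauss; apply/funext => j; apply/funext => k.
  by rewrite subrr sqrtr1 sqrtr0 expr1n expr0n/=; ring.
rewrite -U0 -U1 distrC.
pose c := 6 * beta ^+ 2 * (CX + CY).
have c0 : 0 <= c.
  apply: mulr_ge0; first by rewrite mulr_ge0// sqr_ge0.
  by apply: addr_ge0; apply: sumr_ge0 => j _; apply: Rintegral_ge0 => u _; rewrite exprn_ge0.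
have us := U_step.
move: us; move: (U) => u us.
(* Over [N] steps of length [1 / N] the linear terms add up to [beta * D], while the remainders
   total [N * c * N^(-3/2)], which vanishes as [N] grows. *)
have main (N : nat) : (0 < N)%N -> `|u 1 - u 0| <= beta * D + c * Num.sqrt (N%:R^-1).
  move=> N0; have NR0 : 0 < N%:R :> R by rewrite ltr0n.
  have -> : u 1 - u 0 = \sum_(0 <= m < N) (u (m.+1%:R / N%:R) - u (m%:R / N%:R)).
    by rewrite (telescope_sumr (fun m => u (m%:R / N%:R)))// divff ?gt_eqF// mul0r.
  rewrite (le_trans (ler_norm_sum _ _ _))//.
  rewrite (@le_trans _ _ (\sum_(0 <= m < N)
    (N%:R^-1 * (beta * D) + c * Num.sqrt (N%:R^-1) ^+ 3)))//.
    rewrite !big_mkord; apply: ler_sum => m _.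
    have -> : m.+1%:R / N%:R = m%:R / N%:R + N%:R^-1 :> R by rewrite -natr1 mulrDl mul1r.
    apply: us; rewrite ?divr_ge0 ?invr_ge0 ?ler0n//.
    by rewrite -[X in _ + X]mul1r -mulrDl natr1 ler_pdivrMr// mul1r ler_nat.
  rewrite sumr_const_nat subn0 exprS sqr_sqrtr ?invr_ge0 ?ler0n// le_eqVlt.
  by apply/orP; left; apply/eqP; rewrite -mulr_natl; field; rewrite gt_eqF.
apply/ler_addgt0Pr => e e0.
pose N := (Num.truncn ((c / e) ^+ 2)).+1.
rewrite (le_trans (main N isT))// lerD2l.
have NR0 : 0 < N%:R :> R by rewrite ltr0n.
have cN : (c / e) ^+ 2 <= N%:R by rewrite ltW// truncnS_gt.
rewrite sqrtrV ?ler0n// ler_pdivrMr ?sqrtr_gt0// mulrC -ler_pdivrMr//.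
rewrite -[leLHS](ger0_norm (divr_ge0 c0 (ltW e0))) -sqrtr_sqr.
exact: ler_wsqrtr.
Qed.

End lse_comparison.

(** * The Hessian trace and dilation *)

Section lse_stationarity.
Context (R : realType) (p : nat) (beta K : R) (mu : 'I_p -> R).
Hypotheses (p_gt0 : (0 < p)%N) (beta_gt0 : 0 < beta) (K_ge0 : 0 <= K).
Context d (T : measurableType d) (P : probability T R) (Y : T -> p.-tuple R)
  (S : 'I_p -> 'I_p -> R) (GY : gauss P Y S) (S1 : forall j, S j j = 1).

Let F x := lse beta K (shifted mu x).
Let w x j := softmax beta K (shifted mu x) j.
Let mF : measurable_fun setT F. Proof. exact: measurable_lse. Qed.
Let iF : integ P (fun u => F (Y u)) := integ_lse mu p_gt0 beta_gt0 K_ge0 GY.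
Let iw j : integ P (fun u => w (Y u) j) := integ_softmax beta mu p_gt0 K_ge0 GY j.
Let iww j k : integ P (fun u => w (Y u) j * w (Y u) k)
  := integ_softmax2 beta mu p_gt0 K_ge0 GY j k.

Let iYY j k : integ P (fun u => tnth (Y u) j * tnth (Y u) k).
Proof. by case: (gauss_cov j k GY). Qed.

Let iY j : integ P (fun u => tnth (Y u) j).
Proof. by case: (gauss_mean j GY). Qed.

Lemma gauss_cov_le1 j k : S j k <= 1.
Proof.
rewrite -(gauss_cov j k GY).2.
have -> : 1 = \int[P]_u (2^-1 * (tnth (Y u) j * tnth (Y u) j + tnth (Y u) k * tnth (Y u) k)).
  rewrite (EEZ _ (integD (iYY j j) (iYY k k))) (EED (iYY j j) (iYY k k)).
  by rewrite !(gauss_cov _ _ GY).2 !S1; field.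
apply: EEle => [||u]; first exact: iYY.
  by apply: integZ; exact: (integD (iYY j j) (iYY k k)).
have := sqr_ge0 (tnth (Y u) j - tnth (Y u) k); lra.
Qed.

(** With unit variances no covariance exceeds 1. Replacing each [S j k] by 1 lowers the trace to the
    mean of [s * (1 - s)], where [s] is the total softmax weight. *)
Lemma lse_trace_ge :
  \int[P]_u ((\sum_j w (Y u) j) * (1 - \sum_j w (Y u) j)) <= lse_trace beta K mu P Y S.
Proof.
have E u : (\sum_j w (Y u) j) * (1 - \sum_j w (Y u) j) =
    \sum_j w (Y u) j - \sum_j \sum_k w (Y u) j * w (Y u) k.
  rewrite mulrBr mulr1; congr (_ - _); rewrite mulr_suml.
  by apply: eq_bigr => j _; rewrite mulr_sumr.
under eq_Rintegral do rewrite E.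
rewrite (EEB (integ_sum iw) (integ_sum (fun j => integ_sum (iww j)))).
rewrite (EEsum iw) (EEsum (fun j => integ_sum (iww j))) /lse_trace.
under [X in _ <= X - _]eq_bigr do rewrite S1 mulr1.
rewrite lerD2l lerN2; apply: ler_sum => j _.
rewrite (EEsum (iww j)); apply: ler_sum => k _.
rewrite ler_piMr ?gauss_cov_le1//.
by apply: Rintegral_ge0 => u _; rewrite mulr_ge0// softmax_ge0.
Qed.

Let iwY j : integ P (fun u => w (Y u) j * tnth (Y u) j).
Proof.
apply: (integ_dom _ _ (integ_norm (iY j))).
  by apply: measurable_funM; apply: integ_meas; [exact: iw|exact: iY].
move=> u; rewrite normrM ler_piMl// ger0_norm ?softmax_ge0//.
exact: softmax_le1.
Qed.

Let m1 := \int[P]_u (softmean beta K (shifted mu (Y u)) (fun j => tnth (Y u) j)).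

Lemma lse_trace_ge0 : 0 <= lse_trace beta K mu P Y S.
Proof.
apply: le_trans lse_trace_ge; apply: Rintegral_ge0 => u _.
rewrite mulr_ge0 ?subr_ge0 ?sum_softmax_le1// sumr_ge0// => j _.
exact: softmax_ge0.
Qed.

(* (1 + t) Y and Y + r Y' have the same law when r ^+ 2 = 2 t + t ^+ 2; compare
   the expansions of the expected log-sum-exp function along both. *)
Lemma lse_dilation (t : R) : 0 < t -> t <= 1 ->
  beta * lse_trace beta K mu P Y S <= m1 +
   (2 * beta * \sum_j \int[P]_u (tnth (Y u) j * tnth (Y u) j) +
    36 * beta ^+ 2 * \sum_j \int[P]_u `|tnth (Y u) j| ^+ 3) * Num.sqrt t.
Proof.
move=> t0 t1.
pose r := Num.sqrt (2 * t + t ^+ 2).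
have r2 : r ^+ 2 = 2 * t + t ^+ 2 by rewrite sqr_sqrtr// addr_ge0 ?sqr_ge0//; lra.
have r0 : 0 <= r by exact: sqrtr_ge0.
have Gs := gauss_scale (fun=> 1 + t) GY.
have Gc := gauss_comb 1 r GY GY.
have Eab : \int[P]_u F [tuple (1 + t) * tnth (Y u) j | j < p]
    = \int[(P \x P)%E]_z F (comb_tuple Y Y 1 r z).
  apply: (gauss_EE Gs _ mF); last exact: (integ_lse mu p_gt0 beta_gt0 K_ge0 Gs).
  move: Gc; congr gauss; apply/funext => j; apply/funext => k.
  by rewrite expr1n r2; ring.
have hb := lse_step mu p_gt0 beta_gt0 K_ge0 GY GY r0.
rewrite -Eab in hb.
pose SQ := \sum_j \int[P]_u (tnth (Y u) j * tnth (Y u) j).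
have iSQ : integ P (fun u => \sum_j tnth (Y u) j * tnth (Y u) j).
  by apply: integ_sum => j; exact: iYY.
have ha : \int[P]_u F [tuple (1 + t) * tnth (Y u) j | j < p] <=
    \int[P]_u F (Y u) + t * m1 + 2 * beta * t ^+ 2 * SQ.
  rewrite /SQ -(EEsum (fun j => iYY j j)) -(EEZ _ iSQ) /m1 -(EEZ t (integ_sum iwY)).
  rewrite -(EED iF (integZ t (integ_sum iwY))).
  rewrite -(EED (integD iF (integZ t (integ_sum iwY))) (integZ _ iSQ)).
  apply: EEle.
  - exact: (integ_lse mu p_gt0 beta_gt0 K_ge0 Gs).
  - exact: (integD (integD iF (integZ t (integ_sum iwY))) (integZ _ iSQ)).
  move=> u; have [[j0 vj0] hj0] := vmaxP (fun j => `|tnth (Y u) j|) p_gt0.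
  have hH j : `|tnth (Y u) j| <= `|tnth (Y u) j0| by rewrite -vj0.
  have := lse_taylor2_line p_gt0 beta_gt0 K_ge0 (shifted mu (Y u)) t hH.
  have -> : lse beta K (fun j => shifted mu (Y u) j + t * tnth (Y u) j)
      = F [tuple (1 + t) * tnth (Y u) j | j < p].
    congr lse; apply/funext => j; rewrite /shifted tnth_mktuple; ring.
  rewrite ler_norml => /andP[_].
  rewrite -/(F (Y u)) -/(softmean beta K (shifted mu (Y u)) (tnth (Y u))).
  have hsq : `|tnth (Y u) j0| ^+ 2 <= \sum_j tnth (Y u) j * tnth (Y u) j.
    rewrite real_normK ?num_real// (bigD1 j0)//= expr2 lerDl sumr_ge0// => j _.
    by rewrite -expr2 sqr_ge0.
  have : 2 * beta * `|tnth (Y u) j0| ^+ 2 * t ^+ 2 <=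
      2 * beta * t ^+ 2 * \sum_j tnth (Y u) j * tnth (Y u) j.
    rewrite mulrAC ler_wpM2l// mulr_ge0 ?sqr_ge0// mulr_ge0// ltW//.
  rewrite /softmean.
  move: (F _) (F _) (\sum_j _) (\sum_j _) => a b c e; lra.
move: hb; rewrite -/SQ; have := lse_trace_ge0.
set C3 := \sum_j \int[P]_u _; set tr := lse_trace _ _ _ _ _ _ => tr0.
have C30 : 0 <= C3.
  by apply: sumr_ge0 => j _; apply: Rintegral_ge0 => u _; rewrite exprn_ge0.
have SQ0 : 0 <= SQ.
  by apply: sumr_ge0 => j _; apply: Rintegral_ge0 => u _; rewrite -expr2 sqr_ge0.
move: ha; rewrite -/F.
move: (\int[P]_u F [tuple (1 + t) * tnth (Y u) j | j < p]) (\int[P]_u F (Y u)) => a b ha.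
clear -t0 t1 r2 r0 tr0 C30 SQ0 ha beta_gt0.
move: m1 SQ C3 tr ha SQ0 C30 tr0 => m sq c3 tr ha SQ0 C30 tr0.
rewrite ler_norml => /andP[hb _].
set q := Num.sqrt t.
have q2 : q ^+ 2 = t by rewrite sqr_sqrtr// ltW.
have q0 : 0 <= q by exact: sqrtr_ge0.
have q1 : q <= 1 by rewrite -sqrtr1 ler_wsqrtr.
(* From [t <= 1], [r ^+ 2 <= 3 * t]; hence [r ^+ 3 <= 6 * t * sqrt t], and the 36 is this 6 times
   the 6 of [lse_step]. *)
have rq : r <= 2 * q.
  rewrite -(@ler_pXn2r _ 2) ?nnegrE ?mulr_ge0// r2 exprMn q2; nra.
have r3 : r ^+ 3 <= 6 * t * q.
  rewrite exprSr r2 (@le_trans _ _ ((3 * t) * (2 * q)))//; last by lra.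
  rewrite ler_pM//; nra.
have b2 : 0 <= beta ^+ 2 * c3 by rewrite mulr_ge0// sqr_ge0.
have h1 : 6 * beta ^+ 2 * r ^+ 3 * c3 <= t * (36 * beta ^+ 2 * c3 * q).
  have : (beta ^+ 2 * c3) * r ^+ 3 <= (beta ^+ 2 * c3) * (6 * t * q) by rewrite ler_wpM2l.
  lra.
have h2 : 2 * beta * t ^+ 2 * sq <= t * (2 * beta * sq * q).
  have tq : t <= q by rewrite -q2 expr2 ler_piMr.
  have bs : 0 <= beta * sq * t by rewrite !mulr_ge0// ltW.
  have : (beta * sq * t) * t <= (beta * sq * t) * q by rewrite ler_wpM2l.
  lra.
(* The 2 in [r ^+ 2 = 2 * t + t ^+ 2] cancels the 1/2 of the Taylor expansion; the trace being
   nonnegative, the rest may be dropped. *)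
have h3 : t * (beta * tr) <= r ^+ 2 * (beta / 2) * tr.
  have bt : 0 <= beta * tr * t ^+ 2 by rewrite !mulr_ge0 ?sqr_ge0// ltW.
  rewrite r2; lra.
rewrite -(ler_pM2l t0); lra.
Qed.

Lemma lse_stationarity : beta * lse_trace beta K mu P Y S <= m1.
Proof.
pose c := 2 * beta * \sum_j \int[P]_u (tnth (Y u) j * tnth (Y u) j) +
    36 * beta ^+ 2 * \sum_j \int[P]_u `|tnth (Y u) j| ^+ 3.
have c0 : 0 <= c.
  have b2 : 0 <= 36 * beta ^+ 2 by rewrite mulr_ge0// sqr_ge0.
  have b1 : 0 <= 2 * beta by rewrite mulr_ge0// ltW.
  apply: addr_ge0; apply: mulr_ge0 => //; apply: sumr_ge0 => j _;
    apply: Rintegral_ge0 => u _; first by rewrite -expr2 sqr_ge0.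
  by rewrite exprn_ge0.
apply/ler_addgt0Pr => e e0.
(* Taking [t = q ^+ 2] in [lse_dilation] makes its error [c * q], at most [e]. *)
pose q := Num.min 1 (e / (c + 1)).
have c1 : 0 < c + 1 by rewrite ltr_wpDl.
have q0 : 0 < q by rewrite lt_min ltr01 divr_gt0.
have q1 : q <= 1 by rewrite ge_min lexx.
have := @lse_dilation (q ^+ 2) (exprn_gt0 _ q0) (exprn_ile1 2 (ltW q0) q1).
rewrite sqrtr_sqr ger0_norm ?(ltW q0)// -/c => /le_trans; apply.
rewrite lerD2l (@le_trans _ _ ((c + 1) * q))//.
  by rewrite ler_wpM2r ?(ltW q0)// lerDl.
by rewrite mulrC -ler_pdivlMr// ge_min lexx orbT.
Qed.

End lse_stationarity.

(** * Anti-concentration of Gaussian maxima *)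

Section anti_concentration.
Context (R : realType).

Lemma expR1_le3 : expR 1 <= 3 :> R.
Proof.
have h : expR (8^-1) <= 8 / 7 :> R.
  (* This makes [expR 1] at most [(8 / 7) ^+ 8], which is less than 3. *)
  have h : 7 / 8 <= expR (- 8^-1) :> R by rewrite (le_trans _ (expR_ge1Dx _))//; lra.
  rewrite -[8^-1]opprK expRN -[8 / 7]invf_div lef_pV2 ?posrE ?expR_gt0//.
have -> : 1 = 8%:R * 8^-1 :> R by rewrite divff.
rewrite expRM_natl (@le_trans _ _ ((8 / 7) ^+ 8))//.
  by rewrite lerXn2r ?nnegrE ?expR_ge0// divr_ge0.
lra.
Qed.

Lemma ln_nat_ge1 (p : nat) : (3 <= p)%N -> 1 <= ln p%:R :> R.
Proof.
move=> p3; rewrite -[leLHS]expRK ler_ln ?posrE ?expR_gt0 ?ltr0n ?(leq_trans _ p3)//.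
by rewrite (le_trans expR1_le3)// ler_nat.
Qed.

Context (p : nat) (p_ge3 : (3 <= p)%N).
Let p_gt0 : (0 < p)%N. Proof. exact: leq_trans p_ge3. Qed.

Context d (T : measurableType d) (P : probability T R).

(** All coordinates are bounded at once by one variable [B] of mean of order [sqrt (ln p)], so the
    softmax weights, though dependent on [Y], can be ignored. The square is linearized around
    [l = sqrt (ln p)] and [y ^+ 2 / 4] is compared with the average over [k] of its exponentials,
    each of mean at most [sqrt 2]. *)
Lemma gauss_softmean_le (Y : T -> p.-tuple R) S (beta K : R) (mu : 'I_p -> R) :
  0 < beta -> 0 <= K -> gauss P Y S -> (forall j, S j j = 1) ->
  \int[P]_u (softmean beta K (shifted mu (Y u)) (fun j => tnth (Y u) j))
  <= 6 * Num.sqrt (ln p%:R).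
Proof.
move=> beta0 K0 GY S1.
set l := Num.sqrt (ln p%:R).
have lp1 := ln_nat_ge1 p_ge3.
have l2 : l ^+ 2 = ln p%:R by rewrite sqr_sqrtr// (le_trans _ lp1).
have l1 : 1 <= l by rewrite -sqrtr1 ler_wsqrtr.
have l0 : 0 < l by exact: lt_le_trans l1.
have pR0 : 0 < p%:R :> R by rewrite ltr0n.
pose g k u := expR (tnth (Y u) k ^+ 2 / 4).
have ig k : integ P (g k) /\ \int[P]_u g k u <= Num.sqrt 2.
  have := centered_normal_sqexp (gauss_coord k GY).
  by rewrite S1 mulr1; apply.
have iG : integ P (fun u => \sum_k g k u) by apply: integ_sum => k; case: (ig k).
have EG : \int[P]_u (\sum_k g k u) <= p%:R * Num.sqrt 2.
  rewrite EEsum; last by move=> k; case: (ig k).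
  rewrite (@le_trans _ _ (\sum_(k < p) Num.sqrt 2))//.
    by apply: ler_sum => k _; case: (ig k).
  by rewrite sumr_const card_ord mulr_natl.
have iRHS : integ P (fun u => (l / 2 + 2 / l * ln p%:R) + (2 / l * p%:R^-1) * \sum_k g k u).
  apply: integD; [exact: integ_cst|exact: integZ].
have [mY _ _] := GY.
have iLHS : integ P (fun u => softmean beta K (shifted mu (Y u)) (fun j => tnth (Y u) j)).
  apply: integ_sum => j.
  apply: (integ_dom _ _ (integ_norm (gauss_mean j GY).1)).
    apply: measurable_funM; last exact: (measurableT_comp (measurable_tnth j) mY).
    exact: (measurableT_comp (measurable_softmax beta mu p_gt0 K0 j) mY).
  move=> u; rewrite normrM ler_piMl// ger0_norm ?softmax_ge0//.
  exact: softmax_le1.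
rewrite (@le_trans _ _ (\int[P]_u ((l / 2 + 2 / l * ln p%:R) + (2 / l * p%:R^-1) * \sum_k g k u)))//.
  apply: EEle => // u; set B := _ + _ * _ * \sum_k _.
  have Y_le j : tnth (Y u) j <= B.
    set y := tnth (Y u) j.
    have h1 : y ^+ 2 / 4 <= ln p%:R + p%:R^-1 * \sum_k g k u.
      (* The tangent of the exponential taken at [ln p]: this produces the factor [1 / p] that
         compensates the sum over [k]. *)
      have e1 := expR_ge1Dx (y ^+ 2 / 4 - ln p%:R).
      rewrite expRD expRN lnK ?posrE// (mulrC (expR _)) in e1.
      have e2 : p%:R^-1 * expR (y ^+ 2 / 4) <= p%:R^-1 * \sum_k g k u.
        rewrite ler_wpM2l ?invr_ge0// (bigD1 j)//= lerDl sumr_ge0// => k _.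
        exact: expR_ge0.
      lra.
    have h2 : y <= l / 2 + 2 / l * (y ^+ 2 / 4).
      rewrite -subr_ge0.
      have -> : l / 2 + 2 / l * (y ^+ 2 / 4) - y = (l - y) ^+ 2 / (2 * l).
        by field; rewrite gt_eqF.
      by rewrite divr_ge0 ?sqr_ge0// mulr_ge0// ltW.
    have -> : B = l / 2 + 2 / l * (ln p%:R + p%:R^-1 * \sum_k g k u) by rewrite /B; ring.
    by rewrite (le_trans h2)// lerD2l ler_wpM2l// divr_ge0// ltW.
  have B0 : 0 <= B.
    have l'0 : 0 <= 2 / l by rewrite divr_ge0// ltW.
    have lp0 : 0 <= ln p%:R :> R by exact: le_trans lp1.
    have l20 : 0 <= l / 2 by rewrite divr_ge0// ltW.
    rewrite /B; apply: addr_ge0; first by rewrite addr_ge0// mulr_ge0.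
    apply: mulr_ge0; first by rewrite mulr_ge0// invr_ge0 ltW.
    by apply: sumr_ge0 => k _; exact: expR_ge0.
  rewrite (@le_trans _ _ (\sum_j softmax beta K (shifted mu (Y u)) j * B))//.
    by apply: ler_sum => j _; rewrite ler_wpM2l// softmax_ge0.
  by rewrite -mulr_suml ler_piMl// sum_softmax_le1.
rewrite EED; [|exact: integ_cst|exact: integZ].
rewrite EEcst EEZ// -l2.
have l'0 : 0 <= 2 / l * p%:R^-1 by rewrite mulr_ge0 ?invr_ge0// divr_ge0// ltW.
rewrite (@le_trans _ _ (l / 2 + 2 / l * l ^+ 2 + 2 / l * p%:R^-1 * (p%:R * Num.sqrt 2)))//.
  by rewrite lerD2l ler_wpM2l.
have -> : l / 2 + 2 / l * l ^+ 2 + 2 / l * p%:R^-1 * (p%:R * Num.sqrt 2)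
   = 5 / 2 * l + 2 * Num.sqrt 2 / l.
  by field; rewrite !gt_eqF.
have s2 : Num.sqrt 2 <= 3 / 2 :> R.
  rewrite -(@ler_pXn2r _ 2) ?nnegrE ?divr_ge0// sqr_sqrtr//; lra.
have il : l^-1 <= l by rewrite (le_trans _ l1)// invf_le1.
have s23 : 2 * Num.sqrt 2 <= 3 :> R by lra.
have h1 : 2 * Num.sqrt 2 / l <= 3 / l by rewrite ler_wpM2r// invr_ge0 ltW.
have h2 : 3 / l <= 3 * l by rewrite ler_wpM2l.
lra.
Qed.

(* Stationarity bounds E[s (1 - s)], where s = Z / (1 + Z) and Z is the sum of
   the exponentials; s (1 - s) >= 3 / 16 as long as 1 <= Z <= 3. *)
Lemma gauss_band_le (Y : T -> p.-tuple R) S (beta : R) (mu : 'I_p -> R) (A : set T) :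
  0 < beta -> gauss P Y S -> (forall j, S j j = 1) -> measurable A ->
  (forall u, A u -> 1 <= \sum_j expR (beta * shifted mu (Y u) j) <= 3) ->
  Pr P A <= 32 * Num.sqrt (ln p%:R) / beta.
Proof.
move=> beta0 GY S1 mA hA.
have h := lse_stationarity mu p_gt0 beta0 ler01 GY S1.
have h2 := gauss_softmean_le mu beta0 ler01 GY S1.
have h3 := lse_trace_ge beta mu p_gt0 ler01 GY S1.
set s := (fun u => \sum_j softmax beta 1 (shifted mu (Y u)) j) in h3.
have is_ : integ P s by apply: integ_sum => j; exact: (integ_softmax beta mu p_gt0 ler01 GY j).
have s01 u : 0 <= s u <= 1.
  rewrite sum_softmax_le1// andbT sumr_ge0// => j _; exact: softmax_ge0.
have iss : integ P (fun u => s u * (1 - s u)).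
  apply: (@integ_bounded _ _ _ _ _ 1).
    apply: measurable_funM; first exact: (integ_meas is_).
    exact: (measurable_funB (measurable_cst _) (integ_meas is_)).
  move=> u; have /andP[s0 s1] := s01 u.
  by rewrite ger0_norm ?mulr_ge0 ?subr_ge0// mulr_ile1 ?subr_ge0// lerBlDr lerDl.
have h4 : 3 / 16 * Pr P A <= \int[P]_u (s u * (1 - s u)).
  rewrite PrE// -EEZ; last exact: integ_indic.
  apply: EEle => // [|u]; first by apply: integZ; exact: integ_indic.
  rewrite indicE; have [uA|_] := boolP (u \in A); last first.
    by have /andP[s0 s1] := s01 u; rewrite mulr0 mulr_ge0 ?subr_ge0.
  rewrite inE in uA; have := hA _ uA; rewrite mulr1.
  have -> : s u = (\sum_j expR (beta * shifted mu (Y u) j)) /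
     (1 + \sum_j expR (beta * shifted mu (Y u) j)).
    by rewrite mulr_suml.
  move: (\sum_j _) => x /andP[x1 x3].
  have x0 : 0 < 1 + x by lra.
  have -> : x / (1 + x) * (1 - x / (1 + x)) = x / (1 + x) ^+ 2.
    by field; rewrite gt_eqF.
  rewrite ler_pdivlMr ?exprn_gt0//; nra.
rewrite ler_pdivlMr//.
(* The 32 is [6 * (16 / 3)]. *)
have : 3 / 16 * Pr P A * beta <= 6 * Num.sqrt (ln p%:R).
  rewrite mulrC (le_trans _ h2)// (le_trans _ h)// ler_wpM2l ?(ltW beta0)//.
  exact: le_trans h4 h3.
lra.
Qed.

(** On [A] the logarithm of the sum of exponentials lies between 0 and [ln p + beta * eps]. Cutting
    this range into unit slices and paying [32 * l / beta] for each gives [32 * l * eps] in the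
    limit of large [beta]: the [ln p] overhead is fixed, while the price of a slice shrinks. *)
Lemma gauss_unit_anti_concentration (Y : T -> p.-tuple R) S (mu : 'I_p -> R) (A : set T) (eps : R) :
  gauss P Y S -> (forall j, S j j = 1) -> measurable A -> 0 <= eps ->
  (forall u, A u -> (exists j, 0 <= shifted mu (Y u) j) /\ (forall j, shifted mu (Y u) j <= eps)) ->
  Pr P A <= 32 * Num.sqrt (ln p%:R) * eps.
Proof.
move=> GY S1 mA eps0 hA; have [mY _ _] := GY.
set l := Num.sqrt (ln p%:R).
have l0 : 0 <= l by exact: sqrtr_ge0.
have lp0 : 0 <= ln p%:R :> R by rewrite (le_trans _ (ln_nat_ge1 p_ge3)).
have pR0 : 0 < p%:R :> R by rewrite ltr0n.
have main beta : 0 < beta -> Pr P A <= 32 * l * (eps + (ln p%:R + 1) / beta).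
  move=> beta0.
  pose Z u := \sum_j expR (beta * shifted mu (Y u) j).
  have mZ : measurable_fun setT Z.
    apply: measurable_sum => j; apply: measurableT_comp => //.
    apply: measurable_funM => //; apply: measurable_funD => //.
    exact: (measurableT_comp (measurable_tnth j) mY).
  pose m := (Num.truncn (ln p%:R + beta * eps)).+1.
  pose B (k : nat) := [set u | 1 <= expR (- k%:R) * Z u <= 3].
  have mB k : measurable (B k).
    have -> : B k = [set u | 1 <= expR (- k%:R) * Z u] `&` [set u | expR (- k%:R) * Z u <= 3].
      by apply/seteqP; split => u; [move=> /andP[? ?]; split|
        move=> [? ?]; apply/andP; split].
    have mk : measurable_fun setT (fun u => expR (- k%:R) * Z u) by exact: measurable_funM.
    apply: measurableI; rewrite -[X in measurable X]setTI.
      exact: (measurable_fun_ler (measurable_cst _) mk).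
    exact: (measurable_fun_ler mk (measurable_cst _)).
  have PB (k : nat) : Pr P (B k) <= 32 * l / beta.
    (* Lowering every coordinate by [k / beta] multiplies the sum of exponentials by [expR (- k)],
       which moves slice [k] to the band treated by [gauss_band_le]. *)
    apply: (@gauss_band_le Y S beta (fun j => mu j - k%:R / beta)) => // u.
    have -> : \sum_j expR (beta * shifted (fun j => mu j - k%:R / beta) (Y u) j)
        = expR (- k%:R) * Z u; last by [].
    rewrite /Z mulr_sumr; apply: eq_bigr => j _.
    by rewrite -expRD; congr expR; rewrite /shifted; field; rewrite gt_eqF.
  have AB u : A u -> exists k : 'I_m, B k u.
    move=> /hA[[j0 j0P] hle].
    have Z1 : 1 <= Z u.
      rewrite /Z (bigD1 j0)//= (@le_trans _ _ (expR (beta * shifted mu (Y u) j0)))//.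
        by rewrite -expR0 ler_expR mulr_ge0// ltW.
      by rewrite lerDl sumr_ge0// => j _; exact: expR_ge0.
    have Z0 : 0 < Z u by exact: lt_le_trans Z1.
    have Zle : Z u <= p%:R * expR (beta * eps).
      rewrite /Z (@le_trans _ _ (\sum_(j < p) expR (beta * eps)))//.
        by apply: ler_sum => j _; rewrite ler_expR ler_wpM2l ?(ltW beta0).
      by rewrite sumr_const card_ord mulr_natl.
    have lnZ : ln (Z u) <= ln p%:R + beta * eps.
      rewrite -[X in _ <= _ + X](expRK) -lnM ?posrE ?expR_gt0// ler_ln ?posrE//.
      by rewrite mulr_gt0// expR_gt0.
    have lnZ0 : 0 <= ln (Z u) by exact: ln_ge0.
    pose k := Num.truncn (ln (Z u)).
    have km : (k < m)%N by rewrite /m ltnS; apply: le_truncn.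
    have /andP[k1 k2] : k%:R <= ln (Z u) < k.+1%:R by exact: truncn_itv.
    exists (Ordinal km); rewrite /B /=.
    have -> : expR (- k%:R) * Z u = expR (ln (Z u) - k%:R).
      by rewrite addrC expRD lnK.
    apply/andP; split; first by rewrite -[leLHS]expR0 ler_expR subr_ge0.
    rewrite (le_trans _ expR1_le3)// ler_expR; rewrite -natr1 in k2; lra.
  have PA : Pr P A <= \sum_(k < m) Pr P (B k).
    rewrite PrE//; under eq_bigr do rewrite PrE//.
    have iB (k : 'I_m) : integ P \1_(B k) by exact: integ_indic.
    rewrite -(EEsum iB); apply: EEle; [exact: integ_indic|exact: (integ_sum iB)|move=> u].
    rewrite indicE; have [uA|_] := boolP (u \in A); last first.
      by apply: sumr_ge0 => k _.
    rewrite inE in uA; have [k Bk] := AB _ uA.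
    by rewrite (bigD1 k)//= indicE mem_set// lerDl sumr_ge0.
  rewrite (le_trans PA)// (@le_trans _ _ (\sum_(k < m) (32 * l / beta)))//.
    by apply: ler_sum => k _; exact: PB.
  rewrite sumr_const card_ord -[leLHS]mulr_natl.
  have mle : m%:R <= ln p%:R + beta * eps + 1.
    rewrite /m -natr1 lerD2r.
    have /truncn_itv/andP[]// : 0 <= ln p%:R + beta * eps.
    by rewrite addr_ge0// mulr_ge0// ltW.
  have -> : 32 * l * (eps + (ln p%:R + 1) / beta) = (ln p%:R + beta * eps + 1) * (32 * l / beta).
    by field; rewrite gt_eqF.
  by rewrite ler_wpM2r// divr_ge0 ?(ltW beta0)// mulr_ge0.
apply/ler_addgt0Pr => e e0.
pose c := 32 * l * (ln p%:R + 1).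
have c0 : 0 <= c by rewrite !mulr_ge0// addr_ge0.
have b0 : 0 < (c + 1) / e by rewrite divr_gt0// ltr_wpDl.
rewrite (le_trans (main _ b0))// mulrDr lerD2l mulrA -/c invf_div mulrCA.
by rewrite ler_piMr ?(ltW e0)// ler_pdivrMr ?mul1r ?lerDl// ltr_wpDl.
Qed.

(** Apply the unit-variance case to [(Y j - t) / s j]: the sign of [Y j - t] is kept, and a width
    [eps] becomes at most [eps / sqrt c1]. *)
Lemma gauss_anti_concentration (Y : T -> p.-tuple R) S (c1 t : R) (A : set T) (eps : R) :
  gauss P Y S -> 0 < c1 -> (forall j, c1 <= S j j) -> measurable A -> 0 <= eps ->
  (forall u, A u -> (exists j, t <= tnth (Y u) j) /\ (forall j, tnth (Y u) j <= t + eps)) ->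
  Pr P A <= 32 / Num.sqrt c1 * Num.sqrt (ln p%:R) * eps.
Proof.
move=> GY c10 cS mA eps0 hA.
pose s j := Num.sqrt (S j j).
have S0 j : 0 < S j j by exact: lt_le_trans (cS j).
have s0 j : 0 < s j by rewrite sqrtr_gt0.
have s2 j : s j ^+ 2 = S j j by rewrite sqr_sqrtr// ltW.
have Gs := gauss_scale (fun j => (s j)^-1) GY.
have := @gauss_unit_anti_concentration _ _ (fun j => - ((s j)^-1 * t)) A
  (eps / Num.sqrt c1) Gs _ mA _ _.
have -> : 32 / Num.sqrt c1 * Num.sqrt (ln p%:R) * eps
  = 32 * Num.sqrt (ln p%:R) * (eps / Num.sqrt c1).
  by rewrite -!mulrA; congr (_ * _); rewrite mulrC -!mulrA; congr (_ * _).
apply.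
- by move=> j; rewrite -s2; field; rewrite gt_eqF.
- by rewrite divr_ge0.
move=> u /hA[[j0 hj0] hle].
have E j : shifted (fun j => - ((s j)^-1 * t)) [tuple (s j)^-1 * tnth (Y u) j | j < p] j
   = (s j)^-1 * (tnth (Y u) j - t).
  by rewrite /shifted tnth_mktuple; ring.
split; first by exists j0; rewrite E mulr_ge0 ?subr_ge0// invr_ge0 ltW.
move=> j; rewrite E mulrC.
rewrite (@le_trans _ _ (eps * (s j)^-1))//.
  by rewrite ler_wpM2r ?invr_ge0 ?(ltW (s0 j))// lerBlDl.
rewrite ler_wpM2l// lef_pV2 ?posrE ?sqrtr_gt0//.
exact: ler_wsqrtr.
Qed.

End anti_concentration.

(** * Comparison of distribution functions of Gaussian maxima *)

Section smooth_step.
Context (R : realType) (p : nat) (w L s : R).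
Hypotheses (p_gt0 : (0 < p)%N) (w_gt0 : 0 < w) (L_ge1 : 1 <= L) (lnpL : ln p%:R <= L).
Let beta := L / w.
Let L_gt0 : 0 < L. Proof. exact: lt_le_trans L_ge1. Qed.
Let beta_gt0 : 0 < beta. Proof. exact: divr_gt0. Qed.

(* Smooth decreasing approximation of the indicator of [max v <= s]: the
   difference quotient in [s] of the soft maximum of [v] and [s]. *)
Definition smooth_step (v : 'I_p -> R) : R :=
  w^-1 * (lse beta (expR (beta * (s + w))) v - lse beta (expR (beta * s)) v).

Let stepE (v : 'I_p -> R) : smooth_step v =
  L^-1 * ln ((expR (beta * s) * expR L + \sum_j expR (beta * v j)) /
             (expR (beta * s) + \sum_j expR (beta * v j))).
Proof.
have S0 : 0 <= \sum_j expR (beta * v j) by apply: sumr_ge0 => j _; exact: expR_ge0.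
rewrite ln_div ?posrE ?ltr_pwDl ?mulr_gt0 ?expR_gt0//.
rewrite /smooth_step /lse /lse_sum (mulrDr beta) expRD.
have -> : beta * w = L by rewrite /beta divfK// gt_eqF.
rewrite -mulrBr mulrA; congr (_ * _).
by rewrite /beta invf_div mulrA mulVf ?mul1r// gt_eqF.
Qed.

Lemma smooth_step01 v : 0 <= smooth_step v <= 1.
Proof.
rewrite stepE.
have S0 : 0 <= \sum_j expR (beta * v j) by apply: sumr_ge0 => j _; exact: expR_ge0.
move: (\sum_j _) S0 => S S0.
have a0 := expR_gt0 (beta * s); move: (expR (beta * s)) a0 => a a0.
have aS : 0 < a + S by rewrite ltr_pwDl.
have e1 : 1 <= expR L by rewrite -[leLHS]expR0 ler_expR ltW.
apply/andP; split.
  rewrite mulr_ge0 ?invr_ge0 ?(ltW L_gt0)// ln_ge0// ler_pdivlMr// mul1r lerD2r.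
  by rewrite ler_peMr// ltW.
rewrite mulrC ler_pdivrMr// mul1r -[leRHS]expRK ler_ln ?posrE ?expR_gt0//; last first.
  by rewrite divr_gt0// ltr_pwDl// mulr_gt0// expR_gt0.
rewrite ler_pdivrMr// mulrDr mulrC lerD2l.
by rewrite ler_peMl.
Qed.

(** Each exponential is at most [expR (- 2 * L)] times that of the level [s]. There are
    [p <= expR L] of them, so together they still weigh at most [expR (- L)] of it. *)
Lemma smooth_step_ge v : (forall j, v j <= s - 2 * w) -> 1 - expR (- L) <= smooth_step v.
Proof.
move=> vs; rewrite stepE.
have S0 : 0 <= \sum_j expR (beta * v j) by apply: sumr_ge0 => j _; exact: expR_ge0.
have Sle : \sum_j expR (beta * v j) <= expR (beta * s) * expR (- L).
  rewrite (@le_trans _ _ (\sum_(j < p) expR (beta * s - 2 * L)))//.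
    apply: ler_sum => j _; rewrite ler_expR.
    have -> : beta * s - 2 * L = beta * (s - 2 * w) by rewrite /beta; field; rewrite gt_eqF.
    by rewrite ler_wpM2l// ltW.
  rewrite sumr_const card_ord -[leLHS]mulr_natl -[X in X * _]lnK ?posrE ?ltr0n//.
  rewrite -!expRD ler_expR; have := lnpL; lra.
move: (\sum_j _) S0 Sle => S S0 Sle.
have a0 := expR_gt0 (beta * s); move: (expR (beta * s)) a0 Sle => a a0 Sle.
have aS : 0 < a + S by rewrite ltr_pwDl.
have q0 := expR_gt0 (- L).
have h : ln (expR L / (1 + expR (- L))) <= ln ((a * expR L + S) / (a + S)).
  rewrite ler_ln ?posrE ?divr_gt0 ?expR_gt0 ?ltr_pwDl ?mulr_gt0 ?expR_gt0 ?(ltW q0)//.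
  rewrite ler_pdivrMr ?ltr_pwDl ?(ltW q0)// mulrAC ler_pdivlMr//.
  have eL : expR L * expR (- L) = 1 by rewrite -expRD subrr expR0.
  have e0 := expR_gt0 L.
  have : expR L * S <= expR L * (a * expR (- L)) by rewrite ler_wpM2l// ltW.
  rewrite mulrCA eL mulr1 => h1.
  have : 0 <= S * expR (- L) by rewrite mulr_ge0// ltW.
  have -> : (a * expR L + S) * (1 + expR (- L)) = a * expR L + S + a * (expR L * expR (- L)) + S * expR (- L) by ring.
  rewrite eL; lra.
rewrite ln_div ?posrE ?expR_gt0 ?ltr_pwDl ?(ltW q0)// expRK in h.
have h2 : ln (1 + expR (- L)) <= expR (- L) by rewrite le_ln1Dx// (lt_trans _ q0)// ltrN10.
have h3 : L - expR (- L) <= ln ((a * expR L + S) / (a + S)) by lra.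
rewrite mulrC ler_pdivlMr// (le_trans _ h3)// mulrBl mul1r lerD2l lerN2.
by rewrite ler_peMr// ltW.
Qed.

(** A single exponential outweighs that of the level [s] by [expR (2 * L)], so raising the level by
    [w] barely changes the soft maximum. *)
Lemma smooth_step_le v : (exists j, s + 2 * w <= v j) -> smooth_step v <= expR (- L).
Proof.
move=> [j vs]; rewrite stepE.
have Sge : expR (beta * s) * expR (2 * L) <= \sum_j expR (beta * v j).
  rewrite (bigD1 j)//= (@le_trans _ _ (expR (beta * v j)))//; last first.
    by rewrite lerDl sumr_ge0// => i _; exact: expR_ge0.
  rewrite -expRD ler_expR.
  have -> : beta * s + 2 * L = beta * (s + 2 * w) by rewrite /beta; field; rewrite gt_eqF.
  by rewrite ler_wpM2l// ltW.
move: (\sum_j _) Sge => S Sge.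
have a0 := expR_gt0 (beta * s); move: (expR (beta * s)) a0 Sge => a a0 Sge.
have S0 : 0 < S by rewrite (lt_le_trans _ Sge)// mulr_gt0// expR_gt0.
have aS : 0 < a + S by rewrite addr_gt0.
have eL := expR_gt0 L; have q0 := expR_gt0 (- L).
have h : ln ((a * expR L + S) / (a + S)) <= ln (1 + expR (- L)).
  rewrite ler_ln ?posrE ?divr_gt0 ?addr_gt0 ?mulr_gt0//.
  rewrite ler_pdivrMr//.
  have E : expR L = expR (2 * L) * expR (- L) by rewrite -expRD; congr expR; ring.
  have h1 : a * expR L <= S * expR (- L).
    by rewrite E mulrA ler_wpM2r// ltW.
  have : 0 <= a * expR (- L) by rewrite mulr_ge0// ltW.
  lra.
have h2 : ln (1 + expR (- L)) <= expR (- L) by rewrite le_ln1Dx// (lt_trans _ q0)// ltrN10.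
rewrite mulrC ler_pdivrMr// (le_trans h)// (le_trans h2)//.
by rewrite ler_peMr// ltW.
Qed.

End smooth_step.

Section cdf_comparison.
Context (R : realType) (p : nat) (p_ge3 : (3 <= p)%N).
Let p_gt0 : (0 < p)%N. Proof. exact: leq_trans p_ge3. Qed.

Lemma measurable_orthant d (T : measurableType d) (X : T -> p.-tuple R) (t : R) :
  measurable_fun setT X -> measurable [set u | forall j, tnth (X u) j <= t].
Proof.
move=> mX.
have -> : [set u | forall j, tnth (X u) j <= t] =
    \bigcap_(j in [set: 'I_p]) [set u | tnth (X u) j <= t].
  by apply/seteqP; split => u /= h j; [move=> _; exact: h|exact: h].
apply: fin_bigcap_measurable => // j _; rewrite -[X in measurable X]setTI.
exact: (measurable_fun_ler (measurableT_comp (measurable_tnth j) mX) (measurable_cst _)).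
Qed.

(** The smooth step is centered at [t + 2 * w], so its transition lies between [t] and [t + 4 * w].
    It is [1 / w] times a difference of two [lse], each changing by at most [(L / w) * D] between
    the two vectors; both tails cost [expR (- L)]. *)
Lemma gauss_orthant_shift d1 (T1 : measurableType d1) (P1 : probability T1 R)
    (X : T1 -> p.-tuple R) SX d2 (T2 : measurableType d2) (P2 : probability T2 R)
    (Y : T2 -> p.-tuple R) SY (D w L t : R) :
  gauss P1 X SX -> gauss P2 Y SY -> (forall j k, `|SX j k - SY j k| <= D) ->
  0 < w -> 1 <= L -> ln p%:R <= L ->
  Pr P1 [set u | forall j, tnth (X u) j <= t]
  <= Pr P2 [set u | forall j, tnth (Y u) j <= t + 4 * w]
     + 2 * (L / w ^+ 2) * D + 2 * expR (- L).
Proof.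
move=> GX GY SXY w0 L1 lnpL.
have L0 : 0 < L by exact: lt_le_trans L1.
have beta0 : 0 < L / w by exact: divr_gt0.
have [mX _ _] := GX; have [mY _ _] := GY.
have mA := measurable_orthant t mX; have mB := measurable_orthant (t + 4 * w) mY.
set A := [set u | _] in mA *; set B := [set u | _] in mB *.
pose s := t + 2 * w.
pose f (x : p.-tuple R) := smooth_step w L s (shifted (fun=> 0) x).
pose K1 := expR (L / w * (s + w)); pose K2 := expR (L / w * s).
have K10 : 0 <= K1 by exact: expR_ge0.
have K20 : 0 <= K2 by exact: expR_ge0.
have iX1 := integ_lse (fun=> 0) p_gt0 beta0 K10 GX.
have iX2 := integ_lse (fun=> 0) p_gt0 beta0 K20 GX.
have iY1 := integ_lse (fun=> 0) p_gt0 beta0 K10 GY.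
have iY2 := integ_lse (fun=> 0) p_gt0 beta0 K20 GY.
have ifX : integ P1 (fun u => f (X u)) by apply: integZ; exact: (integB iX1 iX2).
have ifY : integ P2 (fun u => f (Y u)) by apply: integZ; exact: (integB iY1 iY2).
have fXY : \int[P1]_u f (X u) <= \int[P2]_u f (Y u) + 2 * (L / w ^+ 2) * D.
  rewrite /f /smooth_step (EEZ _ (integB iX1 iX2)) (EEB iX1 iX2).
  rewrite (EEZ _ (integB iY1 iY2)) (EEB iY1 iY2).
  have := lse_comparison (fun=> 0) p_gt0 beta0 K10 GX GY SXY.
  have := lse_comparison (fun=> 0) p_gt0 beta0 K20 GX GY SXY.
  rewrite -/K1 -/K2 -lerBlDl -mulrBr.
  move: (Rintegral _ _ _) (Rintegral _ _ _) (Rintegral _ _ _) (Rintegral _ _ _) => a b c e.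
  rewrite !ler_norml => /andP[h1 h2] /andP[h3 h4].
  have -> : 2 * (L / w ^+ 2) * D = w^-1 * (2 * (L / w * D)).
    by field; rewrite gt_eqF.
  rewrite ler_wpM2l ?invr_ge0 ?(ltW w0)//; lra.
have hX : Pr P1 A <= \int[P1]_u f (X u) + expR (- L).
  rewrite PrE// -[X in _ <= _ + X](EEcst P1) -(EED ifX (integ_cst P1 _)).
  apply: EEle => [||u]; [exact: integ_indic|exact: (integD ifX (integ_cst P1 _))|].
  rewrite indicE; have [uA|_] := boolP (u \in A); last first.
    have /andP[f0 _] := smooth_step01 s w0 L1 (shifted (fun=> 0) (X u)).
    by rewrite addr_ge0// expR_ge0.
  rewrite inE in uA; rewrite -lerBlDr; apply: (smooth_step_ge p_gt0 w0 L1 lnpL) => j.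
  by rewrite /shifted add0r /s addrK.
have hY : \int[P2]_u f (Y u) <= Pr P2 B + expR (- L).
  rewrite PrE// -[X in _ <= _ + X](EEcst P2) -(EED (integ_indic P2 mB) (integ_cst P2 _)).
  apply: EEle => [||u]; [exact: ifY|exact: (integD (integ_indic P2 mB) (integ_cst P2 _))|].
  rewrite indicE; have [uB|uB] := boolP (u \in B).
    have /andP[_ f1] := smooth_step01 s w0 L1 (shifted (fun=> 0) (Y u)).
    by rewrite (le_trans f1)// lerDl expR_ge0.
  rewrite add0r; apply: (smooth_step_le w0 L1).
  have [j hj] : exists j, ~ (tnth (Y u) j <= t + 4 * w).
    by apply/existsNP => h; move/negP : uB; apply; rewrite inE.
  exists j; rewrite /shifted add0r /s; move/negP : hj; rewrite -ltNge => /ltW; lra.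
lra.
Qed.

Lemma gauss_cdf_comparison d1 (T1 : measurableType d1) (P1 : probability T1 R)
    (X : T1 -> p.-tuple R) SX d2 (T2 : measurableType d2) (P2 : probability T2 R)
    (Y : T2 -> p.-tuple R) SY (c1 theta t : R) :
  gauss P1 X SX -> gauss P2 Y SY -> (forall j k, `|SX j k - SY j k| <= theta) ->
  0 < c1 -> (forall j, c1 <= SY j j) -> 0 < theta ->
  `|Pr P1 [set u | forall j, tnth (X u) j <= t] -
    Pr P2 [set u | forall j, tnth (Y u) j <= t]|
  <= pi_bound (4 + 128 / Num.sqrt c1) p theta.
Proof.
move=> GX GY SXY c10 cSY theta0.
have [mX _ _] := GX; have [mY _ _] := GY.
have mA := measurable_orthant t mX; have mB := measurable_orthant t mY.
have q0 : 0 <= 128 / Num.sqrt c1 by rewrite divr_ge0.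
have pR0 : 0 < p%:R :> R by rewrite ltr0n.
have lnp1 := ln_nat_ge1 R p_ge3.
set L := Num.max 1 (ln (p%:R / theta)).
have L1 : 1 <= L by rewrite le_max lexx.
have L0 : 0 < L by exact: lt_le_trans L1.
(* In these roots all quantities become monomials: [theta = a ^+ 3], [L = b ^+ 6],
   [sqrt L = b ^+ 3], and the target rate is [a * b ^+ 4]. The 4 counts two units of comparison
   error and two tails; 128 is 32 times the width [4 * w]. *)
pose a := theta `^ (1 / 3); pose b := L `^ (1 / 6).
have e1 (y : R) : 1 `^ y = 1 by rewrite powR1.
have a0 : 0 < a by exact: powR_gt0.
have b1 : 1 <= b by rewrite /b -[leLHS](e1 (1 / 6)) ge0_ler_powR ?nnegrE ?divr_ge0 ?(ltW L0).
have b0 : 0 < b by exact: lt_le_trans b1.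
have a3 : a ^+ 3 = theta.
  by rewrite /a -powR_mulrn ?powR_ge0// -powRrM mul1r mulVf// powRr1// ltW.
have b6 : b ^+ 6 = L.
  by rewrite /b -powR_mulrn ?powR_ge0// -powRrM mul1r mulVf// powRr1// ltW.
have b4 : L `^ (2 / 3) = b ^+ 4.
  by rewrite /b -powR_mulrn ?powR_ge0// -powRrM; congr (_ `^ _); field.
rewrite /pi_bound -/L b4 -/a.
(* For [theta >= 1] the bound is at least 1. For smaller [theta], [L] is [ln (p / theta)], so
   [ln p <= L] and [expR (- L) <= theta]. *)
have [theta1|theta1] := leP 1 theta.
  have a1 : 1 <= a.
    by rewrite /a -[leLHS](e1 (1 / 3)) ge0_ler_powR ?nnegrE ?divr_ge0 ?(ltW theta0).
  have ab : 1 <= a * b ^+ 4 by rewrite -[leLHS]mulr1 ler_pM// exprn_ege1.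
  rewrite (@le_trans _ _ 1)//.
    have := Pr_ge0 P1 [set u | forall j, tnth (X u) j <= t].
    have := Pr_ge0 P2 [set u | forall j, tnth (Y u) j <= t].
    have := Pr_le1 P1 mA; have := Pr_le1 P2 mB.
    by rewrite ler_norml => *; apply/andP; split; lra.
  by rewrite -mulrA -[leLHS]mulr1 ler_pM//; lra.
have lnpL : ln p%:R <= L.
  rewrite le_max; apply/orP; right; rewrite ler_ln ?posrE ?divr_gt0//.
  by rewrite ler_pdivlMr// ler_piMr// ltW.
have LE : L = ln (p%:R / theta).
  apply/max_idPr; rewrite (le_trans lnp1)// ler_ln ?posrE ?divr_gt0//.
  by rewrite ler_pdivlMr// ler_piMr// ltW.
have eL : expR (- L) <= theta.
  rewrite LE expRN lnK ?posrE ?divr_gt0// invf_div ler_pdivrMr// ler_peMr ?(ltW theta0)//.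
  by rewrite ler1n.
(* [w] balances the comparison error [L * theta / w ^+ 2] and the
   anti-concentration error [Num.sqrt L * w]. *)
pose w := a * b.
have w0 : 0 < w by exact: mulr_gt0.
have sb : Num.sqrt (ln p%:R) <= b ^+ 3.
  rewrite -(ger0_norm (exprn_ge0 3 (ltW b0))) -sqrtr_sqr ler_wsqrtr// -exprM.
  by rewrite b6.
have err : 2 * (L / w ^+ 2) * theta = 2 * (a * b ^+ 4).
  by rewrite /w -a3 -b6; field; rewrite !gt_eqF.
have anti (r : R) A : measurable A ->
   (forall u, A u -> (exists j, r <= tnth (Y u) j) /\ (forall j, tnth (Y u) j <= r + 4 * w)) ->
   Pr P2 A <= 128 / Num.sqrt c1 * (a * b ^+ 4).
  move=> mA' hA.
  have w4 : 0 <= 4 * w by rewrite mulr_ge0// ltW.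
  rewrite (le_trans (gauss_anti_concentration p_ge3 GY c10 cSY mA' w4 hA))//.
  have -> : 128 / Num.sqrt c1 * (a * b ^+ 4) = 32 / Num.sqrt c1 * b ^+ 3 * (4 * w).
    by rewrite /w; ring.
  by rewrite ler_wpM2r// ler_wpM2l// divr_ge0.
have ea : expR (- L) <= a * b ^+ 4.
  rewrite (le_trans eL)// -a3 (@le_trans _ _ a)//.
    rewrite -[leRHS]mulr1 exprS ler_wpM2l ?(ltW a0)// exprn_ile1 ?(ltW a0)//.
    by rewrite /a -[leRHS](e1 (1 / 3)) ge0_ler_powR ?nnegrE ?divr_ge0 ?(ltW theta0)// ltW.
  by rewrite ler_peMr ?(ltW a0)// exprn_ege1.
have SYX j k : `|SY j k - SX j k| <= theta by rewrite distrC.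
have diff (r r' : R) : r <= r' ->
   Pr P2 [set u | forall j, tnth (Y u) j <= r'] <=
   Pr P2 [set u | forall j, tnth (Y u) j <= r] +
   Pr P2 ([set u | forall j, tnth (Y u) j <= r'] `\` [set u | forall j, tnth (Y u) j <= r]).
  move=> rr'; have m1 := measurable_orthant r mY; have m2 := measurable_orthant r' mY.
  rewrite (le_trans _ (Pr_setU_le P2 m1 (measurableD m2 m1)))//.
  apply: Pr_le => //; first by apply: measurableU => //; exact: measurableD.
  by move=> u ur'; have [ur|ur] := pselect (forall j, tnth (Y u) j <= r); [left|right].
have far (r : R) : Pr P2 ([set u | forall j, tnth (Y u) j <= r + 4 * w]
    `\` [set u | forall j, tnth (Y u) j <= r]) <= 128 / Num.sqrt c1 * (a * b ^+ 4).
  apply: (anti r).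
    by apply: measurableD; exact: measurable_orthant.
  move=> u [h1 h2]; split => //.
  have [j hj] : exists j, ~ (tnth (Y u) j <= r) by apply/existsNP.
  by exists j; move/negP : hj; rewrite -ltNge => /ltW.
have up := gauss_orthant_shift t GX GY SXY w0 L1 lnpL.
have lo := gauss_orthant_shift (t - 4 * w) GY GX SYX w0 L1 lnpL.
rewrite subrK err in lo; rewrite err in up.
have w4 : 0 <= 4 * w by rewrite mulr_ge0// ltW.
have d1' := diff t (t + 4 * w) ltac:(by rewrite lerDl).
have d2' := diff (t - 4 * w) t ltac:(by rewrite gerBl).
have f1 := far t; have f2 := far (t - 4 * w); rewrite subrK in f2.
have ab0 : 0 <= a * b ^+ 4 by rewrite mulr_ge0 ?exprn_ge0 ?ltW.
rewrite -mulrA ler_norml; apply/andP; split; lra.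
Qed.

End cdf_comparison.

(** * Measurability of maxima *)

Lemma measurable_fun_le_rays (R : realType) d (T : measurableType d) (f : T -> R) :
  (forall t, measurable [set u | f u <= t]) -> measurable_fun setT f.
Proof.
move=> hf; apply: (measurability (@RGenOInfty.G R)) => [|_ [_ [t ->] <-]].
  exact: RGenOInfty.measurableE.
rewrite setTI (_ : _ @^-1` _ = ~` [set u | f u <= t]); first exact: measurableC.
by apply/seteqP; split => u /=; rewrite in_itv/= andbT ltNge => /negP.
Qed.

Lemma vmax_le (R : realType) p (f : 'I_p -> R) t : (0 < p)%N ->
  vmax f <= t <-> forall j, f j <= t.
Proof.
move=> p0; have [[j0 E] h] := vmaxP f p0; split => [ft j|ft].
  exact: le_trans (h j) ft.
by rewrite E.
Qed.

Lemma measurable_vmax (R : realType) p d (T : measurableType d) (f : 'I_p -> T -> R) :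
  (0 < p)%N -> (forall j, measurable_fun setT (f j)) ->
  measurable_fun setT (fun u => vmax (fun j => f j u)).
Proof.
move=> p0 mf; apply: measurable_fun_le_rays => t.
have -> : [set u | vmax (fun j => f j u) <= t] =
    \bigcap_(j in [set: 'I_p]) [set u | f j u <= t].
  apply/seteqP; split => u /= h.
    by move=> j _; exact: ((vmax_le (fun j => f j u) t p0).1 h j).
  by apply: (vmax_le (fun j => f j u) t p0).2 => j; exact: (h j Logic.I).
apply: fin_bigcap_measurable => // j _; rewrite -[X in measurable X]setTI.
exact: (measurable_fun_ler (mf j) (measurable_cst _)).
Qed.

(** * Quantiles *)

Section quantiles.
Context (R : realType) d (T : measurableType d) (P : probability T R)
  (Z : T -> R) (mZ : measurable_fun setT Z).

Let X : {RV P >-> R} := mfun_Sub (mem_set mZ).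
Let H t := Pr P [set w | Z w <= t].

Lemma measurable_le_ray t : measurable [set w | Z w <= t].
Proof.
rewrite -[Y in measurable Y]setTI.
exact: (measurable_fun_ler mZ (measurable_cst _)).
Qed.

Let HE t : cdf X t = (H t)%:E.
Proof.
rewrite EFin_Pr; last exact: measurable_le_ray.
rewrite /cdf /distribution/= /pushforward; congr (P _).
Qed.

Lemma Pr_ray_nd s t : s <= t -> H s <= H t.
Proof.
move=> st; apply: Pr_le; [exact: measurable_le_ray|exact: measurable_le_ray|].
by move=> w /= /le_trans; exact.
Qed.

Let fH : fine \o cdf X = H.
Proof. by apply/funext => t; rewrite /= HE. Qed.

Lemma Pr_ray_gt a : a < 1 -> exists t, a < H t.
Proof.
move=> a1; have := cvg_cdfy1 X => /fine_cvg; rewrite fH => h.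
have [M [_ hM]] := @cvgr_gt _ _ _ _ _ _ h a a1.
by exists (M + 1); apply: hM; rewrite ltrDl.
Qed.

Lemma Pr_ray_lt a : 0 < a -> exists t, H t < a.
Proof.
move=> a0; have := cvg_cdfNy0 X => /fine_cvg; rewrite fH => h.
have [M [_ hM]] := @cvgr_lt _ _ _ _ _ _ h a a0.
by exists (M - 1); apply: hM; rewrite ltrBlDr ltrDl.
Qed.

(* The upward-closed set [{t | a <= H t}] contains its infimum because [H] is
   right-continuous. *)
Lemma quantileP a : 0 < a < 1 -> forall t, (inf [set t | a <= H t] <= t) = (a <= H t).
Proof.
move=> /andP[a0 a1] t; set A := [set t | a <= H t].
have [t1 ht1] := Pr_ray_gt a1; have [t0 ht0] := Pr_ray_lt a0.
have A0 : A !=set0 by exists t1; exact: ltW.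
have lbA : has_lbound A.
  exists t0 => s As; rewrite leNgt; apply/negP => st0.
  by have := Pr_ray_nd (ltW st0); rewrite leNgt (lt_le_trans ht0).
apply/idP/idP => [ct|At]; last exact: ge_inf.
rewrite (le_trans _ (Pr_ray_nd ct))//.
have := @cdf_right_continuous _ _ _ P X (inf A).
rewrite [cdf X (inf A)]HE => /fine_cvg; rewrite fH => h.
apply: (cvgr_to_ge h); near=> s.
have : inf A < s by near: s; exact: nbhs_right_gt.
move=> /(inf_lt A0)[s' As' s's].
exact: le_trans As' (Pr_ray_nd (ltW s's)).
Unshelve. all: by end_near. Qed.

End quantiles.

Section lipschitz_cdf.
Context (R : realType) d (T : measurableType d) (P : probability T R)
  (Z : T -> R) (mZ : measurable_fun setT Z).
Let H t := Pr P [set w | Z w <= t].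
Context (L : R) (L0 : 0 <= L) (HL : forall s t, s <= t -> H t <= H s + L * (t - s)).

(** Just below the quantile [H] is under [a], and the Lipschitz bound excludes a jump. *)
Lemma lipschitz_quantile a : 0 < a < 1 -> H (inf [set t | a <= H t]) = a.
Proof.
move=> a01; set c := inf _; apply/eqP; rewrite eq_le; apply/andP; split.
  apply/ler_addgt0Pr => e e0; have L1 : 0 < L + 1 by rewrite ltr_wpDl.
  set s := c - e / (L + 1); have sc : s < c by rewrite ltrBlDr ltrDl divr_gt0.
  have : H s < a by rewrite ltNge -(quantileP P mZ a01) -ltNge.
  have := HL (ltW sc); rewrite [c - s]subKr.
  have : L * (e / (L + 1)) <= e.
    by rewrite mulrCA ger_pMr// ler_pdivrMr// mul1r lerDl.
  by move: (H c) (H s) (L * _) => x y z; lra.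
by rewrite -(quantileP P mZ a01).
Qed.

Context d' (T' : measurableType d') (Q : probability T' R)
  (X : T' -> R) (mX : measurable_fun setT X) (r : R)
  (XH : forall t, `|Pr Q [set w | X w <= t] - H t| <= r).

Let r0 : 0 <= r. Proof. exact: le_trans (normr_ge0 _) (XH 0). Qed.

Let mHX : measurable_fun setT (H \o X).
Proof.
apply: (measurableT_comp _ mX); apply: nondecreasing_measurable => //.
by move=> s t; exact: (Pr_ray_nd P mZ).
Qed.

Let mle b : measurable [set w | H (X w) <= b].
Proof.
rewrite -[Y in measurable Y]setTI.
exact: (measurable_fun_ler mHX (measurable_cst _)).
Qed.

Let mlt b : measurable [set w | H (X w) < b].
Proof.
rewrite -[Y in measurable Y]setTI.
exact: (measurable_fun_ltr mHX (measurable_cst _)).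
Qed.

Lemma measurable_cdf_band a b : measurable [set w | a <= H (X w) <= b].
Proof.
rewrite (_ : mkset _ = [set w | H (X w) <= b] `\` [set w | H (X w) < a]).
  exact: measurableD.
apply/seteqP; split => w /=.
  by move=> /andP[h1 h2]; split => //; apply/negP; rewrite -leNgt.
by move=> [h1 /negP]; rewrite -leNgt => ->.
Qed.

(** [H] applied to [Z] itself would be uniform. The distribution function of [X] is within [r] of
    [H], and each end of the band costs one [r]. *)
Lemma Pr_cdf_band a b : a <= 1 -> 0 <= b -> a <= b ->
  Pr Q [set w | a <= H (X w) <= b] <= b - a + 2 * r.
Proof.
move=> a1 b0 ab.
have up : Pr Q [set w | H (X w) <= b] <= b + r.
  have [b1|b1] := leP 1 b.
    by rewrite (le_trans (Pr_le1 Q (mle b)))// (le_trans b1)// lerDl.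
  (* A level slightly above [b] and still below 1, where the quantile is exact; being strictly above
     [b] turns [H (X w) <= b] into a bound on [X w]. *)
  apply/ler_addgt0Pr => e e0; set v := Num.min (b + e) ((b + 1) / 2).
  have v01 : 0 < v < 1 by rewrite /v lt_min gt_min; apply/andP; split; lra.
  have bv : b < v by rewrite /v lt_min; apply/andP; split; lra.
  have := lipschitz_quantile v01; set t := inf _ => tv.
  rewrite (@le_trans _ _ (Pr Q [set w | X w <= t]))//.
    apply: Pr_le => //; first exact: measurable_le_ray.
    move=> w /= hw; rewrite leNgt; apply/negP => /ltW /(Pr_ray_nd P mZ).
    by rewrite -/(H t) tv leNgt (le_lt_trans hw bv).
  have := XH t; rewrite tv ler_norml => /andP[_].
  have : v <= b + e by rewrite /v ge_min lexx.
  move: (Pr _ _) => q; lra.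
have lo : a - r <= Pr Q [set w | H (X w) < a].
  have [a0|a0] := leP a 0.
    by rewrite (le_trans _ (Pr_ge0 _ _))// subr_le0 (le_trans a0).
  apply/ler_addgt0Pr => e e0; set v := Num.max (a - e) (a / 2).
  have v01 : 0 < v < 1 by rewrite /v lt_max gt_max; apply/andP; split; lra.
  have va : v < a by rewrite /v gt_max; apply/andP; split; lra.
  have := lipschitz_quantile v01; set t := inf _ => tv.
  have : Pr Q [set w | X w <= t] <= Pr Q [set w | H (X w) < a].
    apply: Pr_le => //; first exact: measurable_le_ray.
    by move=> w /= /(Pr_ray_nd P mZ); rewrite -/(H t) tv => /le_lt_trans; exact.
  have := XH t; rewrite tv ler_norml => /andP[+ _].
  have : a - e <= v by rewrite /v le_max lexx.
  move: (Pr Q [set w | X w <= t]) (Pr Q [set w | H (X w) < a]) => q q'; lra.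
have : Pr Q [set w | H (X w) <= b] =
    Pr Q [set w | a <= H (X w) <= b] + Pr Q [set w | H (X w) < a].
  apply: EFin_inj; rewrite EFinD !EFin_Pr//; last exact: measurable_cdf_band.
  rewrite -measureU//; last 2 first.
  - exact: measurable_cdf_band.
  - apply/seteqP; split => // w [/= /andP[h _]]; by rewrite ltNge h.
  congr (Q _); apply/seteqP; split => w /=.
    by move=> h; have [ha|ha] := leP a (H (X w)); [left; rewrite h|right].
  by move=> [/andP[]//|/ltW /le_trans]; exact.
move: up lo; move: (Pr Q _) (Pr Q _) (Pr Q _) => q q' q''; lra.
Qed.

End lipschitz_cdf.

(* A quantile [cw] of [G] and the [a]-quantile [c0] of [H] separate [t] and
   [t0] differently only if [H t0] is close to [a]. *)
Lemma quantile_sandwich (R : realType) (H G : R -> R) (L z k a c0 cw t t0 : R) :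
  (forall s s', s <= s' -> H s <= H s') ->
  (forall s s', s <= s' -> H s' <= H s + L * (s' - s)) -> 0 <= L ->
  0 <= z -> 0 <= k ->
  (forall s, G s <= H (s + z) + k) -> (forall s, H (s - z) <= G s + k) ->
  H c0 = a -> (forall s, (cw <= s) = (a <= G s)) -> `|t - t0| <= z ->
  (t <= cw /\ ~ t0 <= c0) \/ (t0 <= c0 /\ ~ t <= cw) ->
  a - (k + 2 * L * z) <= H t0 <= a + (k + 2 * L * z).
Proof.
move=> ndH HL L0 z0 k0 GH HG Hc0 Gcw tt0.
have Lz0 : 0 <= L * z by rewrite mulr_ge0.
move: tt0; rewrite ler_norml => /andP[tt0l tt0r].
move=> [[tc /negP]|[t0c /negP]]; rewrite -ltNge => h; apply/andP; split.
- by have := ndH _ _ (ltW h); rewrite Hc0; move: (H t0) => u; lra.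
- apply/ler_addgt0Pr => e e0; have L1 : 0 < L + 1 by rewrite ltr_wpDl.
  (* [G] may jump at [cw], so it is known to be below [a] only strictly to the left; the small
     retreat is absorbed by the Lipschitz bound on [H]. *)
  set s := cw - e / (L + 1); have sc : s < cw by rewrite ltrBlDr ltrDl divr_gt0.
  have Gs : G s < a by rewrite ltNge -Gcw -ltNge.
  have h1 : H t0 <= H (cw + z) by apply: ndH; lra.
  have sz : s - z <= cw + z by lra.
  have h2 := HL _ _ sz; have h3 := HG s.
  have : L * (e / (L + 1)) <= e.
    by rewrite mulrCA ger_pMr// ler_pdivrMr// mul1r lerDl.
  have : L * (cw + z - (s - z)) = L * (e / (L + 1)) + 2 * (L * z) by rewrite /s; ring.
  move: h2; move: (L * (cw + z - (s - z))) (L * (e / (L + 1))) => u v; lra.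
- have h1 : H (cw - z) <= H t0 by apply: ndH; lra.
  have sz : cw - z <= cw + z by lra.
  have h2 := HL _ _ sz; have h3 := GH cw.
  have h4 : a <= G cw by rewrite -Gcw.
  have : L * (cw + z - (cw - z)) = 2 * (L * z) by ring.
  by move: h2; move: (L * (cw + z - (cw - z))) => u; lra.
- by have := ndH _ _ t0c; rewrite Hc0; lra.
Qed.

(** * The multiplier bootstrap *)

Section max_statistics_measurability.
Context (R : realType) d (U : measurableType d).

Lemma measurable_sum_scaled n (c : R) (f : 'I_n -> U -> R) :
  (forall i, measurable_fun setT (f i)) ->
  measurable_fun setT (fun u => c * \sum_i f i u).
Proof.
move=> mf; apply: measurable_funM => //.
exact: (measurable_sum (index_enum _) mf).
Qed.

Lemma measurable_max_scaled_sum n p (f : 'I_n -> 'I_p -> U -> R) : (0 < p)%N ->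
  (forall i j, measurable_fun setT (f i j)) ->
  measurable_fun setT (fun u => max_scaled_sum (fun i j => f i j u)).
Proof.
move=> p0 mf; apply: (measurable_vmax (f := fun j u => (Num.sqrt n%:R)^-1 * \sum_i f i j u)) => // j.
exact: measurable_sum_scaled.
Qed.

End max_statistics_measurability.

Lemma max_scaled_sum_le (R : realType) n p (u : 'I_n -> 'I_p -> R) t : (0 < p)%N ->
  max_scaled_sum u <= t <->
  forall j, tnth [tuple (Num.sqrt n%:R)^-1 * \sum_i u i j | j < p] j <= t.
Proof.
move=> p0; rewrite /max_scaled_sum vmax_le//.
by split => h j; have := h j; rewrite tnth_mktuple.
Qed.

Section gaussian_vectors.
Context (R : realType) d (T : measurableType d) (P : probability T R) (p : nat).

Lemma integ_mul_of_sqr (f g : T -> R) : measurable_fun setT f -> measurable_fun setT g ->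
  integ P (fun w => f w ^+ 2) -> integ P (fun w => g w ^+ 2) ->
  integ P (fun w => f w * g w).
Proof.
move=> mf mg If Ig; apply: (integ_dom _ _ (integD If Ig)).
  exact: measurable_funM.
move=> w; move: (f w) (g w) => a b; rewrite ler_norml; apply/andP.
have := sqr_ge0 (a + b); have := sqr_ge0 (a - b).
have -> : (a + b) ^+ 2 = a ^+ 2 + b ^+ 2 + 2 * (a * b) by ring.
have -> : (a - b) ^+ 2 = a ^+ 2 + b ^+ 2 - 2 * (a * b) by ring.
have := sqr_ge0 a; have := sqr_ge0 b.
by move: (a ^+ 2) (b ^+ 2) (a * b) => u v z; split; lra.
Qed.

(** The quadratic form is the second moment of a linear form of [X], hence nonnegative, as needed to
    read [normal0] as a normal law of that variance. *)
Lemma gauss_of_gaussian_vector (X Y : T -> p.-tuple R) :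
  measurable_fun setT X -> measurable_fun setT Y ->
  (forall j, (fun w => tnth (X w) j) \in Lfun P 2%:E) ->
  gaussian_vector P Y (second_moment_mx P X) ->
  gauss P Y (fun j k => Ex P (fun w => tnth (X w) j * tnth (X w) k)).
Proof.
move=> mX mY X2 GY.
have mXj j : measurable_fun setT (fun w => tnth (X w) j).
  exact: (measurableT_comp (measurable_tnth j) mX).
have IX j k : integ P (fun w => tnth (X w) j * tnth (X w) k).
  by apply: integ_mul_of_sqr => //; exact: Lfun2_integrable_sqr.
split => // [j k|a].
  by rewrite !ExE; apply: eq_Rintegral => w _; rewrite mulrC.
have qfEE : qf (fun j k => Ex P (fun w => tnth (X w) j * tnth (X w) k)) a =
    \int[P]_w (lin a (X w) ^+ 2).
  have -> : (fun w => lin a (X w) ^+ 2) =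
      (fun w => \sum_j \sum_k a j * a k * (tnth (X w) j * tnth (X w) k)).
    apply/funext => w; rewrite expr2 /lin mulr_suml; apply: eq_bigr => j _.
    by rewrite mulr_sumr; apply: eq_bigr => k _; ring.
  rewrite EEsum => [|j]; last by apply: integ_sum => k; exact: integZ.
  apply: eq_bigr => j _; rewrite EEsum => [|k]; last exact: integZ.
  by apply: eq_bigr => k _; rewrite EEZ// ExE.
apply: has_law_centered_normal.
- by apply: measurableT_comp => //; exact: measurable_lin.
- by rewrite qfEE; apply: Rintegral_ge0 => w _; exact: sqr_ge0.
have := GY (\row_j a j).
rewrite (_ : (_ *m _ *m _) 0 0 = qf (fun j k => Ex P (fun w => tnth (X w) j * tnth (X w) k)) a).
  rewrite (_ : (fun w => \sum_j _) = (fun w => lin a (Y w)))//.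
  by apply/funext => w; apply: eq_bigr => j _; rewrite mxE.
rewrite mxE /qf exchange_big/=; apply: eq_bigr => k _; rewrite !mxE mulr_suml.
by apply: eq_bigr => j _; rewrite !mxE mulrAC.
Qed.

End gaussian_vectors.

Section conditional_probability.
Context (R : realType) d (Omega : measurableType d) (P : probability Omega R)
  (n p : nat) (e : 'I_n -> Omega -> R).
Hypothesis me : forall i, measurable_fun setT (e i).
Implicit Types (u : n.-tuple (p.-tuple R)).

Lemma measurable_multipliers : measurable_fun setT (multipliers e).
Proof.
apply/measurable_fun_tnthP => i; rewrite (_ : _ \o _ = e i)//.
by apply/funext => w; rewrite /= tnth_mktuple.
Qed.

Lemma measurable_multipliers_section u A : measurable A ->
  measurable [set w | A (u, multipliers e w)].
Proof.
move=> mA; have mp : measurable_fun setT (fun w => (u, multipliers e w)).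
  by apply: measurable_fun_pair => //; exact: measurable_multipliers.
by have := mp measurableT A mA; rewrite setTI.
Qed.

Lemma measurable_Pe A : measurable A -> measurable_fun setT (@Pe _ _ _ P n p e A).
Proof.
move=> mA; set B := [set z : n.-tuple (p.-tuple R) * Omega | A (z.1, multipliers e z.2)].
have mB : measurable B.
  have mp : measurable_fun setT (fun z : n.-tuple (p.-tuple R) * Omega => (z.1, multipliers e z.2)).
    apply: measurable_fun_pair; first exact: measurable_fst.
    exact: (measurableT_comp measurable_multipliers measurable_snd).
  by have := mp measurableT A mA; rewrite setTI.
(* With the law of [e] on one factor, [Pe] is the probability of a section, so Tonelli-type
   measurability applies. *)
rewrite (_ : Pe P e A = fine \o (P \o xsection B)).
  by apply: measurableT_comp => //; exact: measurable_fun_xsection.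
apply/funext => u; rewrite /Pe /Pr /=; congr (fine (P _)).
by apply/seteqP; split => w; rewrite /xsection/= inE.
Qed.

Lemma Pe_le u A B : measurable A -> measurable B -> A `<=` B -> Pe P e A u <= Pe P e B u.
Proof.
move=> mA mB AB; apply: Pr_le; [exact: measurable_multipliers_section..|].
by move=> w; exact: AB.
Qed.

Lemma Pe_setU_le u A B : measurable A -> measurable B ->
  Pe P e (A `|` B) u <= Pe P e A u + Pe P e B u.
Proof.
by move=> mA mB; apply: Pr_setU_le; exact: measurable_multipliers_section.
Qed.

Context (W : n.-tuple (p.-tuple R) * n.-tuple R -> R) (mW : measurable_fun setT W).

Let mWu u : measurable_fun setT (fun w => W (u, multipliers e w)).
Proof.
apply: (measurableT_comp mW); apply: measurable_fun_pair => //.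
exact: measurable_multipliers.
Qed.

Lemma cW_le a u : 0 < a < 1 -> forall t, (cW P e W a u <= t) = (a <= Pe P e [set z | W z <= t] u).
Proof. by move=> a01 t; rewrite /cW /Pe (quantileP P (mWu u) a01). Qed.

(** By the quantile equivalence, sublevel sets of [cW] are superlevel sets of the measurable
    function [Pe]. *)
Lemma measurable_cW a : 0 < a < 1 -> measurable_fun setT (cW P e W a).
Proof.
move=> a01; apply: measurable_fun_le_rays => t.
rewrite (_ : mkset _ = [set u | a <= Pe P e [set z | W z <= t] u]); last first.
  by apply/seteqP; split => u /=; rewrite cW_le.
rewrite -[X in measurable X]setTI.
exact: (measurable_fun_ler (measurable_cst a) (measurable_Pe (measurable_le_ray mW t))).
Qed.

End conditional_probability.

Section multiplier_bootstrap.
Context (R : realType) (c1 : R) (c1_gt0 : 0 < c1) (n p : nat)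
  (p_ge3 : (3 <= p)%N) d (Omega : measurableType d) (P : probability Omega R).
Context (x y : 'I_n -> Omega -> p.-tuple R) (e : 'I_n -> Omega -> R).
Hypotheses (mx : forall i, measurable_fun setT (x i))
  (my : forall i, measurable_fun setT (y i))
  (me : forall i, measurable_fun setT (e i)).
Hypothesis x_L2 : forall i j, (fun w => tnth (x i w) j) \in Lfun P 2%:E.
Hypothesis y_indep : mutually_independent P y.
Hypothesis y_gauss : forall i, gaussian_vector P (y i) (second_moment_mx P (x i)).
Hypothesis e_indep : mutually_independent P e.
Hypothesis e_normal : forall i, has_law P (e i) (normal_prob 0 1).
Hypothesis moment_ge : forall j : 'I_p,
  c1 <= emp_mean (fun i => Ex P (fun w => tnth (x i w) j ^+ 2)).

Let p_gt0 : (0 < p)%N. Proof. exact: leq_trans p_ge3. Qed.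

Let mxij i j : measurable_fun setT (fun w => tnth (x i w) j).
Proof. exact: (measurableT_comp (measurable_tnth j) (mx i)). Qed.

Let S j k := emp_mean (fun i => Ex P (fun w => tnth (x i w) j * tnth (x i w) k)).

Let Zvec w := [tuple (Num.sqrt n%:R)^-1 * \sum_i tnth (y i w) j | j < p].

Let sqrt_n_sqr : ((Num.sqrt n%:R)^-1 ^+ 2 : R) = n%:R^-1.
Proof. by rewrite exprVn sqr_sqrtr. Qed.

Let gauss_Zvec : gauss P Zvec S.
Proof.
have := gauss_indep_sum (Num.sqrt n%:R)^-1 y_indep
  (fun i => gauss_of_gaussian_vector (mx i) (my i) (x_L2 i) (y_gauss i)).
by rewrite sqrt_n_sqr.
Qed.

Let S_ge j : c1 <= S j j.
Proof.
by rewrite (le_trans (moment_ge j))//.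
Qed.

Let H t := Pr P [set w | Z0 y w <= t].

Let HE t : H t = Pr P [set w | forall j, tnth (Zvec w) j <= t].
Proof. by congr (Pr P _); apply/seteqP; split => w /(max_scaled_sum_le _ _ p_gt0). Qed.

Lemma measurable_Z0 : measurable_fun setT (Z0 y).
Proof.
apply: (measurable_max_scaled_sum (f := fun i j w => tnth (y i w) j)) => // i j.
exact: (measurableT_comp (measurable_tnth j) (my i)).
Qed.

Lemma measurable_data : measurable_fun setT (data x).
Proof.
apply/measurable_fun_tnthP => i; rewrite (_ : _ \o _ = x i)//.
by apply/funext => w; rewrite /= tnth_mktuple.
Qed.

Lemma measurable_T0 : measurable_fun setT (@T0 R n p).
Proof.
apply: (measurable_max_scaled_sum (f := fun i j (u : n.-tuple (p.-tuple R)) => tnth (tnth u i) j)) => // i j.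
exact: (measurableT_comp (measurable_tnth j) (measurable_tnth i)).
Qed.

Lemma measurable_W0 : measurable_fun setT (@W0 R n p).
Proof.
apply: (measurable_max_scaled_sum (f := fun i j (z : n.-tuple (p.-tuple R) * n.-tuple R) =>
  tnth (tnth z.1 i) j * tnth z.2 i)) => // i j.
apply: measurable_funM.
  apply: (measurableT_comp (measurable_tnth j)).
  exact: (measurableT_comp (measurable_tnth i) measurable_fst).
exact: (measurableT_comp (measurable_tnth i) measurable_snd).
Qed.

Lemma measurable_Delta : measurable_fun setT (Delta P x).
Proof.
apply: (measurable_vmax (f := fun j w => vmax (fun k => `|emp_mean (fun i => tnth (x i w) j * tnth (x i w) k) - S j k|))) => // j.
apply: (measurable_vmax (f := fun k w => `|emp_mean (fun i => tnth (x i w) j * tnth (x i w) k) - S j k|)) => // k.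
apply: measurableT_comp => //; apply: measurable_funB => //.
apply: (@measurable_sum_scaled _ _ _ _ _ (fun i w => tnth (x i w) j * tnth (x i w) k)) => i.
exact: measurable_funM.
Qed.

(** The Lipschitz constant that anti-concentration gives to the distribution function of [Z0]. *)
Definition lip : R := 32 / Num.sqrt c1 * Num.sqrt (ln p%:R).

Lemma lip_ge0 : 0 <= lip.
Proof. by rewrite mulr_ge0 ?divr_ge0. Qed.

Lemma Z0_cdf_lipschitz s t : s <= t -> H t <= H s + lip * (t - s).
Proof.
move=> st; have [mZ _ _] := gauss_Zvec.
have ms := measurable_le_ray measurable_Z0 s.
have mt := measurable_le_ray measurable_Z0 t.
have := gauss_anti_concentration (t := s) (eps := t - s) p_ge3 gauss_Zvec c1_gt0 S_ge (measurableD mt ms).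
rewrite subr_ge0 => /(_ st) anti.
rewrite (@le_trans _ _ (H s + Pr P ([set w | Z0 y w <= t] `\` [set w | Z0 y w <= s])))//.
  rewrite (le_trans _ (Pr_setU_le P ms (measurableD mt ms)))//.
  apply: Pr_le => //; first by apply: measurableU => //; exact: measurableD.
  by move=> w wt; have [ws|ws] := pselect (Z0 y w <= s); [left|right].
rewrite lerD2l; apply: anti => w [/= /(max_scaled_sum_le _ _ p_gt0) h1 h2].
rewrite addrC subrK; split => //; apply: contra_notP h2 => h2.
apply/(max_scaled_sum_le _ _ p_gt0) => j; rewrite leNgt; apply/negP => h3.
by apply: h2; exists j; exact: ltW.
Qed.

(** The outcome [w] freezes the data and a second outcome drives the multipliers. [W0] is then the
    maximum of a Gaussian vector whose covariance is within [theta] of that of [Z0]. *)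
Lemma multiplier_cdf_approx theta w t : 0 < theta -> Delta P x w <= theta ->
  `|Pe P e [set z | W0 z <= t] (data x w) - H t| <= pi_bound (4 + 128 / Num.sqrt c1) p theta.
Proof.
move=> theta0 /(vmax_le _ _ p_gt0) hD.
have e_centered i : centered_normal P (e i) 1.
  apply: has_law_centered_normal => //; rewrite /normal0 oner_eq0 sqrtr1.
  exact: e_normal.
have Ge := gauss_multipliers (fun i j => tnth (x i w) j) (Num.sqrt n%:R)^-1 e_indep e_centered.
have dS j k : `|(Num.sqrt n%:R)^-1 ^+ 2 * \sum_i tnth (x i w) j * tnth (x i w) k - S j k| <= theta.
  rewrite sqrt_n_sqr; exact: ((vmax_le _ _ p_gt0).1 (hD j) k).
have := gauss_cdf_comparison p_ge3 t Ge gauss_Zvec dS c1_gt0 S_ge theta0.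
rewrite -HE; congr (`|Pr P _ - _| <= _).
apply/seteqP; split => w' /=.
  move=> h; apply/(max_scaled_sum_le _ _ p_gt0) => j; have := h j.
  rewrite !tnth_mktuple; under [in X in X -> _]eq_bigr do rewrite -[x _ w](tnth_mktuple (fun i => x i w)).
  by under [in X in X -> _]eq_bigr do rewrite -[e _ w'](tnth_mktuple (fun i => e i w')).
move=> /(max_scaled_sum_le _ _ p_gt0) h j; have := h j.
rewrite !tnth_mktuple /=; under [in X in X -> _]eq_bigr do rewrite !tnth_mktuple.
by [].
Qed.

Let m_T0_data : measurable_fun setT (fun w => T0 (data x w)).
Proof. exact: (measurableT_comp measurable_T0 measurable_data). Qed.

Lemma rho_ub t : `|Pr P [set w | T0 (data x w) <= t] - H t| <= rho P x y.
Proof.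
rewrite /rho; apply: ub_le_sup; last by exists t.
(* A real [sup] bounds its elements only when the set is bounded above, here by 1. *)
exists 1 => _ [s _ <-].
have := Pr_le1 P (measurable_le_ray m_T0_data s); have := Pr_ge0 P [set w | T0 (data x w) <= s].
have := Pr_le1 P (measurable_le_ray measurable_Z0 s); have := Pr_ge0 P [set w | Z0 y w <= s].
move: (Pr _ _) (Pr _ _) => a b; rewrite ler_norml => *; apply/andP; split; lra.
Qed.

Lemma Z0_quantile alpha : 0 < alpha < 1 -> H (cZ0 P y alpha) = alpha.
Proof. exact: (lipschitz_quantile measurable_Z0 lip_ge0 Z0_cdf_lipschitz). Qed.

Context (T : n.-tuple (p.-tuple R) -> R) (mT : measurable_fun setT T)
  (W : n.-tuple (p.-tuple R) * n.-tuple R -> R) (mW : measurable_fun setT W).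

Lemma measurable_symdiff alpha : 0 < alpha < 1 ->
  measurable ([set w | T (data x w) <= cW P e W alpha (data x w)]
              `+` [set w | T0 (data x w) <= cZ0 P y alpha]) /\
  measurable [set w | T (data x w) <= cW P e W alpha (data x w)].
Proof.
move=> a01; have m1 : measurable [set w | T (data x w) <= cW P e W alpha (data x w)].
  rewrite -[X in measurable X]setTI.
  exact: (measurable_fun_ler (measurableT_comp mT measurable_data)
    (measurableT_comp (measurable_cW P me mW a01) measurable_data)).
have m2 := measurable_le_ray m_T0_data (cZ0 P y alpha).
by split; [apply: measurableU; exact: measurableD|].
Qed.

Context (zeta1 zeta2 : R) (zeta1_ge0 : 0 <= zeta1) (zeta2_ge0 : 0 <= zeta2)
  (T_approx : Pr P [set w | zeta1 < `|T (data x w) - T0 (data x w)|] < zeta2)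
  (W_approx :
     Pr P [set w | zeta2 < Pe P e [set z | zeta1 < `|W z - W0 z|] (data x w)] < zeta2).

Let mWW0 : measurable [set z | zeta1 < `|W z - W0 z|].
Proof.
have mD : measurable_fun setT (fun z => `|W z - W0 z|).
  by apply: measurableT_comp => //; apply: measurable_funB => //; exact: measurable_W0.
rewrite -[X in measurable X]setTI; exact: (measurable_fun_ltr (measurable_cst _) mD).
Qed.

(** Where [W] and [W0] are within [zeta1], their rays are nested after a shift by [zeta1]; the
    remaining set has conditional probability at most [zeta2]. *)
Lemma Pe_approx u t : Pe P e [set z | zeta1 < `|W z - W0 z|] u <= zeta2 ->
  Pe P e [set z | W z <= t] u <= Pe P e [set z | W0 z <= t + zeta1] u + zeta2 /\
  Pe P e [set z | W0 z <= t - zeta1] u <= Pe P e [set z | W z <= t] u + zeta2.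
Proof.
move=> hu; have mW0 := measurable_W0.
split.
  have mr := measurable_le_ray mW0 (t + zeta1).
  rewrite (@le_trans _ _ (Pe P e ([set z | W0 z <= t + zeta1] `|` [set z | zeta1 < `|W z - W0 z|]) u))//.
    apply: (Pe_le P me _ (measurable_le_ray mW t) (measurableU _ _ mr mWW0)) => z /= hz.
    have [h|h] := ltP zeta1 `|W z - W0 z|; [by right|left].
    by move: h; rewrite ler_norml => /andP[+ _]; move: hz => /=; lra.
  by rewrite (le_trans (Pe_setU_le P me u mr mWW0))// lerD2l.
have mr := measurable_le_ray mW t.
rewrite (@le_trans _ _ (Pe P e ([set z | W z <= t] `|` [set z | zeta1 < `|W z - W0 z|]) u))//.
  apply: (Pe_le P me _ (measurable_le_ray mW0 (t - zeta1)) (measurableU _ _ mr mWW0)) => z /= hz.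
  have [h|h] := ltP zeta1 `|W z - W0 z|; [by right|left].
  by move: h; rewrite ler_norml => /andP[_]; move: hz => /=; lra.
by rewrite (le_trans (Pe_setU_le P me u mr mWW0))// lerD2l.
Qed.

Lemma pi_bound_ge0 theta : 0 <= pi_bound (4 + 128 / Num.sqrt c1) p theta.
Proof. by rewrite !mulr_ge0 ?powR_ge0// addr_ge0// divr_ge0. Qed.

(** A union bound over three exceptional events and the band [N]. The band has width [2 * r] and
    adds [2 * rho]; its share of [zeta2] is 2, and [B2] and [B3] add one each, hence 4. *)
Lemma Pr_symdiff_le theta alpha : 0 < theta -> 0 < alpha < 1 ->
  Pr P ([set w | T (data x w) <= cW P e W alpha (data x w)]
        `+` [set w | T0 (data x w) <= cZ0 P y alpha])
  <= 2 * (rho P x y + pi_bound (4 + 128 / Num.sqrt c1) p theta)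
     + Pr P [set w | theta < Delta P x w] + 4 * lip * zeta1 + 4 * zeta2.
Proof.
move=> theta0 a01; set pi_ := pi_bound _ _ _.
have pi0 : 0 <= pi_ by exact: pi_bound_ge0.
(* [k] is the vertical error between the conditional distribution function of [W] and that of [Z0].
   The term [2 * lip * zeta1] of [r] pays for the horizontal errors of [W] and [T]. *)
set k := zeta2 + pi_; have k0 : 0 <= k by rewrite addr_ge0.
set r := k + 2 * lip * zeta1.
have l0 := lip_ge0.
have lz0 : 0 <= lip * zeta1 by rewrite mulr_ge0.
set B1 := [set w | theta < Delta P x w].
set B2 := [set w | zeta2 < Pe P e [set z | zeta1 < `|W z - W0 z|] (data x w)].
set B3 := [set w | zeta1 < `|T (data x w) - T0 (data x w)|].
set N := [set w | alpha - r <= H (T0 (data x w)) <= alpha + r].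
have mB1 : measurable B1.
  rewrite -[X in measurable X]setTI.
  exact: (measurable_fun_ltr (measurable_cst _) measurable_Delta).
have mB2 : measurable B2.
  rewrite -[X in measurable X]setTI.
  exact: (measurable_fun_ltr (measurable_cst _)
    (measurableT_comp (measurable_Pe P me mWW0) measurable_data)).
have mB3 : measurable B3.
  have mD : measurable_fun setT (fun w => `|T (data x w) - T0 (data x w)|).
    apply: measurableT_comp => //; apply: measurable_funB => //.
    exact: (measurableT_comp mT measurable_data).
  rewrite -[X in measurable X]setTI.
  exact: (measurable_fun_ltr (measurable_cst _) mD).
have mN : measurable N by exact: (measurable_cdf_band P measurable_Z0 m_T0_data).
have mB3N := measurableU _ _ mB3 mN; have mB23N := measurableU _ _ mB2 mB3N.
have [mE _] := measurable_symdiff a01.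
have sub : [set w | T (data x w) <= cW P e W alpha (data x w)]
    `+` [set w | T0 (data x w) <= cZ0 P y alpha] `<=` B1 `|` (B2 `|` (B3 `|` N)).
  move=> w Ew; have [w1|w1] := ltP theta (Delta P x w); first by left.
  right; have [w2|w2] := ltP zeta2 (Pe P e [set z | zeta1 < `|W z - W0 z|] (data x w)); first by left.
  right; have [w3|w3] := ltP zeta1 `|T (data x w) - T0 (data x w)|; first by left.
  right; have appr t := multiplier_cdf_approx t theta0 w1.
  apply: (quantile_sandwich (G := fun t => Pe P e [set z | W z <= t] (data x w)) (fun s s' => @Pr_ray_nd _ _ _ P _ measurable_Z0 s s')
    Z0_cdf_lipschitz l0 zeta1_ge0 k0 _ _ (Z0_quantile a01) (cW_le P me mW (data x w) a01) w3) => [t|t|].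
  - rewrite -/(H (t + zeta1)); have [h _] := Pe_approx t w2; have := appr (t + zeta1).
    rewrite ler_norml -/pi_ /k => /andP[_]; move: h.
    move: (Pe _ _ _ _) (Pe _ _ _ _) (H _) => a b c; lra.
  - rewrite -/(H (t - zeta1)); have [_ h] := Pe_approx t w2; have := appr (t - zeta1).
    rewrite ler_norml -/pi_ /k => /andP[+ _]; move: h.
    move: (Pe _ _ _ _) (Pe _ _ _ _) (H _) => a b c; lra.
  - exact: Ew.
have r0 : 0 <= r by rewrite /r; lra.
have /andP[a0 a1] := a01.
have hN : Pr P N <= alpha + r - (alpha - r) + 2 * rho P x y.
  apply: (Pr_cdf_band measurable_Z0 l0 Z0_cdf_lipschitz m_T0_data rho_ub); lra.
have := Pr_le P mE (measurableU _ _ mB1 mB23N) sub.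
have := Pr_setU_le P mB1 mB23N; have := Pr_setU_le P mB2 mB3N.
have := Pr_setU_le P mB3 mN.
move: T_approx W_approx; rewrite -/B2 -/B3.
move: hN; rewrite /r /k; move: (Pr P _) (Pr P _) (Pr P _) (Pr P _) (Pr P _) (Pr P _) (Pr P _) (Pr P _).
have -> : 2 * lip * zeta1 = 2 * (lip * zeta1) by ring.
have -> : 4 * lip * zeta1 = 4 * (lip * zeta1) by ring.
move: (rho _ _ _) (lip * _) => *; lra.
Qed.

End multiplier_bootstrap.

(** * Constants and conclusion *)

Lemma lip_zeta_bound (R : realType) (c1 : R) (p : nat) (zeta : R) : (0 < p)%N ->
  0 <= zeta <= 1 ->
  lip c1 p * zeta <= 32 / Num.sqrt c1 * zeta_bound p zeta.
Proof.
move=> p0 /andP[z0 z1]; have [->|zN0] := eqVneq zeta 0.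
  by rewrite /zeta_bound mul0r !mulr0.
have zp : 0 < zeta by rewrite lt0r zN0.
rewrite /lip /zeta_bound -[leLHS]mulrA ler_wpM2l ?divr_ge0// [leLHS]mulrC ler_wpM2l//.
rewrite ler_wsqrtr// le_max; apply/orP; right.
have p0R : 0 < p%:R :> R by rewrite ltr0n.
by rewrite ler_ln ?posrE ?divr_gt0// ler_pdivlMr// ler_piMr// ltW.
Qed.

Theorem theorem3p2 (R : realType) (c1 C1 : R) (c1_gt0 : 0 < c1)
    (c1_lt_C1 : c1 < C1) :
  exists C2 C3 : R, 0 < C2 /\ 0 < C3 /\
  forall (n p : nat) (n_ge1 : (1 <= n)%N) (p_ge3 : (3 <= p)%N)
    (d : measure_display) (Omega : measurableType d) (P : probability Omega R)
    (x y : 'I_n -> {RV P >-> (p.-tuple R)%type}) (e : 'I_n -> {RV P >-> R})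
    (T : {mfun n.-tuple (p.-tuple R) >-> R})
    (W : {mfun (n.-tuple (p.-tuple R) * n.-tuple R)%type >-> R})
    (zeta1 zeta2 : R)
    (x_indep : mutually_independent P (fun i => x i : Omega -> p.-tuple R))
    (x_L2 : forall i j, (fun w => tnth (x i w) j) \in Lfun P 2%:E)
    (x_mean0 : forall i j, Ex P (fun w => tnth (x i w) j) = 0)
    (y_indep : mutually_independent P (fun i => y i : Omega -> p.-tuple R))
    (y_gauss : forall i, gaussian_vector P (y i) (second_moment_mx P (x i)))
    (e_indep : mutually_independent P (fun i => e i : Omega -> R))
    (e_normal : forall i, has_law P (e i) (normal_prob 0 1))
    (xe_indep : independent P (data x) (multipliers e))
    (moment_bounds : forall j : 'I_p,
       c1 <= emp_mean (fun i => Ex P (fun w => tnth (x i w) j ^+ 2)) <= C1)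
    (zeta1_ge0 : 0 <= zeta1) (zeta2_ge0 : 0 <= zeta2)
    (T_approx :
       Pr P [set w | zeta1 < `|T (data x w) - T0 (data x w)|] < zeta2)
    (W_approx :
       Pr P [set w | zeta2 < Pe P e [set z | zeta1 < `|W z - W0 z|] (data x w)]
       < zeta2),
  (forall theta : R, 0 < theta ->
     rho_ominus P x y e T W
     <= 2 * (rho P x y + pi_bound C2 p theta
             + Pr P [set w | theta < Delta P x w])
        + C3 * zeta_bound p zeta1 + 5 * zeta2)
  /\ sup [set `|Pr P [set w | T (data x w) <= cW P e W alpha (data x w)] - alpha|
         | alpha in `]0, 1[]
     <= rho_ominus P x y e T W + rho P x y.
Proof.
set Ca := 32 / Num.sqrt c1; have Ca0 : 0 <= Ca by rewrite divr_ge0.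
(* The summand 1 makes the second constant at least 1, so that the [zeta1] term alone exceeds any
   probability when [zeta1 > 1]. *)
exists (4 + 128 / Num.sqrt c1), (4 * Ca + 1); split.
  by rewrite ltr_wpDr// divr_ge0.
split; first by rewrite ltr_wpDl// mulr_ge0.
move=> n p n_ge1 p_ge3 d Omega P x y e T W zeta1 zeta2 _ x_L2 _ y_indep y_gauss
  e_indep e_normal _ moment_bounds zeta1_ge0 zeta2_ge0 T_approx W_approx.
have p_gt0 : (0 < p)%N by exact: leq_trans p_ge3.
have mx i : measurable_fun setT (x i) by exact: measurable_funPT.
have my i : measurable_fun setT (y i) by exact: measurable_funPT.
have me i : measurable_fun setT (e i) by exact: measurable_funPT.
have mT : measurable_fun setT T by exact: measurable_funPT.
have mW : measurable_fun setT W by exact: measurable_funPT.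
have moment_ge j : c1 <= emp_mean (fun i => Ex P (fun w => tnth (x i w) j ^+ 2)).
  by have /andP[] := moment_bounds j.
pose E alpha := [set w | T (data x w) <= cW P e W alpha (data x w)]
                `+` [set w | T0 (data x w) <= cZ0 P y alpha].
have mE alpha : 0 < alpha < 1 -> measurable (E alpha).
  by move=> a01; have [] := measurable_symdiff p_ge3 P y mx me mT mW a01.
have ubE alpha : 0 < alpha < 1 -> Pr P (E alpha) <= rho_ominus P x y e T W.
  move=> a01; apply: ub_le_sup; last by exists alpha => //=; rewrite in_itv.
  exists 1 => _ [a + <-]; rewrite /= in_itv/= => a01'; exact: (Pr_le1 P (mE a a01')).
(* Bounding a real [sup] from above by its elements requires a nonempty set of levels. *)
have half01 : `]0, 1[%classic (2^-1 : R) by rewrite /= in_itv/=; apply/andP; split; lra.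
split.
  move=> theta theta0; apply: ge_sup; first by exists (Pr P (E 2^-1)), 2^-1.
  move=> _ [a + <-]; rewrite /= in_itv/= => a01; rewrite -/(E a).
  have rho0 : 0 <= rho P x y.
    exact: le_trans (normr_ge0 _) (rho_ub p_ge3 P mx my 0).
  have pi0 := pi_bound_ge0 c1 p theta.
  have Pr0 := Pr_ge0 P [set w | theta < Delta P x w].
  have [z1|z1] := leP zeta1 1.
    have z01 : 0 <= zeta1 <= 1 by rewrite zeta1_ge0.
    have := lip_zeta_bound c1 p_gt0 z01.
    have := Pr_symdiff_le c1_gt0 p_ge3 mx my me x_L2 y_indep y_gauss e_indep
      e_normal moment_ge mT mW zeta1_ge0 zeta2_ge0 T_approx W_approx theta0 a01.
    have : 0 <= zeta_bound p zeta1 by rewrite /zeta_bound mulr_ge0.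
    rewrite -/(E a) -/Ca.
    move: (Pr P (E a)) (rho _ _ _) (pi_bound _ _ _) (Pr _ _) (zeta_bound _ _) rho0 pi0 Pr0.
    have -> : 4 * lip c1 p * zeta1 = 4 * (lip c1 p * zeta1) by ring.
    move: (lip _ _ * _) => l q r pi_ Q z rho0 pi0 Q0 z0 h1 h2.
    have -> : (4 * Ca + 1) * z = 4 * (Ca * z) + z by ring.
    by move: (Ca * z) h2 => v; lra.
  have := Pr_le1 P (mE a a01).
  have zb : 1 <= zeta_bound p zeta1.
    rewrite /zeta_bound (le_trans (ltW z1))// ler_peMr//.
    by rewrite -[leLHS]sqrtr1 ler_wsqrtr// le_max lexx.
  have : 1 <= (4 * Ca + 1) * zeta_bound p zeta1.
    by rewrite (le_trans zb)// ler_peMl ?(le_trans ler01 zb)// lerDr mulr_ge0.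
  move: (Pr P (E a)) (rho _ _ _) (pi_bound _ _ _) (Pr _ _) (_ * zeta_bound _ _) rho0 pi0 Pr0.
  by move=> *; lra.
apply: ge_sup.
  by exists `|Pr P [set w | T (data x w) <= cW P e W 2^-1 (data x w)] - 2^-1|, 2^-1.
move=> _ [a + <-]; rewrite /= in_itv/= => a01.
have [_ m1] := measurable_symdiff p_ge3 P y mx me mT mW a01.
have m2 := measurable_le_ray (measurableT_comp (@measurable_T0 R n p p_ge3) (measurable_data mx)) (cZ0 P y a).
have := rho_ub p_ge3 P mx my (cZ0 P y a); cbv beta.
(* The quantile of [Z0] is exact, so [T0] stays below it with probability within [rho] of the level;
   the symmetric difference pays for the passage to [T]. *)
have Hc := Z0_quantile c1_gt0 p_ge3 mx my x_L2 y_indep y_gauss moment_ge a01; cbv beta in Hc; rewrite Hc.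
have := ubE a a01.
have h1 : Pr P [set w | T (data x w) <= cW P e W a (data x w)] <=
    Pr P [set w | T0 (data x w) <= cZ0 P y a] + Pr P (E a).
  rewrite (le_trans _ (Pr_setU_le P m2 (mE a a01)))//.
  apply: (Pr_le P m1 (measurableU _ _ m2 (mE a a01))) => w w1.
  by have [w2|w2] := pselect (T0 (data x w) <= cZ0 P y a); [left|right; left].
have h2 : Pr P [set w | T0 (data x w) <= cZ0 P y a] <=
    Pr P [set w | T (data x w) <= cW P e W a (data x w)] + Pr P (E a).
  rewrite (le_trans _ (Pr_setU_le P m1 (mE a a01)))//.
  apply: (Pr_le P m2 (measurableU _ _ m1 (mE a a01))) => w w2.
  by have [w1|w1] := pselect (T (data x w) <= cW P e W a (data x w)); [left|right; right].
move: h1 h2; rewrite !ler_norml.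
move: (Pr P (E a)) (Pr P [set w | T (data x w) <= cW P e W a (data x w)])
  (Pr P [set w | T0 (data x w) <= cZ0 P y a]) => q q1 q2.
move: (rho _ _ _) (rho_ominus _ _ _ _ _ _) => r ro h1 h2 h3 /andP[h4 h5].
by apply/andP; split; lra.
Qed.
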